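(* Every traveling solitary wave in $H^1_+(\mathbb{R})$ for the equation $$i\partial_t u+\partial_{xx}u+(D+|D|)(|u|^2)\,u=0$$ is of the form $$u(t,x)=e^{i\theta+i\eta x-i\eta^2t}\,\lambda^{1/2}\,\mathcal{R}\big(\lambda(x-2\eta t)+y\big)$$ with some $\theta\in[0,2\pi)$, $y\in\mathbb{R}$, $\lambda>0$ and $\eta\ge0$, where $\mathcal{R}(x)=\frac{\sqrt2}{x+i}$. In particular, every traveling solitary wave $u(t)\in H^1_+(\mathbb{R})$ has $L^2$-mass $M(u)=\int_{\mathbb{R}}|u|^2\,dx=M(\mathcal{R})=2\pi$.
   Context: $D=-i\partial_x$; $|D|$ is the Fourier multiplier with symbol $|\xi|$; $H^1_+(\mathbb{R})=\{f\in H^1(\mathbb{R}):\operatorname{supp}\hat f\subset[0,\infty)\}$. A traveling solitary wave in $H^1_+(\mathbb{R})$ is a solution (in the sense of distributions, for all $t\in\mathbb R$) of the form $u(t,x)=e^{i\omega t}\,\mathcal{R}_{v,\omega}(x-vt)$ with some $\omega\in\mathbb{R}$ (frequency), $v\in\mathbb{R}$ (velocity), and a profile $\mathcal{R}_{v,\omega}\in H^1_+(\mathbb{R})$, $\mathcal{R}_{v,\omega}\not\equiv0$, which may depend on $v$ and $\omega$. *)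

(* Defs.v *)
From HB Require Import structures.
From mathcomp Require Import all_boot all_order all_algebra.
From mathcomp Require Import complex.
From mathcomp Require Import all_classical all_reals all_analysis.

Set Implicit Arguments.
Unset Strict Implicit.
Unset Printing Implicit Defensive.

Import Order.TTheory GRing.Theory Num.Theory.
Import numFieldTopology.Exports numFieldNormedType.Exports.

Local Open Scope classical_set_scope.
Local Open Scope ring_scope.
Local Open Scope complex_scope.

Definition normsq (R : realType) (z : R[i]) : R :=
  complex.Re z ^+ 2 + complex.Im z ^+ 2.

(* exp (i theta) *)
Definition expi (R : realType) (theta : R) : R[i] := cos theta +i* sin theta.

Definition cintegral (R : realType) (A : set R) (f : R -> R[i]) : R[i] :=
  Rintegral (@lebesgue_measure R) A (fun x => complex.Re (f x)) +i*
  Rintegral (@lebesgue_measure R) A (fun x => complex.Im (f x)).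

Definition cmeasurable (R : realType) (f : R -> R[i]) : Prop :=
  measurable_fun setT (fun x => complex.Re (f x)) /\
  measurable_fun setT (fun x => complex.Im (f x)).

(* Elements of L^2, H^1, H^1_+ are represented by measurable functions, to be
   identified when they agree almost everywhere. *)
Definition mass (R : realType) (f : R -> R[i]) : \bar R :=
  (\int[@lebesgue_measure R]_x (normsq (f x))%:E)%E.

Definition L2 (R : realType) (f : R -> R[i]) : Prop :=
  cmeasurable f /\ (mass f < +oo)%E.

(* Fourier integral of f over the window [-n, n], with the convention
   \hat f (xi) = \int f(x) exp (- i x xi) dx under which D = - i d/dx has
   symbol xi. *)
Definition fourier_window (R : realType) (f : R -> R[i]) (n : nat) (xi : R) :
    R[i] :=
  cintegral `[- n%:R, n%:R] (fun x => f x * expi (- (x * xi))).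

(* g is the L^2 Fourier transform of f: by Plancherel's theorem the windowed
   Fourier integrals of f in L^2 converge in L^2, and \hat f is their limit.
   It is determined by f up to almost everywhere equality. *)
Definition is_fourier (R : realType) (f g : R -> R[i]) : Prop :=
  [/\ L2 f, L2 g &
      (fun n : nat => mass (fun xi => fourier_window f n xi - g xi))
        @ \oo --> 0%E].

(* H^1 with spectrum in [0, +oo[: (1 + xi^2) |\hat f|^2 is integrable, and
   \hat f vanishes almost everywhere on ]-oo, 0[. *)
Definition H1plus (R : realType) (f : R -> R[i]) : Prop :=
  exists fhat : R -> R[i],
    [/\ is_fourier f fhat,
        (\int[@lebesgue_measure R]_xi
           ((1 + xi ^+ 2) * normsq (fhat xi))%:E < +oo)%E &
        {ae @lebesgue_measure R, forall xi : R, xi < 0 -> fhat xi = 0}].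

(* h is the image of f under the Fourier multiplier with symbol m. *)
Definition is_fourier_multiplier (R : realType) (m : R -> R)
    (f h : R -> R[i]) : Prop :=
  exists fhat hhat : R -> R[i],
    [/\ is_fourier f fhat, is_fourier h hhat &
        {ae @lebesgue_measure R, forall xi : R,
           hhat xi = (m xi)%:C * fhat xi}].

(* h = (D + |D|) f *)
Definition is_D_plus_absD (R : realType) (f h : R -> R[i]) : Prop :=
  is_fourier_multiplier (fun xi : R => xi + `|xi|) f h.

(* Points of the space-time plane are pairs (t, x); partial_t and partial_x
   are the directional derivatives along (1, 0) and (0, 1). *)
Definition dir_t (R : realType) : R * R := (1, 0).
Definition dir_x (R : realType) : R * R := (0, 1).

Definition partial_t (R : realType) (phi : R * R -> R) : R * R -> R :=
  fun p => 'D_(dir_t R) phi p.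
Definition partial_x (R : realType) (phi : R * R -> R) : R * R -> R :=
  fun p => 'D_(dir_x R) phi p.

(* The boolean word s selects a mixed partial derivative of any order. *)
Definition iter_partial (R : realType) (s : seq bool) (phi : R * R -> R) :
    R * R -> R :=
  foldr (fun (b : bool) psi => if b then partial_t psi else partial_x psi)
    phi s.

Definition smooth (R : realType) (phi : R * R -> R) : Prop :=
  forall s : seq bool,
    continuous (iter_partial s phi) /\
    forall p : R * R, derivable (iter_partial s phi) p (dir_t R) /\
                      derivable (iter_partial s phi) p (dir_x R).

(* Real-valued test functions on the plane; testing a complex-valued
   distribution against complex test functions amounts to the same by
   linearity. *)
Definition test_function (R : realType) (phi : R * R -> R) : Prop :=
  smooth phi /\ compact (closure [set p | phi p != 0]).

(* The nonlinearity involves the function N t = (D + |D|)(|u(t)|^2), which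
   exists (in L^2) and is unique up to almost everywhere equality as soon as
   u t is in H^1.  The pairing with phi is an integral in x followed by an
   integral in t, so that it only depends on the almost everywhere classes of
   u t and N t for each t. *)
Definition distributional_solution (R : realType) (u : R -> R -> R[i]) :
    Prop :=
  (forall t : R, H1plus (u t)) /\
  exists N : R -> R -> R[i],
    (forall t : R, is_D_plus_absD (fun x => (normsq (u t x))%:C) (N t)) /\
    forall phi : R * R -> R, test_function phi ->
      cintegral setT (fun t => cintegral setT (fun x =>
        - (0 +i* 1) * u t x * (partial_t phi (t, x))%:C
        + u t x * (partial_x (partial_x phi) (t, x))%:C
        + N t x * u t x * (phi (t, x))%:C)) = 0.

Definition traveling_solitary_wave (R : realType) (u : R -> R -> R[i]) :
    Prop :=
  distributional_solution u /\
  exists (omega v : R) (Q : R -> R[i]),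
    [/\ H1plus Q,
        ~ {ae @lebesgue_measure R, forall x : R, Q x = 0} &
        forall t : R, {ae @lebesgue_measure R, forall x : R,
          u t x = expi (omega * t) * Q (x - v * t)}].

Definition profile (R : realType) (x : R) : R[i] :=
  (Num.sqrt 2)%:C / (x +i* 1).

(* Main.v *)
Require Import Defs.
From HB Require Import structures.
From mathcomp Require Import all_boot all_order all_algebra.
From mathcomp Require Import complex.
From mathcomp Require Import all_classical all_reals all_analysis.
From mathcomp Require Import measurable_realfun ring lra.
Set Implicit Arguments.
Unset Strict Implicit.
Unset Printing Implicit Defensive.
Import Order.TTheory GRing.Theory Num.Theory.
Import numFieldTopology.Exports numFieldNormedType.Exports.
Local Open Scope classical_set_scope.
Local Open Scope ring_scope.
Local Open Scope complex_scope.

(** Let [u = e^(i omega t) Q (x - v t)], [rho = |Q|^2] and [N = (D + |D|) rho].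
    Tested against products [a(t) b(x - v t)] the equation becomes
    [(- xi^2 + v xi - omega) Q^ + (N Q)^ = 0] almost everywhere; read as an
    integrability statement it successively puts [xi Q^], [N^] and [xi^2 Q^] in
    [L^1], so that [Q] is [C^2].

    Put [S = e^(- i v x / 2) Q] and [c = omega - v^2 / 4], and let [F] be the
    projection of [rho] onto nonnegative frequencies: [F + F^* = rho],
    [F' = i N / 2] and [S'' = (c - N) S].  Then [Im (S^* S') = rho^2 / 2], since
    the difference is constant and integrable.  The function
    [T = |S'|^2 - rho^3 / 3 - c rho] has derivative [Im (N^2) / 2]; the spectrum
    of [N^2] is positive and vanishes to third order at [0], whence [int T = 0].
    The same positivity for [F] gives [int rho (Im F)^2 = int rho^3 / 12].
    Together these identities yield [int |S' - i F S|^2 = 0].  Thus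
    [S' = i F S], [c = 0] and [F' = i F^2], so that [1 / F] is affine and [S] is
    a multiple of [F].

    Finally [(x + z0) Q = C e^(i v x / 2)], while [Q] has no negative
    frequencies; comparing Laplace transforms near [0] excludes [v < 0]. *)

(** The first-order equation [S' = i F S] is reached by completing a square: the integral of
    [|S' - i F S|^2] expands into integrals of [|S'|^2], [rho^3], [rho (Im F)^2] and [(Im F) rho'],
    tied together by the identities. The unknown [c] enters two of them,
    [int |S'|^2 = int (Re N - c) rho] and [int T = 0], with opposite signs and drops out of their
    sum; only afterwards does it turn out to vanish. That [int T = 0] is no boundary-term argument:
    pairing [T'] with [sin (h x)] gives [h int cos (h x) T = O(h^3)], and one divides by [h] and
    lets [h] tend to 0. The obstacle before that is regularity. [u t] and [N t] are given for each
    [t] separately and only almost everywhere, with no measurability in [(t, x)]; test functions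
    that move with the wave make the inner integral computable at each fixed [t]. A priori [N] is
    only in [L^2], so its transform is handled through the bilinear duality [int f k^ = int f^ k]
    with well-behaved [k], and pointwise information is recovered with Poisson kernels. *)

Section RealIntegrals.
Context {R : realType}.
Local Notation mu := (@lebesgue_measure R).
Implicit Types (f g : R -> R).

(** * Integrals of real functions on the line and their invariances *)

Lemma ae_mono (P Q : R -> Prop) : (forall x, P x -> Q x) ->
  {ae mu, forall x, P x} -> {ae mu, forall x, Q x}.
Proof. by move=> PQ; apply: filterS; [exact: (ae_filter_ringOfSetsType mu)|]. Qed.

Lemma ae_and (P Q : R -> Prop) : {ae mu, forall x, P x} ->
  {ae mu, forall x, Q x} -> {ae mu, forall x, P x /\ Q x}.
Proof.
by move=> hP hQ; apply: filterI; [exact: (ae_filter_ringOfSetsType mu)|..].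
Qed.

Lemma ae_mono2 (P Q S : R -> Prop) : (forall x, P x -> Q x -> S x) ->
  {ae mu, forall x, P x} -> {ae mu, forall x, Q x} -> {ae mu, forall x, S x}.
Proof. by move=> PQ hP hQ; apply: ae_mono (ae_and hP hQ) => x []; exact: PQ. Qed.

Lemma squeeze0 (u v : nat -> R) : (forall n, 0 <= u n <= v n) ->
  v n @[n --> \oo] --> 0 -> u n @[n --> \oo] --> 0.
Proof.
move=> uv hv; apply: (@squeeze_cvgr _ _ _ _ (cst 0) _ _ _ _ _ hv).
  exact: nearW.
exact: cvg_cst.
Qed.

Definition rintg f : Prop := mu.-integrable setT (EFin \o f).
(** As the [fine] part of an extended integral it takes a default value when that integral is
    infinite, whence the [rintg] premises of the algebraic laws below. *)
Definition rint f : R := \int[mu]_x f x.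

Lemma rintg_meas f : rintg f -> measurable_fun setT f.
Proof. by move=> /integrableP[/measurable_EFinP]. Qed.

Lemma rintg_le f g : measurable_fun setT f -> rintg g ->
  (forall x, `|f x| <= g x) -> rintg f.
Proof.
move=> mf ig fg; apply: (le_integrable measurableT _ _ ig).
  exact/measurable_EFinP.
by move=> x _ /=; rewrite lee_fin (le_trans (fg x))// ler_norm.
Qed.

Lemma rintgD f g : rintg f -> rintg g -> rintg (fun x => f x + g x).
Proof. by move=> hf hg; exact: (integrableD measurableT hf hg). Qed.

Lemma rintgZ (k : R) f : rintg f -> rintg (fun x => k * f x).
Proof. by move=> hf; exact: (integrableZl measurableT k hf). Qed.

Lemma rintgN f : rintg f -> rintg (fun x => - f x).
Proof.
move=> /(rintgZ (-1)); congr rintg; apply/funext => x; by rewrite mulN1r.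
Qed.

Lemma rintgB f g : rintg f -> rintg g -> rintg (fun x => f x - g x).
Proof. by move=> hf hg; exact: rintgD hf (rintgN hg). Qed.

Lemma rintg_abs f : rintg f -> rintg (fun x => `|f x|).
Proof. by move=> /integrable_abse. Qed.

Lemma rintg0 : rintg (fun=> 0).
Proof. exact: integrable0. Qed.

Lemma rintD f g : rintg f -> rintg g ->
  rint (fun x => f x + g x) = rint f + rint g.
Proof. by move=> hf hg; exact: (RintegralD measurableT hf hg). Qed.

Lemma rintZ (k : R) f : rintg f -> rint (fun x => k * f x) = k * rint f.
Proof. by move=> hf; exact: (RintegralZl k measurableT hf). Qed.

Lemma rintN f : rintg f -> rint (fun x => - f x) = - rint f.
Proof.
move=> hf; rewrite -mulN1r -rintZ//.
by congr rint; apply/funext => x; rewrite mulN1r.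
Qed.

Lemma rintB f g : rintg f -> rintg g ->
  rint (fun x => f x - g x) = rint f - rint g.
Proof. by move=> hf hg; rewrite rintD ?rintN//; exact: rintgN. Qed.

Lemma rint0 : rint (fun=> 0) = 0.
Proof. by rewrite /rint /Rintegral integral0. Qed.

Lemma rint_ge0 f : (forall x, 0 <= f x) -> 0 <= rint f.
Proof. by move=> f0; apply: Rintegral_ge0. Qed.

Lemma rint_le f g : rintg f -> rintg g -> (forall x, f x <= g x) ->
  rint f <= rint g.
Proof. by move=> hf hg fg; apply: le_Rintegral. Qed.

Lemma rint_abs f : rintg f -> `|rint f| <= rint (fun x => `|f x|).
Proof. by move=> hf; exact: le_normr_Rintegral. Qed.

Lemma rint_EFin f : rintg f -> (\int[mu]_x (f x)%:E)%E = (rint f)%:E.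
Proof. by move=> hf; rewrite /rint /Rintegral fineK// integrable_fin_num. Qed.

Lemma rintg_ge0P f : measurable_fun setT f -> (forall x, 0 <= f x) ->
  rintg f <-> (\int[mu]_x (f x)%:E < +oo)%E.
Proof.
move=> mf f0; rewrite /rintg; split=> [/integrableP[_]|h].
  by under eq_integral do rewrite /= ger0_norm//.
apply/integrableP; split; first exact/measurable_EFinP.
by under eq_integral do rewrite /= ger0_norm//.
Qed.

Lemma rint_ae f g : measurable_fun setT f -> measurable_fun setT g ->
  {ae mu, forall x, f x = g x} -> rint f = rint g.
Proof.
move=> mf mg fg; rewrite /rint /Rintegral; congr fine.
apply: ae_eq_integral => //; [exact/measurable_EFinP..|].
by apply: ae_mono fg => x /= -> _.
Qed.

Lemma rintg_ae f g : measurable_fun setT f -> measurable_fun setT g ->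
  {ae mu, forall x, f x = g x} -> rintg f -> rintg g.
Proof.
move=> mf mg fg /integrableP[_ fi]; apply/integrableP; split.
  exact/measurable_EFinP.
apply: le_lt_trans fi; rewrite le_eqVlt; apply/orP; left; apply/eqP.
apply: ae_eq_integral => //.
- by apply/measurable_EFinP; exact: measurableT_comp.
- by apply/measurable_EFinP; exact: measurableT_comp.
- by apply: ae_mono fg => x /= -> _.
Qed.

Lemma rint_eq0_ae f : rintg f -> (forall x, 0 <= f x) -> rint f = 0 ->
  {ae mu, forall x, f x = 0}.
Proof.
move=> hf f0 h0.
have mf := rintg_meas hf.
have : (\int[mu]_x `|(f x)%:E| = 0)%E.
  under eq_integral do rewrite /= ger0_norm//.
  by rewrite rint_EFin// h0.
have mfE : measurable_fun setT (EFin \o f) by exact/measurable_EFinP.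
move/(ae_eq_integral_abs mu measurableT mfE).
by apply: ae_mono => x /= /(_ Logic.I) [].
Qed.

Lemma rint_dct (fn : nat -> R -> R) f g :
  (forall n, measurable_fun setT (fn n)) -> measurable_fun setT f ->
  rintg g -> (forall n x, `|fn n x| <= g x) ->
  (forall x, fn n x @[n --> \oo] --> f x) ->
  rintg f /\ rint (fn n) @[n --> \oo] --> rint f.
Proof.
move=> mfn mf ig fg fnf.
have mfn' n : measurable_fun setT (EFin \o fn n) by exact/measurable_EFinP.
have mf' : measurable_fun setT (EFin \o f) by exact/measurable_EFinP.
have cv : {ae mu, forall x, setT x -> (EFin \o fn n) x @[n --> \oo] --> (f x)%:E}.
  apply: aeW => x _; apply/fine_cvgP; split; first exact: nearW.
  exact: fnf.
have bd : {ae mu, forall x n, setT x -> (`|(EFin \o fn n) x| <= (g x)%:E)%E}.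
  by apply: aeW => x n _; rewrite /= lee_fin.
have [h1 _ h3] := @dominated_convergence _ _ R mu setT measurableT _ _ _ mfn' mf' cv ig bd.
split; first exact: h1.
apply: fine_cvg; move: h3; rewrite rint_EFin//.
Qed.

(** Lebesgue measure is the only measure that gives every []c, d]] its length, and its image under a
    translation does so too. *)
Lemma lebesgue_measure_shift (a : R) (A : set (measurableTypeR R)) :
  measurable A ->
  pushforward mu (fun x : measurableTypeR R => (x + a)%R : measurableTypeR R) A
  = mu A.
Proof.
have mphi : measurable_fun setT
    (fun x : measurableTypeR R => (x + a)%R : measurableTypeR R).
  exact: measurable_funD.
pose phi : {mfun measurableTypeR R >-> measurableTypeR R} :=
  HB.pack (fun x : measurableTypeR R => (x + a)%R : measurableTypeR R)
          (isMeasurableFun.Build _ _ _ _ _ mphi).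
move=> mA; apply/esym/(@lebesgue_measure_unique _ (pushforward mu phi)) => //.
move=> _ [[c d]] _ <-.
transitivity (mu `]c - a, d - a]%classic).
  rewrite !lebesgue_measure_itv/= !lte_fin ltrD2r; case: ifPn => // _.
  by rewrite -!EFinB; congr EFin; ring.
apply: (congr1 mu).
by apply/seteqP; split => x /=; rewrite !in_itv/= ltrBlDr lerBrDr//.
Qed.

(** The nonnegative case comes first: it yields the integrability of the translate, which the signed
    change of variables requires. *)
Lemma ge0_integral_shift (a : R) (f : R -> \bar R) : measurable_fun setT f ->
  (forall x, (0 <= f x)%E) ->
  (\int[mu]_x f (x + a)%R = \int[mu]_x f x)%E.
Proof.
move=> mf f0.
have mphi : measurable_fun setT
    (fun x : measurableTypeR R => (x + a)%R : measurableTypeR R).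
  exact: measurable_funD.
rewrite [LHS](_ : _ =
  (\int[pushforward mu (fun x : measurableTypeR R => (x + a)%R : measurableTypeR R)]_x f x)%E).
  by apply: eq_measure_integral => A mA _; exact: lebesgue_measure_shift.
by rewrite ge0_integral_pushforward.
Qed.

Lemma rintg_shift (a : R) f : rintg f -> rintg (fun x => f (x + a)).
Proof.
move=> hf; have mf := rintg_meas hf.
have mfa : measurable_fun setT (fun x : R => f (x + a)).
  by apply: (measurableT_comp mf); exact: measurable_funD.
move: (hf) => /integrableP[_ h]; apply/integrableP; split.
  exact/measurable_EFinP.
rewrite (@ge0_integral_shift a (fun x => `|f x|%:E))//.
by apply/measurable_EFinP; exact: measurableT_comp.
Qed.

Lemma rint_shift (a : R) f : rintg f -> rint (fun x => f (x + a)) = rint f.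
Proof.
move=> hf; have mf := rintg_meas hf.
have mphi : measurable_fun setT
    (fun x : measurableTypeR R => (x + a)%R : measurableTypeR R).
  exact: measurable_funD.
rewrite /rint /Rintegral; congr fine.
rewrite [RHS](_ : _ =
  (\int[pushforward mu (fun x : measurableTypeR R => (x + a)%R : measurableTypeR R)]_x (f x)%:E)%E).
  rewrite integral_pushforward//; first exact/measurable_EFinP.
  exact: rintg_shift.
by apply: eq_measure_integral => A mA _; exact/esym/lebesgue_measure_shift.
Qed.

Lemma ge0_integral_opp (f : R -> \bar R) : measurable_fun setT f ->
  (forall x, (0 <= f x)%E) ->
  (\int[mu]_x f (- x)%R = \int[mu]_x f x)%E.
Proof.
move=> mf f0.
rewrite [LHS](_ : _ =
  (\int[pushforward mu (-%R : _ -> measurableTypeR R)]_x f x)%E).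
  by apply: eq_measure_integral => A mA _; exact: lebesgue_measureN.
by rewrite ge0_integral_pushforward.
Qed.

Lemma rintg_opp f : rintg f -> rintg (fun x => f (- x)).
Proof.
move=> hf; have mf := rintg_meas hf.
have mfa : measurable_fun setT (fun x : R => f (- x)).
  by apply: (measurableT_comp mf).
move: (hf) => /integrableP[_ h]; apply/integrableP; split.
  exact/measurable_EFinP.
rewrite (@ge0_integral_opp (fun x => `|f x|%:E))//.
by apply/measurable_EFinP; exact: measurableT_comp.
Qed.

Lemma rint_opp f : rintg f -> rint (fun x => f (- x)) = rint f.
Proof.
move=> hf; have mf := rintg_meas hf.
rewrite /rint /Rintegral; congr fine.
rewrite [RHS](_ : _ =
  (\int[pushforward mu (-%R : _ -> measurableTypeR R)]_x (f x)%:E)%E).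
  rewrite integral_pushforward//; first exact/measurable_EFinP.
  exact: rintg_opp.
by apply: eq_measure_integral => A mA _; exact/esym/lebesgue_measureN.
Qed.

End RealIntegrals.

(** * Complex-valued integrals: dominated convergence and Fubini *)

Section ComplexIntegrals.
Context {R : realType}.
Local Notation mu := (@lebesgue_measure R).
Implicit Types (z w : R[i]) (f g : R -> R[i]).

Local Notation cabs := (@Normc.normc R).

Lemma cabsE z : cabs z = Num.sqrt (complex.Re z ^+ 2 + complex.Im z ^+ 2).
Proof. by case: z. Qed.

Lemma cabs_ge0 z : 0 <= cabs z.
Proof. by rewrite cabsE sqrtr_ge0. Qed.

Lemma cabs_normsq z : cabs z ^+ 2 = normsq z.
Proof. by rewrite cabsE sqr_sqrtr// addr_ge0 ?sqr_ge0. Qed.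

Lemma normsq_ge0 z : 0 <= normsq z.
Proof. by rewrite addr_ge0 ?sqr_ge0. Qed.

Lemma Re_le_cabs z : `|complex.Re z| <= cabs z.
Proof. by rewrite cabsE -sqrtr_sqr ler_wsqrtr// lerDl sqr_ge0. Qed.

Lemma Im_le_cabs z : `|complex.Im z| <= cabs z.
Proof. by rewrite cabsE -sqrtr_sqr ler_wsqrtr// lerDr sqr_ge0. Qed.

Lemma cabs_le_ReIm z : cabs z <= `|complex.Re z| + `|complex.Im z|.
Proof.
rewrite -(@ler_pXn2r _ 2)// ?nnegrE ?addr_ge0 ?normr_ge0 ?cabs_ge0//.
rewrite cabs_normsq sqrrD !real_normK ?num_real// -addrA lerD2l lerDr.
by rewrite mulrn_wge0// mulr_ge0.
Qed.

Lemma cabsM z w : cabs (z * w) = cabs z * cabs w.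
Proof. exact: Normc.normcM. Qed.

Lemma cabsD z w : cabs (z + w) <= cabs z + cabs w.
Proof. exact: (@le_normcD R). Qed.

Lemma cabsN z : cabs (- z) = cabs z.
Proof. exact: normcN. Qed.

Lemma cabsJ z : cabs z^* = cabs z.
Proof. by case: z => a b /=; rewrite sqrrN. Qed.

Lemma cabsR (a : R) : cabs a%:C = `|a|.
Proof. by rewrite cabsE /= expr0n addr0 sqrtr_sqr. Qed.

Lemma cabs0 : cabs 0 = 0. Proof. exact: Normc.normc0. Qed.

Lemma cabs_eq0 z : cabs z = 0 -> z = 0. Proof. exact: Normc.eq0_normc. Qed.

Lemma cabs_expi (a : R) : cabs (expi a) = 1.
Proof. by rewrite cabsE /= cos2Dsin2 sqrtr1. Qed.

Lemma expiD (a b : R) : expi (a + b) = expi a * expi b :> R[i].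
Proof. by rewrite /expi sinD cosD; simpc; rewrite [cos a * sin b + _]addrC. Qed.

Lemma expi0 : expi 0 = 1 :> R[i].
Proof. by rewrite /expi cos0 sin0. Qed.

Lemma expiN (a : R) : expi (- a) = (expi a)^*.
Proof. by rewrite /expi cosN sinN. Qed.

Lemma eq_complexP z w : complex.Re z = complex.Re w ->
  complex.Im z = complex.Im w -> z = w.
Proof. by case: z => a b; case: w => c d /= -> ->. Qed.

Lemma realCM (a b : R) : (a * b)%:C = a%:C * b%:C :> R[i].
Proof. exact: rmorphM. Qed.

Lemma mul_conj z : z * z^* = (normsq z)%:C.
Proof.
by case: z => a b; apply: eq_complexP; rewrite /normsq /=; ring.
Qed.

Lemma cReM z w : complex.Re (z * w) =
  complex.Re z * complex.Re w - complex.Im z * complex.Im w.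
Proof. by case: z; case: w. Qed.

Lemma cImM z w : complex.Im (z * w) =
  complex.Re z * complex.Im w + complex.Im z * complex.Re w.
Proof. by case: z; case: w. Qed.

Lemma cReD z w : complex.Re (z + w) = complex.Re z + complex.Re w.
Proof. by case: z; case: w. Qed.

Lemma cImD z w : complex.Im (z + w) = complex.Im z + complex.Im w.
Proof. by case: z; case: w. Qed.

Lemma cReN z : complex.Re (- z) = - complex.Re z. Proof. by case: z. Qed.
Lemma cImN z : complex.Im (- z) = - complex.Im z. Proof. by case: z. Qed.
Lemma cReJ z : complex.Re z^* = complex.Re z. Proof. by case: z. Qed.
Lemma cImJ z : complex.Im z^* = - complex.Im z. Proof. by case: z. Qed.

Definition ReImE := (cReM, cImM, cReD, cImD, cReN, cImN, cReJ, cImJ).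

Lemma cmeasD f g : cmeasurable f -> cmeasurable g ->
  cmeasurable (fun x => f x + g x).
Proof.
move=> [f1 f2] [g1 g2]; split.
  by under eq_fun do rewrite cReD; exact: measurable_funD.
by under eq_fun do rewrite cImD; exact: measurable_funD.
Qed.

Lemma cmeasM f g : cmeasurable f -> cmeasurable g ->
  cmeasurable (fun x => f x * g x).
Proof.
move=> [f1 f2] [g1 g2]; split.
  under eq_fun do rewrite cReM.
  by apply: measurable_funB; exact: measurable_funM.
under eq_fun do rewrite cImM.
by apply: measurable_funD; exact: measurable_funM.
Qed.

Lemma cmeasN f : cmeasurable f -> cmeasurable (fun x => - f x).
Proof.
move=> [f1 f2]; split.
  by under eq_fun do rewrite cReN; exact: measurableT_comp.
by under eq_fun do rewrite cImN; exact: measurableT_comp.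
Qed.

Lemma cmeasJ f : cmeasurable f -> cmeasurable (fun x => (f x)^*).
Proof.
move=> [f1 f2]; split.
  by under eq_fun do rewrite cReJ.
by under eq_fun do rewrite cImJ; exact: measurableT_comp.
Qed.

Lemma cmeas_cst z : cmeasurable (fun=> z : R[i]).
Proof. by split; exact: measurable_cst. Qed.

Lemma cmeasR (h : R -> R) : measurable_fun setT h ->
  cmeasurable (fun x => (h x)%:C).
Proof. by move=> mh; split => //=; exact: measurable_cst. Qed.

Lemma measurable_cos (h : R -> R) : measurable_fun setT h ->
  measurable_fun setT (fun x : R => cos (h x)).
Proof.
by move=> mh; apply: measurableT_comp mh; apply: continuous_measurable_fun;
  exact: continuous_cos.
Qed.

Lemma measurable_sin (h : R -> R) : measurable_fun setT h ->
  measurable_fun setT (fun x : R => sin (h x)).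
Proof.
by move=> mh; apply: measurableT_comp mh; apply: continuous_measurable_fun;
  exact: continuous_sin.
Qed.

Lemma cmeas_expi (h : R -> R) : measurable_fun setT h ->
  cmeasurable (fun x => expi (h x)).
Proof.
by move=> mh; split; [exact: measurable_cos|exact: measurable_sin].
Qed.

Lemma cmeas_comp f (h : R -> R) : cmeasurable f -> measurable_fun setT h ->
  cmeasurable (fun x => f (h x)).
Proof. by move=> [f1 f2] mh; split;
  [exact: (measurableT_comp f1 mh)|exact: (measurableT_comp f2 mh)]. Qed.

Lemma meas_normsq f : cmeasurable f -> measurable_fun setT (fun x => normsq (f x)).
Proof.
by move=> [f1 f2]; apply: measurable_funD; apply: measurable_funX.
Qed.

Lemma meas_cabs f : cmeasurable f -> measurable_fun setT (fun x => cabs (f x)).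
Proof.
move=> /meas_normsq mf.
rewrite (_ : (fun x => _) = (@Num.sqrt R) \o (fun x => normsq (f x))).
  apply: measurableT_comp mf.
  by apply: continuous_measurable_fun; exact: sqrt_continuous.
by apply/funext => x; rewrite /= cabsE.
Qed.

Definition cintg f : Prop := cmeasurable f /\ rintg (fun x => cabs (f x)).
Definition cint f : R[i] := cintegral setT f.

Lemma cintegralT f : cintegral setT f = cint f.
Proof. by []. Qed.

Lemma cintE f : cint f =
  rint (fun x => complex.Re (f x)) +i* rint (fun x => complex.Im (f x)).
Proof. by []. Qed.

Lemma cintg_Re f : cintg f -> rintg (fun x => complex.Re (f x)).
Proof. by move=> [[f1 f2] hf]; apply: rintg_le hf _ => // x; exact: Re_le_cabs. Qed.

Lemma cintg_Im f : cintg f -> rintg (fun x => complex.Im (f x)).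
Proof. by move=> [[f1 f2] hf]; apply: rintg_le hf _ => // x; exact: Im_le_cabs. Qed.

Lemma cintg_le f (h : R -> R) : cmeasurable f -> rintg h ->
  (forall x, cabs (f x) <= h x) -> cintg f.
Proof.
move=> mf hh fh; split => //; apply: rintg_le hh _; first exact: meas_cabs.
by move=> x; rewrite ger0_norm ?cabs_ge0.
Qed.

Lemma cintg_ReIm f : rintg (fun x => complex.Re (f x)) ->
  rintg (fun x => complex.Im (f x)) -> cintg f.
Proof.
move=> h1 h2; apply: (cintg_le (h := fun x => `|complex.Re (f x)| + `|complex.Im (f x)|)).
- by split; exact: rintg_meas.
- by apply: rintgD; exact: rintg_abs.
- by move=> x; exact: cabs_le_ReIm.
Qed.

Lemma cintgD f g : cintg f -> cintg g -> cintg (fun x => f x + g x).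
Proof.
move=> [mf hf] [mg hg]; apply: cintg_le (rintgD hf hg) _; first exact: cmeasD.
by move=> x; exact: cabsD.
Qed.

Lemma cintgN f : cintg f -> cintg (fun x => - f x).
Proof.
move=> [mf hf]; apply: cintg_le hf _; first exact: cmeasN.
by move=> x; rewrite cabsN.
Qed.

Lemma cintgB f g : cintg f -> cintg g -> cintg (fun x => f x - g x).
Proof. by move=> hf hg; apply: cintgD => //; exact: cintgN. Qed.

Lemma cintgZ z f : cintg f -> cintg (fun x => z * f x).
Proof.
move=> [mf hf]; apply: cintg_le (rintgZ (cabs z) hf) _.
  by apply: cmeasM => //; exact: cmeas_cst.
by move=> x; rewrite cabsM.
Qed.

Lemma cintgJ f : cintg f -> cintg (fun x => (f x)^*).
Proof.
move=> [mf hf]; apply: cintg_le hf _; first exact: cmeasJ.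
by move=> x; rewrite cabsJ.
Qed.

Lemma cintg_bdM f g (M : R) : cmeasurable f -> (forall x, cabs (f x) <= M) ->
  cintg g -> cintg (fun x => f x * g x).
Proof.
move=> mf fM [mg hg]; apply: cintg_le (rintgZ M hg) _; first exact: cmeasM.
by move=> x; rewrite cabsM ler_wpM2r ?cabs_ge0.
Qed.

Lemma cintg0 : cintg (fun=> 0).
Proof.
split; first exact: cmeas_cst.
by under eq_fun do rewrite cabs0; exact: rintg0.
Qed.

Lemma cint0 : cint (fun=> 0) = 0.
Proof. by rewrite cintE /= !rint0. Qed.

Lemma eq_cint f g : (forall x, f x = g x) -> cint f = cint g.
Proof. by move=> /funext ->. Qed.

Lemma cintD f g : cintg f -> cintg g ->
  cint (fun x => f x + g x) = cint f + cint g.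
Proof.
move=> hf hg; rewrite !cintE; apply: eq_complexP; rewrite /= ?cReD ?cImD/=.
  by rewrite -rintD; [|exact: cintg_Re..]; congr rint; apply/funext => x; rewrite cReD.
by rewrite -rintD; [|exact: cintg_Im..]; congr rint; apply/funext => x; rewrite cImD.
Qed.

Lemma cintZ z f : cintg f -> cint (fun x => z * f x) = z * cint f.
Proof.
move=> hf; have h1 := cintg_Re hf; have h2 := cintg_Im hf.
rewrite !cintE; apply: eq_complexP; rewrite /= ?cReM ?cImM/= -!rintZ//.
  rewrite -rintB; [|exact: rintgZ..].
  by congr rint; apply/funext => x; rewrite cReM.
rewrite -rintD; [|exact: rintgZ..].
by congr rint; apply/funext => x; rewrite cImM.
Qed.

Lemma cintN f : cintg f -> cint (fun x => - f x) = - cint f.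
Proof.
move=> hf; rewrite -mulN1r -cintZ//.
by apply: eq_cint => x; rewrite mulN1r.
Qed.

Lemma cintB f g : cintg f -> cintg g ->
  cint (fun x => f x - g x) = cint f - cint g.
Proof. by move=> hf hg; rewrite cintD ?cintN//; exact: cintgN. Qed.

Lemma cintZr z f : cintg f -> cint (fun x => f x * z) = cint f * z.
Proof.
by move=> hf; rewrite mulrC -cintZ//; apply: eq_cint => x; rewrite mulrC.
Qed.

Lemma cintJ f : cintg f -> cint (fun x => (f x)^*) = (cint f)^*.
Proof.
move=> hf; rewrite !cintE; apply: eq_complexP => /=.
  by congr rint; apply/funext => x; rewrite cReJ.
rewrite -rintN; last exact: cintg_Im.
by congr rint; apply/funext => x; rewrite cImJ.
Qed.

Lemma cintR (h : R -> R) : cint (fun x => (h x)%:C) = (rint h)%:C.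
Proof. by rewrite cintE /= rint0. Qed.

Lemma cintgR (h : R -> R) : rintg h -> cintg (fun x => (h x)%:C).
Proof.
move=> hh; apply: cintg_le (rintg_abs hh) _.
  by apply: cmeasR; exact: rintg_meas.
by move=> x; rewrite cabsR.
Qed.

(** Multiplication by the conjugate of the integral [I] makes it real and nonnegative:
    [|I|^2 = Re int (conj I) f <= |I| int |f|]. Bounding the components separately would lose a
    constant. *)
Lemma cint_le f : cintg f -> cabs (cint f) <= rint (fun x => cabs (f x)).
Proof.
move=> hf; have [->|/eqP nz] := pselect (cint f = 0).
  by rewrite cabs0 rint_ge0// => x; exact: cabs_ge0.
have n0 : 0 < cabs (cint f).
  by rewrite lt_def cabs_ge0 andbT; apply: contra nz => /eqP/cabs_eq0 ->.
rewrite -(ler_pM2l n0) -expr2 cabs_normsq.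
have -> : normsq (cint f) = complex.Re ((cint f)^* * cint f).
  by rewrite mulrC mul_conj.
rewrite -cintZ// -rintZ; last exact: hf.2.
rewrite cintE/=; apply: rint_le.
- exact: cintg_Re (cintgZ _ hf).
- exact/rintgZ/hf.2.
- move=> x; rewrite (le_trans (ler_norm _))// (le_trans (Re_le_cabs _))//.
  by rewrite cabsM cabsJ.
Qed.

Lemma cint_ae f g : cmeasurable f -> cmeasurable g ->
  {ae mu, forall x, f x = g x} -> cint f = cint g.
Proof.
move=> [f1 f2] [g1 g2] fg; rewrite !cintE; congr Complex; apply: rint_ae => //;
  by apply: ae_mono fg => x ->.
Qed.

Lemma cintg_ae f g : cmeasurable f -> cmeasurable g ->
  {ae mu, forall x, f x = g x} -> cintg f -> cintg g.
Proof.
move=> mf mg fg [_ hf]; split=> //; apply: rintg_ae hf; try exact: meas_cabs.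
by apply: ae_mono fg => x ->.
Qed.

Lemma cintg_shift (a : R) f : cintg f -> cintg (fun x => f (x + a)).
Proof.
move=> [mf hf]; split; last exact: (rintg_shift a hf).
by apply: cmeas_comp mf _; exact: measurable_funD.
Qed.

Lemma cint_shift (a : R) f : cintg f -> cint (fun x => f (x + a)) = cint f.
Proof.
move=> hf; rewrite !cintE (rint_shift a (cintg_Re hf)).
by rewrite (rint_shift a (cintg_Im hf)).
Qed.

Lemma cintg_opp f : cintg f -> cintg (fun x => f (- x)).
Proof.
move=> [mf hf]; split; last exact: (rintg_opp hf).
apply: cmeas_comp mf _.
by apply: (measurable_funN (f := fun x : R => x)); exact: measurable_id.
Qed.

Lemma cint_opp f : cintg f -> cint (fun x => f (- x)) = cint f.
Proof.
move=> hf; rewrite !cintE (rint_opp (cintg_Re hf)).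
by rewrite (rint_opp (cintg_Im hf)).
Qed.

(** Stated through the real modulus, so that limits, squeezes and dominated convergence all take
    place in [R]. *)
Definition ccvg (u : nat -> R[i]) z : Prop := cabs (u n - z) @[n --> \oo] --> 0.

Lemma ccvgP (u : nat -> R[i]) z : ccvg u z <->
  (complex.Re (u n) @[n --> \oo] --> complex.Re z /\
   complex.Im (u n) @[n --> \oo] --> complex.Im z).
Proof.
split=> [h|[h1 h2]].
  split; apply/subr_cvg0; apply: norm_cvg0; apply: (squeeze0 _ h) => n;
    rewrite normr_ge0/=.
    by apply: le_trans (Re_le_cabs _); rewrite cReD cReN.
  by apply: le_trans (Im_le_cabs _); rewrite cImD cImN.
have h : `|complex.Re (u n) - complex.Re z| + `|complex.Im (u n) - complex.Im z|
    @[n --> \oo] --> 0.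
  rewrite -[0]addr0 -[X in X + _](@normr0 R R) -[X in _ + X](@normr0 R R).
  by apply: cvgD; apply: cvg_norm; apply/subr_cvg0.
apply: (squeeze0 _ h) => n.
rewrite cabs_ge0/=; apply: le_trans (cabs_le_ReIm _) _.
by rewrite cReD cReN cImD cImN.
Qed.

Lemma ccvg_uniq (u : nat -> R[i]) z w : ccvg u z -> ccvg u w -> z = w.
Proof.
move=> /ccvgP[h1 h2] /ccvgP[h3 h4]; apply: eq_complexP.
  exact: (cvg_unique _ h1 h3).
exact: (cvg_unique _ h2 h4).
Qed.

Lemma ccvg_cst z : ccvg (fun=> z) z.
Proof. by apply/ccvgP; split; exact: cvg_cst. Qed.

Lemma ccvgM (u v : nat -> R[i]) z w : ccvg u z -> ccvg v w ->
  ccvg (fun n => u n * v n) (z * w).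
Proof.
move=> /ccvgP[h1 h2] /ccvgP[h3 h4]; apply/ccvgP; split.
  under eq_fun do rewrite cReM.
  by rewrite cReM; apply: cvgB; exact: cvgM.
under eq_fun do rewrite cImM.
by rewrite cImM; apply: cvgD; exact: cvgM.
Qed.

Lemma ccvgD (u v : nat -> R[i]) z w : ccvg u z -> ccvg v w ->
  ccvg (fun n => u n + v n) (z + w).
Proof.
move=> /ccvgP[h1 h2] /ccvgP[h3 h4]; apply/ccvgP; split.
  by under eq_fun do rewrite cReD; rewrite cReD; exact: cvgD.
by under eq_fun do rewrite cImD; rewrite cImD; exact: cvgD.
Qed.

Lemma ccvgR (u : nat -> R) (a : R) : u n @[n --> \oo] --> a ->
  ccvg (fun n => (u n)%:C) a%:C.
Proof. by move=> h; apply/ccvgP; split => //=; exact: cvg_cst. Qed.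

Lemma ccvg_le (u : nat -> R[i]) (v : nat -> R) z :
  (forall n, cabs (u n - z) <= v n) -> v n @[n --> \oo] --> 0 -> ccvg u z.
Proof.
by move=> h hv; apply: (squeeze0 _ hv) => n; rewrite cabs_ge0/=.
Qed.

Lemma cint_dct (fn : nat -> R -> R[i]) f (g : R -> R) :
  (forall n, cmeasurable (fn n)) -> cmeasurable f ->
  rintg g -> (forall n x, cabs (fn n x) <= g x) ->
  (forall x, ccvg (fn^~ x) (f x)) ->
  cintg f /\ ccvg (fun n => cint (fn n)) (cint f).
Proof.
move=> mfn [mf1 mf2] ig fg fnf.
have [] := @rint_dct _ (fun n x => complex.Re (fn n x))
  (fun x => complex.Re (f x)) g _ mf1 ig _ _.
- by move=> n; exact: (mfn n).1.
- by move=> n x; exact: le_trans (Re_le_cabs _) (fg n x).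
- by move=> x; exact: ((ccvgP _ _).1 (fnf x)).1.
move=> i1 c1.
have [] := @rint_dct _ (fun n x => complex.Im (fn n x))
  (fun x => complex.Im (f x)) g _ mf2 ig _ _.
- by move=> n; exact: (mfn n).2.
- by move=> n x; exact: le_trans (Im_le_cabs _) (fg n x).
- by move=> x; exact: ((ccvgP _ _).1 (fnf x)).2.
move=> i2 c2; split; first exact: cintg_ReIm.
by apply/ccvgP; split.
Qed.

Definition cmeas2 (f : R -> R -> R[i]) : Prop :=
  measurable_fun setT (fun p : R * R => complex.Re (f p.1 p.2)) /\
  measurable_fun setT (fun p : R * R => complex.Im (f p.1 p.2)).

Lemma cmeas2_fst f : cmeasurable f -> cmeas2 (fun x _ => f x).
Proof.
move=> [f1 f2]; split.
  exact: (measurableT_comp f1 measurable_fst).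
exact: (measurableT_comp f2 measurable_fst).
Qed.

Lemma cmeas2_snd f : cmeasurable f -> cmeas2 (fun _ y => f y).
Proof.
move=> [f1 f2]; split.
  exact: (measurableT_comp f1 measurable_snd).
exact: (measurableT_comp f2 measurable_snd).
Qed.

Lemma cmeas2_comp f (h : R * R -> R) : cmeasurable f -> measurable_fun setT h ->
  cmeas2 (fun x y => f (h (x, y))).
Proof.
move=> [f1 f2] mh; split.
  rewrite (_ : (fun p => _) = (fun x => complex.Re (f x)) \o h).
    exact: measurableT_comp.
  by apply/funext => -[].
rewrite (_ : (fun p => _) = (fun x => complex.Im (f x)) \o h).
  exact: measurableT_comp.
by apply/funext => -[].
Qed.

Lemma cmeas2M (f g : R -> R -> R[i]) : cmeas2 f -> cmeas2 g ->
  cmeas2 (fun x y => f x y * g x y).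
Proof.
move=> [f1 f2] [g1 g2]; split.
  under eq_fun do rewrite cReM.
  by apply: measurable_funB; exact: measurable_funM.
under eq_fun do rewrite cImM.
by apply: measurable_funD; exact: measurable_funM.
Qed.

Lemma cmeas2J (f : R -> R -> R[i]) : cmeas2 f -> cmeas2 (fun x y => (f x y)^*).
Proof.
move=> [f1 f2]; split.
  by under eq_fun do rewrite cReJ.
by under eq_fun do rewrite cImJ; exact: measurableT_comp.
Qed.

Lemma meas2_cabs (f : R -> R -> R[i]) : cmeas2 f ->
  measurable_fun setT (fun p : R * R => cabs (f p.1 p.2)).
Proof.
move=> [f1 f2].
rewrite (_ : (fun p => _) = (@Num.sqrt R) \o (fun p => normsq (f p.1 p.2))).
  apply: measurableT_comp.
    by apply: continuous_measurable_fun; exact: sqrt_continuous.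
  by apply: measurable_funD; exact: measurable_funX.
by apply/funext => p; rewrite /= cabsE.
Qed.

Lemma rfubini (f : R * R -> R) : measurable_fun setT f ->
  (\int[mu]_x \int[mu]_y `|f (x, y)|%:E < +oo)%E ->
  [/\ rintg (fun x => rint (fun y => f (x, y))),
      rintg (fun y => rint (fun x => f (x, y))) &
      rint (fun x => rint (fun y => f (x, y))) =
      rint (fun y => rint (fun x => f (x, y)))].
Proof.
move=> mf hf.
have mfE : measurable_fun setT (EFin \o f) by exact/measurable_EFinP.
have im : (mu \x mu)%E.-integrable setT (EFin \o f).
  exact: (@integrable12ltyP _ _ (measurableTypeR R) (measurableTypeR R) R mu mu
    (EFin \o f) mfE).2 hf.
have iF : mu.-integrable setT (fubini_F mu (EFin \o f)) :=
  integrable_fubini_F im.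
have iG : mu.-integrable setT (fubini_G mu (EFin \o f)).
  have mfs : measurable_fun setT (EFin \o (fun p : R * R => f (p.2, p.1))).
    apply/measurable_EFinP.
    exact: (measurableT_comp mf (@measurable_swap _ _ R R)).
  apply: (@integrable_fubini_F _ _ (measurableTypeR R) (measurableTypeR R) R
    mu mu (EFin \o (fun p : R * R => f (p.2, p.1)))).
  apply: (@integrable12ltyP _ _ (measurableTypeR R) (measurableTypeR R) R mu mu
    _ mfs).2.
  exact: (@integrable21ltyP _ _ (measurableTypeR R) (measurableTypeR R) R mu mu
    _ mfE).1 im.
(* Inner integrals are extended reals, finite only almost everywhere; passing to their [fine] part
   changes neither integrability nor the value of the outer integral. *)
have key (F : R -> \bar R) : mu.-integrable setT F ->
    rintg (fun x => fine (F x)) /\ (\int[mu]_x F x = (rint (fun x => fine (F x)))%:E)%E.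
  move=> hF; have mF : measurable_fun setT F by case/integrableP: hF.
  have mfF : measurable_fun setT (fun x => fine (F x)) by exact: measurableT_comp.
  have h1 : rintg (fun x => fine (F x)).
    apply: (le_integrable measurableT _ _ hF); first exact/measurable_EFinP.
    by move=> x _ /=; case: (F x) => //=; rewrite normr0 leey.
  split => //; rewrite -rint_EFin//; apply: ae_eq_integral => //.
    exact/measurable_EFinP.
  by apply: ae_mono (integrable_ae measurableT hF) => x /(_ Logic.I) h _ /=; rewrite fineK.
have [h1 e1] := key _ iF.
have [h2 e2] := key _ iG.
split; [exact: h1|exact: h2|].
apply: EFin_inj; rewrite -[LHS]e1 -[RHS]e2.
exact: (Fubini im).
Qed.

Lemma measurable_tonelli (h : R * R -> \bar R) : measurable_fun setT h ->
  (forall p, (0 <= h p)%E) ->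
  measurable_fun setT (fun x : R => (\int[mu]_y h (x, y))%E).
Proof.
move=> mh h0.
exact: (@measurable_fun_fubini_tonelli_F _ _ (measurableTypeR R)
  (measurableTypeR R) R mu h mh h0).
Qed.

Lemma cfubini (f : R -> R -> R[i]) : cmeas2 f ->
  (\int[mu]_x \int[mu]_y (cabs (f x y))%:E < +oo)%E ->
  [/\ cintg (fun x => cint (fun y => f x y)),
      cintg (fun y => cint (fun x => f x y)) &
      cint (fun x => cint (fun y => f x y)) =
      cint (fun y => cint (fun x => f x y))].
Proof.
move=> mf hf; have mcabs := meas2_cabs mf; move: (mf) => [mf1 mf2].
have dom (g : R * R -> R) : measurable_fun setT g ->
   (forall x y, `|g (x, y)| <= cabs (f x y)) ->
   (\int[mu]_x \int[mu]_y `|g (x, y)|%:E < +oo)%E.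
  move=> mg gf; apply: le_lt_trans hf.
  have m1 : measurable_fun setT (fun p : R * R => `|g p|%:E).
    by apply/measurable_EFinP; exact: measurableT_comp.
  have m2 : measurable_fun setT (fun p : R * R => (cabs (f p.1 p.2))%:E).
    exact/measurable_EFinP.
  apply: ge0_le_integral => //.
  - by move=> x _; apply: integral_ge0 => y _; rewrite lee_fin.
  - exact: (measurable_tonelli m1 (fun p => normr_ge0 (g p))).
  - exact: (measurable_tonelli m2 (fun p => cabs_ge0 (f p.1 p.2))).
  move=> x _; apply: ge0_le_integral => //.
  - exact: (measurableT_comp m1 (measurable_pair1 x)).
  - exact: (measurableT_comp m2 (measurable_pair1 x)).
  - by move=> y _; rewrite lee_fin gf.
have [a1 a2 a3] := rfubini mf1 (dom _ mf1 (fun x y => Re_le_cabs (f x y))).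
have [b1 b2 b3] := rfubini mf2 (dom _ mf2 (fun x y => Im_le_cabs (f x y))).
split; [exact: cintg_ReIm|exact: cintg_ReIm|].
by apply: eq_complexP; [exact: a3|exact: b3].
Qed.

Lemma cfubini_le (f : R -> R -> R[i]) (h : R -> R) : cmeas2 f ->
  (forall x, cintg (f x)) -> rintg h ->
  (forall x, rint (fun y => cabs (f x y)) <= h x) ->
  [/\ cintg (fun x => cint (fun y => f x y)),
      cintg (fun y => cint (fun x => f x y)) &
      cint (fun x => cint (fun y => f x y)) =
      cint (fun y => cint (fun x => f x y))].
Proof.
move=> mf iF ih fh; apply: cfubini => //.
have h0 x : 0 <= h x.
  by apply: le_trans (fh x); apply: rint_ge0 => y; exact: cabs_ge0.
have mcabs := meas2_cabs mf.
have m2 : measurable_fun setT (fun p : R * R => (cabs (f p.1 p.2))%:E).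
  exact/measurable_EFinP.
apply: (@le_lt_trans _ _ (\int[mu]_x (h x)%:E)%E); last first.
  by apply/(rintg_ge0P (rintg_meas ih) h0).
apply: ge0_le_integral => //.
- by move=> x _; apply: integral_ge0 => y _; rewrite lee_fin cabs_ge0.
- exact: (measurable_tonelli m2 (fun p => cabs_ge0 (f p.1 p.2))).
- by apply/measurable_EFinP; exact: rintg_meas.
- by move=> x _; rewrite rint_EFin; [rewrite lee_fin; exact: fh|exact: (iF x).2].
Qed.

(** The form suited to Fourier kernels: a factor of modulus one leaves a product of two integrable
    functions as majorant. *)
Lemma cfubini_prod (f : R -> R -> R[i]) (a b : R -> R) : cmeas2 f ->
  rintg a -> rintg b -> (forall x, 0 <= a x) -> (forall y, 0 <= b y) ->
  (forall x y, cabs (f x y) <= a x * b y) ->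
  [/\ cintg (fun x => cint (fun y => f x y)),
      cintg (fun y => cint (fun x => f x y)) &
      cint (fun x => cint (fun y => f x y)) =
      cint (fun y => cint (fun x => f x y))].
Proof.
move=> mf ia ib a0 b0 fab; apply: cfubini => //.
have mcabs := meas2_cabs mf.
have m2 : measurable_fun setT (fun p : R * R => (cabs (f p.1 p.2))%:E).
  exact/measurable_EFinP.
apply: (@le_lt_trans _ _ (\int[mu]_x (a x * rint b)%:E)%E); last first.
  rewrite rint_EFin ?ltry//; under eq_fun do rewrite mulrC.
  exact: rintgZ.
apply: ge0_le_integral => //.
- by move=> x _; apply: integral_ge0 => y _; rewrite lee_fin cabs_ge0.
- exact: (measurable_tonelli m2 (fun p => cabs_ge0 (f p.1 p.2))).
- apply/measurable_EFinP; apply: measurable_funM; first exact: rintg_meas.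
  exact: measurable_cst.
move=> x _; rewrite -rintZ// -rint_EFin; last exact: rintgZ.
apply: ge0_le_integral => //.
- by move=> y _; rewrite lee_fin cabs_ge0.
- exact: (measurableT_comp m2 (measurable_pair1 x)).
- by apply/measurable_EFinP; apply: measurable_funM => //; exact: rintg_meas.
- by move=> y _; rewrite lee_fin fab.
Qed.

End ComplexIntegrals.

#[global] Opaque cint rint.

#[local] Transparent rint.

(** * Primitives and integrability on the whole line *)

Section Calculus.
Context {R : realType}.
Local Notation mu := (@lebesgue_measure R).
Implicit Types (F f g : R -> R).

Lemma measurable_indic_itv (i : interval R) :
  measurable_fun setT (\1_[set` i] : R -> R).
Proof. by apply: measurable_indic; exact: measurable_itv. Qed.

Lemma rintg_indic (a b : R) : rintg (\1_`[a, b] : R -> R).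
Proof.
exact: integrable_indic_itv.
Qed.

Lemma Rintegral_indic (A : set R) f : measurable A ->
  \int[mu]_(x in A) f x = rint (fun x => \1_A x * f x).
Proof.
move=> mA; rewrite Rintegral_mkcond /rint; congr (Rintegral mu setT _).
by apply/funext => x; rewrite patchE indicE; case: ifPn => _; rewrite ?mul1r ?mul0r.
Qed.

Lemma is_derive_continuous F f : (forall x : R, is_derive x 1 F (f x)) ->
  continuous F.
Proof.
move=> dF x; apply: differentiable_continuous; apply/derivable1_diffP.
by have [] := dF x.
Qed.

Lemma rintg_itv (a b : R) f : continuous f -> rintg (fun x => \1_`[a, b] x * f x).
Proof.
move=> cf.
have : mu.-integrable `[a, b] (EFin \o f).
  apply: continuous_compact_integrable; first exact: segment_compact.
  exact: continuous_subspaceT.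
move=> /(proj1 (@integrable_mkcond _ _ R mu `[a, b]%classic _ (measurable_itv _))).
rewrite /rintg; congr (is_true (integrable _ _ _)); apply/funext => x.
by rewrite /= patchE indicE; case: ifPn => _; rewrite ?mul1r ?mul0r.
Qed.

Lemma rint_FTC (a b : R) F f : a <= b -> continuous f ->
  (forall x : R, is_derive x 1 F (f x)) ->
  rint (fun x => \1_`[a, b] x * f x) = F b - F a.
Proof.
move=> ab cf dF; rewrite -Rintegral_indic//.
move: ab; rewrite le_eqVlt => /predU1P[->|ab].
  rewrite subrr set_itv1 Rintegral_set1//.
have cF := is_derive_continuous dF.
have dFab : derivable_oo_LRcontinuous F a b.
  split; first by move=> x _; have [] := dF x.
    exact: cvg_at_right_filter (cF a).
  exact: cvg_at_left_filter (cF b).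
rewrite /Rintegral (@continuous_FTC2 _ f F a b)//.
  exact: continuous_subspaceT.
by move=> x _; rewrite derive1E; exact: derive_val.
Qed.

Lemma cvg_indic_sym (x : R) : \1_`[- n%:R, n%:R] x @[n --> \oo] --> (1 : R).
Proof.
apply: cvg_near_cst.
have [N hN] : exists N : nat, `|x| < N%:R.
  by exists (Num.bound `|x|); exact: archi_boundP.
exists N => // n /= Nn; rewrite indicE mem_set//= in_itv/= -ler_norml.
by rewrite (le_trans (ltW hN))// ler_nat.
Qed.

Lemma cvg_rint_sym f : rintg f ->
  rint (fun x => \1_`[- n%:R, n%:R] x * f x) @[n --> \oo] --> rint f.
Proof.
move=> hf; have mf := rintg_meas hf.
apply: (@rint_dct _ (fun n x => \1_`[- n%:R, n%:R] x * f x) f _ _ mf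
  (rintg_abs hf) _ _).2.
- by move=> n; apply: measurable_funM => //; exact: measurable_indic_itv.
- move=> n x; rewrite normrM ler_piMl// indicE; case: (_ \in _) => /=;
  by rewrite ?normr1 ?normr0.
- move=> x; rewrite -[X in _ --> X]mul1r; apply: cvgM; last exact: cvg_cst.
  exact: cvg_indic_sym.
Qed.

Lemma ge0_le_sym (n : nat) : - n%:R <= n%:R :> R.
Proof. by rewrite (@le_trans _ _ 0)// oppr_le0. Qed.

Lemma rint_FTC_R F f : continuous f -> rintg f ->
  (forall x : R, is_derive x 1 F (f x)) ->
  F n%:R - F (- n%:R) @[n --> \oo] --> rint f.
Proof.
move=> cf hf dF; have := cvg_rint_sym hf.
under eq_fun do rewrite (@rint_FTC (- _) _ F) ?ge0_le_sym//.
by [].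
Qed.

(** Monotone convergence along the windows [[-n, n]]. It produces integrability when only a
    primitive is under control, as for [cauchy_weight], the Poisson kernels and [|S'|^2]. *)
Lemma ge0_rintg_sym f (K : R) : continuous f -> (forall x, 0 <= f x) ->
  (forall n : nat, rint (fun x => \1_`[- n%:R, n%:R] x * f x) <= K) -> rintg f.
Proof.
move=> cf f0 fK; have mf := continuous_measurable_fun cf.
apply/rintg_ge0P => //.
pose g (n : nat) x := (\1_`[- n%:R, n%:R] x * f x)%:E.
have gM n : (\int[mu]_x g n x <= K%:E)%E.
  by rewrite rint_EFin; [rewrite lee_fin; exact: fK|exact: rintg_itv].
have cv := @cvg_monotone_convergence _ _ R mu setT measurableT g.
have lim x : limn (g ^~ x) = (f x)%:E.
  apply/cvg_lim => //; apply/fine_cvgP; split; first exact: nearW.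
  rewrite /g /= -[X in _ --> X]mul1r; apply: cvgM; last exact: cvg_cst.
  exact: cvg_indic_sym.
have {}cv : (\int[mu]_x g n x @[n --> \oo] --> \int[mu]_x (f x)%:E)%E.
  rewrite (_ : (\int[mu]_x (f x)%:E)%E = (\int[mu]_x limn (g ^~ x))%E).
    apply: cv.
    - by move=> n; apply/measurable_EFinP; apply: measurable_funM => //; exact: measurable_indic_itv.
    - by move=> n x _; rewrite lee_fin mulr_ge0// indicE.
    - move=> x _ m n mn; rewrite lee_fin ler_wpM2r// !indicE ler_nat.
      case: (boolP (x \in `[- m%:R, m%:R]%classic)) => // xm.
      suff -> : x \in `[- n%:R, n%:R]%classic by [].
      move: xm; rewrite !inE/= !in_itv/= -!ler_norml => /le_trans; apply.
      by rewrite ler_nat.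
  by apply: eq_integral => x _; rewrite lim.
apply: (@le_lt_trans _ _ K%:E); last exact: ltry.
rewrite -(cvg_lim _ cv)//; apply: lime_le; first by apply/cvg_ex; eexists; exact: cv.
exact: nearW.
Qed.

Lemma ge0_rintg_FTC F f (M : R) : continuous f -> (forall x, 0 <= f x) ->
  (forall x : R, is_derive x 1 F (f x)) -> (forall x, `|F x| <= M) -> rintg f.
Proof.
move=> cf f0 dF FM; apply: (ge0_rintg_sym (K := M + M)) => // n.
rewrite (rint_FTC _ cf dF) ?ge0_le_sym//.
apply: lerD; first exact: le_trans (ler_norm _) (FM _).
by apply: le_trans (ler_norm _) _; rewrite normrN.
Qed.

End Calculus.

#[global] Opaque rint.

(** * Fourier integrals and duality for the [L^2] transform *)

Section Fourier.
Context {R : realType}.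
Local Notation mu := (@lebesgue_measure R).
Local Notation cabs := (@Normc.normc R).
Implicit Types (f g k : R -> R[i]).

(** The derivative of [atan]: a bounded integrable weight that serves as the common majorant in the
    domination arguments. *)
Definition cauchy_weight (x : R) : R := (1 + x ^+ 2)^-1.

Lemma cauchy_weight_gt0 x : 0 < cauchy_weight x.
Proof. by rewrite invr_gt0 ltr_wpDr ?sqr_ge0. Qed.

Lemma cauchy_weight_le1 x : cauchy_weight x <= 1.
Proof. by rewrite invf_le1 ?lerDl ?sqr_ge0// ltr_wpDr ?sqr_ge0. Qed.

Lemma continuous_cauchy_weight : continuous cauchy_weight.
Proof.
move=> x; apply: cvgV.
  by rewrite gt_eqF// ltr_wpDr ?sqr_ge0.
by apply: cvgD; [exact: cvg_cst|exact: exprn_continuous].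
Qed.

Lemma rintg_cauchy_weight : rintg cauchy_weight.
Proof.
apply: (@ge0_rintg_FTC _ (@atan R) _ (pi / 2)).
- exact: continuous_cauchy_weight.
- by move=> x; exact: ltW (cauchy_weight_gt0 x).
- by move=> x; rewrite ler_norml (ltW (atan_gtNpi2 x)) (ltW (atan_ltpi2 x)).
Qed.

Definition sqintg f : Prop := cmeasurable f /\ rintg (fun x => normsq (f x)).

Lemma L2P f : L2 f <-> sqintg f.
Proof.
split=> [[mf hf]|[mf hf]]; split => //; apply/rintg_ge0P => //.
- exact: meas_normsq.
- by move=> x; exact: normsq_ge0.
- exact: meas_normsq.
- by move=> x; exact: normsq_ge0.
Qed.

Lemma mul_le_sqr (a b : R) : a * b <= 2^-1 * (a ^+ 2 + b ^+ 2).
Proof.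
by have := sqr_ge0 (a - b); nra.
Qed.

Lemma sqintg_mul f g : sqintg f -> sqintg g -> cintg (fun x => f x * g x).
Proof.
move=> [mf hf] [mg hg]; apply: cintg_le (rintgZ 2^-1 (rintgD hf hg)) _.
  exact: cmeasM.
by move=> x; rewrite cabsM -!cabs_normsq; exact: mul_le_sqr.
Qed.

Lemma sqintgJ f : sqintg f -> sqintg (fun x => (f x)^*).
Proof.
move=> [mf hf]; split; first exact: cmeasJ.
by under eq_fun do rewrite -cabs_normsq cabsJ cabs_normsq.
Qed.

Lemma sqintg_bdM f g (M : R) : cmeasurable f -> (forall x, cabs (f x) <= M) ->
  sqintg g -> sqintg (fun x => f x * g x).
Proof.
move=> mf fM [mg hg]; split; first exact: cmeasM.
apply: rintg_le (rintgZ (M ^+ 2) hg) _; first by apply: meas_normsq; exact: cmeasM.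
move=> x; rewrite ger0_norm ?normsq_ge0// -!cabs_normsq cabsM exprMn.
by rewrite ler_wpM2r ?sqr_ge0// lerXn2r ?nnegrE ?cabs_ge0// (le_trans _ (fM x)) ?cabs_ge0.
Qed.

Lemma sqintg_bd f (M : R) : cintg f -> (forall x, cabs (f x) <= M) -> sqintg f.
Proof.
move=> [mf hf] fM; split => //; apply: rintg_le (rintgZ M hf) _.
  exact: meas_normsq.
move=> x; rewrite ger0_norm ?normsq_ge0// -cabs_normsq expr2.
by rewrite ler_wpM2r ?cabs_ge0.
Qed.

Lemma sqintgD f g : sqintg f -> sqintg g -> sqintg (fun x => f x + g x).
Proof.
move=> [mf hf] [mg hg]; split; first exact: cmeasD.
apply: rintg_le (rintgZ 2 (rintgD hf hg)) _.
  by apply: meas_normsq; exact: cmeasD.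
move=> x; rewrite ger0_norm ?normsq_ge0// -!cabs_normsq.
apply: (@le_trans _ _ ((cabs (f x) + cabs (g x)) ^+ 2)).
  by rewrite lerXn2r ?nnegrE ?addr_ge0 ?cabs_ge0//; exact: cabsD.
by rewrite sqrrD; have := mul_le_sqr (cabs (f x)) (cabs (g x)); lra.
Qed.

Lemma sqintgN f : sqintg f -> sqintg (fun x => - f x).
Proof.
move=> [mf hf]; split; first exact: cmeasN.
by under eq_fun do rewrite -cabs_normsq cabsN cabs_normsq.
Qed.

Lemma sqintg_shift (a : R) f : sqintg f -> sqintg (fun x => f (x + a)).
Proof.
move=> [mf hf]; split; last exact: (rintg_shift a hf).
by apply: cmeas_comp mf _; exact: measurable_funD.
Qed.

Lemma sqintg_opp f : sqintg f -> sqintg (fun x => f (- x)).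
Proof.
move=> [mf hf]; split; last exact: (rintg_opp hf).
by apply: cmeas_comp mf _; exact: (@oppr_measurable R setT).
Qed.

Lemma sqintg_ae f g : cmeasurable g ->
  {ae mu, forall x, f x = g x} -> sqintg f -> sqintg g.
Proof.
move=> mg fg [mf hf]; split=> //; apply: rintg_ae hf; try exact: meas_normsq.
by apply: ae_mono fg => x ->.
Qed.

Lemma cauchy_schwarz f g : sqintg f -> sqintg g ->
  cabs (cint (fun x => f x * g x)) ^+ 2 <=
  rint (fun x => normsq (f x)) * rint (fun x => normsq (g x)).
Proof.
move=> hf hg; have ifg := sqintg_mul hf hg.
set A := rint _; set B := rint (fun x => normsq (g x)).
set X := cabs _.
have A0 : 0 <= A by apply: rint_ge0 => x; exact: normsq_ge0.
have B0 : 0 <= B by apply: rint_ge0 => x; exact: normsq_ge0.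
have X0 : 0 <= X by exact: cabs_ge0.
(* Weighted arithmetic-geometric inequality, integrated; the value of [t] is optimised
   afterwards. *)
have key (t : R) : 0 < t -> 2 * X <= t * A + t^-1 * B.
  move=> t0.
  rewrite -rintZ; last exact: hf.2.
  rewrite -rintZ; last exact: hg.2.
  rewrite -rintD; [|exact/rintgZ/hf.2|exact/rintgZ/hg.2].
  apply: (@le_trans _ _ (2 * rint (fun x => cabs (f x * g x)))).
    by rewrite ler_pM2l//; exact: cint_le.
  rewrite -rintZ; last exact: ifg.2.
  apply: rint_le.
  - exact/rintgZ/ifg.2.
  - by apply: rintgD; [exact/rintgZ/hf.2|exact/rintgZ/hg.2].
  move=> x; rewrite -!cabs_normsq cabsM.
  set a := cabs _; set b := cabs _.
  rewrite -subr_ge0 (_ : _ - _ = t^-1 * (t * a - b) ^+ 2).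
    by rewrite mulr_ge0 ?sqr_ge0// invr_ge0 ltW.
  by field; rewrite gt_eqF.
have [->|/eqP Xn0] := eqVneq X 0; first by rewrite expr0n mulr_ge0.
have Xp : 0 < X by rewrite lt_def X0 andbT; apply/eqP.
have [A0'|/eqP An0] := eqVneq A 0.
  (* With [A = 0] this [t] gives [2 X <= X B / (B + 1)], impossible for [X > 0]. *)
  have := key ((B + 1) / X) _; rewrite A0' mulr0 add0r invf_div.
  rewrite divr_gt0// ?ltr_wpDl// => /(_ isT) h; exfalso.
  move: h; rewrite mulrAC ler_pdivlMr ?ltr_wpDl//.
  by nra.
have Ap : 0 < A by rewrite lt_def A0 andbT; apply/eqP.
(* The optimal [t]: it gives [2 X <= X + A B / X], that is [X^2 <= A B]. *)
have := key (X / A) (divr_gt0 Xp Ap); rewrite divfK ?gt_eqF// invf_div.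
move=> h; have {}h : 2 * X * X <= (X + A / X * B) * X by rewrite ler_pM2r.
have e : (X + A / X * B) * X = X * X + A * B by field; apply/eqP.
by move: h; rewrite e expr2; lra.
Qed.

Definition ft f (xi : R) : R[i] := cint (fun x => f x * expi (- (x * xi))).

Lemma cabs_mul_expi z (a : R) : cabs (z * expi a) = cabs z.
Proof. by rewrite cabsM cabs_expi mulr1. Qed.

Lemma cmeas_idexpi : cmeasurable (@expi R).
Proof. by apply: cmeas_expi; exact: measurable_id. Qed.

Lemma cmeas2_kernel : cmeas2 (fun x xi : R => expi (- (x * xi)) : R[i]).
Proof.
apply: (@cmeas2_comp R (@expi R) (fun p => - (p.1 * p.2)) cmeas_idexpi).
apply: measurableT_comp; first exact: (@oppr_measurable R setT).
by apply: measurable_funM; [exact: measurable_fst|exact: measurable_snd].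
Qed.

Lemma cintg_expi f (h : R -> R) : measurable_fun setT h ->
  cintg f -> cintg (fun x => f x * expi (h x)).
Proof.
move=> mh [mf hf]; apply: cintg_le hf _.
  by apply: cmeasM => //; exact: cmeas_expi.
by move=> x; rewrite cabs_mul_expi.
Qed.

Lemma measurable_Nmul (xi : R) : measurable_fun setT (fun x : R => - (x * xi)).
Proof.
apply: measurableT_comp; first exact: (@oppr_measurable R setT).
by apply: measurable_funM; [exact: measurable_id|exact: measurable_cst].
Qed.

Lemma cintg_ft f xi : cintg f -> cintg (fun x => f x * expi (- (x * xi))).
Proof. by apply: cintg_expi; exact: measurable_Nmul. Qed.

Lemma ft_le f xi : cintg f -> cabs (ft f xi) <= rint (fun x => cabs (f x)).
Proof.
move=> hf; apply: le_trans (cint_le (cintg_ft xi hf)) _.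
by under eq_fun do rewrite cabs_mul_expi.
Qed.

Lemma ft_fubini f k : cintg f -> cintg k ->
  [/\ cintg (fun x => f x * ft k x), cintg (fun x => ft f x * k x) &
  cint (fun x => f x * ft k x) = cint (fun xi => ft f xi * k xi)].
Proof.
move=> hf hk.
have hb x xi : cabs (f x * (expi (- (x * xi)) * k xi)) <=
    cabs (f x) * cabs (k xi) by rewrite !cabsM cabs_expi mul1r.
have [h1 h2 h3] := cfubini_prod
  (cmeas2M (cmeas2_fst hf.1) (cmeas2M cmeas2_kernel (cmeas2_snd hk.1)))
  hf.2 hk.2 (fun x => cabs_ge0 _) (fun x => cabs_ge0 _) hb.
have e1 x : cint (fun xi => f x * (expi (- (x * xi)) * k xi)) = f x * ft k x.
  rewrite /ft -cintZ; last exact: cintg_ft.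
  by apply: eq_cint => y; rewrite [y * x]mulrC [_ * k y]mulrC.
have e2 xi : cint (fun x => f x * (expi (- (x * xi)) * k xi)) = ft f xi * k xi.
  rewrite /ft -cintZr; last exact: cintg_ft.
  by apply: eq_cint => y; rewrite mulrA.
rewrite (funext e1) in h1 h3; rewrite (funext e2) in h2 h3.
by split.
Qed.

(** Fubini against the integrable weight shows that [ft f] times the weight is integrable, hence
    measurable; the weight, which never vanishes, is then divided out. *)
Lemma cmeas_ft f : cintg f -> cmeasurable (ft f).
Proof.
move=> hf; have [_ [h _] _] := ft_fubini hf (cintgR rintg_cauchy_weight).
have := cmeasM h (cmeasR (h := fun x => 1 + x ^+ 2) _).
rewrite (_ : (fun x => _) = ft f).
  by apply; apply: measurable_funD; [exact: measurable_cst|exact: measurable_funX].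
apply/funext => x; rewrite -mulrA -rmorphM/= mulVf ?mulr1//.
by rewrite gt_eqF// ltr_wpDr ?sqr_ge0.
Qed.

Lemma fourier_windowE f n xi : fourier_window f n xi =
  ft (fun x => (\1_`[- n%:R, n%:R] x)%:C * f x) xi.
Proof.
rewrite /fourier_window /cintegral /ft cintE !Rintegral_indic//.
congr Complex; congr rint; apply/funext => x; rewrite -mulrA.
  by rewrite [in RHS]cReM /= mul0r subr0.
by rewrite [in RHS]cImM /= mul0r addr0.
Qed.

Lemma cabs_indic (A : set R) x z : cabs ((\1_A x)%:C * z) <= cabs z.
Proof.
rewrite cabsM cabsR indicE; case: (_ \in _); rewrite ?normr1 ?normr0 ?mul1r//.
by rewrite mul0r cabs_ge0.
Qed.

Lemma cmeas_indic (i : interval R) : cmeasurable (fun x => (\1_[set` i] x)%:C).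
Proof. by apply: cmeasR; exact: measurable_indic_itv. Qed.

Lemma cintg_window f (a b : R) : sqintg f ->
  cintg (fun x => (\1_`[a, b] x)%:C * f x).
Proof.
move=> hf; apply: sqintg_mul => //; split; first exact: cmeas_indic.
apply: rintg_le (rintg_indic a b) _; first by apply: meas_normsq; exact: cmeas_indic.
move=> x; rewrite ger0_norm ?normsq_ge0// -cabs_normsq cabsR indicE.
by case: (_ \in _); rewrite ?normr1 ?normr0 ?expr1n ?expr0n.
Qed.

Lemma eq_ccvg (u v : nat -> R[i]) z : (forall n, u n = v n) ->
  ccvg u z -> ccvg v z.
Proof. by move=> /funext ->. Qed.

Lemma ccvg_indic (x : R) (z : R[i]) : ccvg (fun n : nat => (\1_`[- n%:R, n%:R] x)%:C * z) z.
Proof.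
rewrite -[X in ccvg _ X]mul1r; apply: ccvgM; last exact: ccvg_cst.
by apply: ccvgR; exact: cvg_indic_sym.
Qed.

(** For windowed [f] this is Fubini. The left sides converge by domination, since [f * ft k] is
    integrable; the right sides by Cauchy-Schwarz, since the windowed transforms converge in [L^2].
    The pairing is bilinear, without conjugation. *)
Lemma is_fourier_parseval f fh k : is_fourier f fh -> cintg k -> sqintg k ->
  cintg (fun x => f x * ft k x) ->
  cint (fun x => f x * ft k x) = cint (fun xi => fh xi * k xi).
Proof.
move=> [/L2P hf /L2P hfh cv] ik k2 ifk.
pose fn n x := (\1_`[- n%:R, n%:R] x)%:C * f x.
have ifn n : cintg (fn n) by exact: cintg_window.
have mdn n : cmeasurable (fun xi => ft (fn n) xi - fh xi).
  by apply: cmeasD; [exact: cmeas_ft|exact: cmeasN hfh.1].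
have {}cv : mass (fun xi => ft (fn n) xi - fh xi) @[n --> \oo] --> 0%E.
  have -> : (fun n => mass (fun xi => ft (fn n) xi - fh xi)) =
      (fun n => mass (fun xi => fourier_window f n xi - fh xi)).
    apply/funext => n; congr (mass _); apply/funext => xi.
    by rewrite fourier_windowE.
  exact: cv.
have /fine_cvgP[cvf cv0] := cv.
have lhs : ccvg (fun n => cint (fun xi => ft (fn n) xi * k xi))
    (cint (fun x => f x * ft k x)).
  have [_ ->] : True /\ (fun n => cint (fun xi => ft (fn n) xi * k xi)) =
      (fun n => cint (fun x => fn n x * ft k x)).
    split=> //; apply/funext => n; have [_ _ ->] := ft_fubini (ifn n) ik.
    by [].
  apply: (cint_dct (g := fun x => cabs (f x * ft k x)) _ ifk.1 ifk.2 _ _).2.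
  - by move=> n; apply: cmeasM; [exact: (ifn n).1|exact: cmeas_ft].
  - by move=> n x; rewrite /fn -mulrA; exact: cabs_indic.
  - move=> x; apply: eq_ccvg (ccvg_indic x (f x * ft k x)) => n.
    by rewrite /fn mulrA.
have rhs : ccvg (fun n => cint (fun xi => ft (fn n) xi * k xi))
    (cint (fun xi => fh xi * k xi)).
  pose B := rint (fun x => normsq (k x)).
  have h0 : Num.sqrt (fine (mass (fun xi => ft (fn n) xi - fh xi)) * B)
      @[n --> \oo] --> 0.
    rewrite -sqrtr0; apply: cvg_comp; last exact: sqrt_continuous.
    by rewrite -(mul0r B); apply: cvgM => //; exact: cvg_cst.
  apply: (@squeeze_cvgr _ _ _ _ (cst 0) _ _ _ _ _ h0); last exact: cvg_cst.
  (* The squared distance is an extended real, known to be finite only for large [n], so the squeeze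
     holds only eventually. *)
  near=> n.
  have fn2 : sqintg (fun xi => ft (fn n) xi - fh xi).
    apply/L2P; split => //; rewrite ltey_eq; apply/orP; left.
    by near: n.
  apply/andP; split; first exact: cabs_ge0.
  rewrite -cintB; last 2 first.
  - by have [] := ft_fubini (ifn n) ik.
  - exact: sqintg_mul.
  rewrite -[leLHS]ger0_norm ?cabs_ge0// -sqrtr_sqr ler_wsqrtr//.
  under eq_cint do rewrite -mulrBl.
  exact: cauchy_schwarz.
exact: ccvg_uniq lhs rhs.
Unshelve. all: by end_near. Qed.

End Fourier.

(** * Calculus of complex functions of a real variable; Laplace integrals *)

Section ComplexCalculus.
Context {R : realType}.
Local Notation mu := (@lebesgue_measure R).
Local Notation cabs := (@Normc.normc R).
Implicit Types (F f g G : R -> R[i]) (h : R -> R) (z : R[i]).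

Definition cder F f : Prop :=
  (forall x : R, is_derive x 1 (fun x => complex.Re (F x)) (complex.Re (f x))) /\
  (forall x : R, is_derive x 1 (fun x => complex.Im (F x)) (complex.Im (f x))).

Definition ccont f : Prop :=
  continuous (fun x => complex.Re (f x)) /\ continuous (fun x => complex.Im (f x)).

Lemma eq_cder F f g : (forall x, f x = g x) -> cder F f -> cder F g.
Proof. by move=> /funext ->. Qed.

Lemma eq_cderl F G f : (forall x, F x = G x) -> cder F f -> cder G f.
Proof. by move=> /funext ->. Qed.

Lemma cder_cst z : cder (fun=> z) (fun=> 0).
Proof. by split => x /=; exact: is_derive_cst. Qed.

Lemma cder_real h h' : (forall x : R, is_derive x 1 h (h' x)) ->
  cder (fun x => (h x)%:C) (fun x => (h' x)%:C).
Proof. by move=> dh; split => x /=; [exact: dh|exact: is_derive_cst]. Qed.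

Lemma cderD F G f g : cder F f -> cder G g ->
  cder (fun x => F x + G x) (fun x => f x + g x).
Proof.
move=> [F1 F2] [G1 G2]; split => x.
  by rewrite cReD; under eq_fun do rewrite cReD; exact: is_deriveD.
by rewrite cImD; under eq_fun do rewrite cImD; exact: is_deriveD.
Qed.

Lemma cderM F G f g : cder F f -> cder G g ->
  cder (fun x => F x * G x) (fun x => f x * G x + F x * g x).
Proof.
move=> [F1 F2] [G1 G2]; split => x.
  under eq_fun do rewrite cReM.
  apply: is_derive_eq.
  by rewrite cReD !cReM /GRing.scale/=; ring.
under eq_fun do rewrite cImM.
apply: is_derive_eq.
by rewrite cImD !cImM /GRing.scale/=; ring.
Qed.

Lemma cderZ z F f : cder F f -> cder (fun x => z * F x) (fun x => z * f x).
Proof.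
move=> dF; apply: eq_cder (cderM (cder_cst z) dF) => x.
by rewrite mul0r add0r.
Qed.

Lemma cder_expi h h' : (forall x : R, is_derive x 1 h (h' x)) ->
  cder (fun x => expi (h x)) (fun x => (0 +i* h' x) * expi (h x)).
Proof.
move=> dh; split => x; rewrite ?cReM ?cImM /=.
  by apply: is_derive_eq; rewrite /GRing.scale/=; ring.
by apply: is_derive_eq; rewrite /GRing.scale/=; ring.
Qed.

Lemma cder_cont F f : cder F f -> ccont F.
Proof.
by move=> [F1 F2]; split; [exact: is_derive_continuous F1|
  exact: is_derive_continuous F2].
Qed.

Lemma ccont_cst z : ccont (fun=> z).
Proof. by split => x; exact: cvg_cst. Qed.

Lemma ccontM f g : ccont f -> ccont g -> ccont (fun x => f x * g x).
Proof.
move=> [f1 f2] [g1 g2]; split.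
  under eq_fun do rewrite cReM.
  by move=> x; apply: cvgB; apply: cvgM;
    [exact: f1|exact: g1|exact: f2|exact: g2].
under eq_fun do rewrite cImM.
by move=> x; apply: cvgD; apply: cvgM;
  [exact: f1|exact: g2|exact: f2|exact: g1].
Qed.

Lemma ccontD f g : ccont f -> ccont g -> ccont (fun x => f x + g x).
Proof.
move=> [f1 f2] [g1 g2]; split.
  under eq_fun do rewrite cReD.
  by move=> x; apply: cvgD; [exact: f1|exact: g1].
under eq_fun do rewrite cImD.
by move=> x; apply: cvgD; [exact: f2|exact: g2].
Qed.

Lemma ccontR h : continuous h -> ccont (fun x => (h x)%:C).
Proof. by move=> ch; split => //= x; exact: cvg_cst. Qed.

Lemma ccont_meas f : ccont f -> cmeasurable f.
Proof. by move=> [f1 f2]; split; exact: continuous_measurable_fun. Qed.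

Lemma cintg_itv (a b : R) f : ccont f -> cintg (fun x => (\1_`[a, b] x)%:C * f x).
Proof.
move=> [f1 f2]; apply: cintg_ReIm.
  by under eq_fun do rewrite cReM /= mul0r subr0; exact: rintg_itv.
by under eq_fun do rewrite cImM /= mul0r addr0; exact: rintg_itv.
Qed.

Lemma cint_FTC (a b : R) F f : a <= b -> ccont f -> cder F f ->
  cint (fun x => (\1_`[a, b] x)%:C * f x) = F b - F a.
Proof.
move=> ab [f1 f2] [F1 F2]; rewrite cintE; apply: eq_complexP => /=.
  under eq_fun do rewrite cReM /= mul0r subr0.
  by rewrite (rint_FTC ab f1 F1) cReD cReN.
under eq_fun do rewrite cImM /= mul0r addr0.
by rewrite (rint_FTC ab f2 F2) cImD cImN.
Qed.

Lemma cvg_cint_sym f : cintg f ->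
  ccvg (fun n : nat => cint (fun x => (\1_`[- n%:R, n%:R] x)%:C * f x)) (cint f).
Proof.
move=> hf; apply: (cint_dct _ hf.1 hf.2 _ _).2.
- by move=> n; apply: cmeasM; [exact: cmeas_indic|exact: hf.1].
- by move=> n x; exact: cabs_indic.
- by move=> x; exact: ccvg_indic.
Qed.

Definition half_line (x : R) : R := \1_`[0, +oo[ x.

Lemma half_line_ge0 x : 0 <= x -> half_line x = 1.
Proof. by move=> x0; rewrite /half_line indicE mem_set//= in_itv/= x0. Qed.

Lemma half_line_lt0 x : x < 0 -> half_line x = 0.
Proof.
move=> x0; rewrite /half_line indicE memNset//= in_itv/= andbT.
by apply/negP; rewrite -ltNge.
Qed.

Lemma measurable_half_line : measurable_fun setT half_line.
Proof. exact: measurable_indic_itv. Qed.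

Lemma cint_FTC_half F f z : ccont f ->
  cintg (fun x => (half_line x)%:C * f x) -> cder F f ->
  ccvg (fun n : nat => F n%:R) z ->
  cint (fun x => (half_line x)%:C * f x) = z - F 0.
Proof.
move=> cf hf dF hz.
have h : ccvg (fun n : nat => F n%:R - F 0) (z - F 0).
  by apply: ccvgD => //; exact: ccvg_cst.
apply: ccvg_uniq h; apply: eq_ccvg (cvg_cint_sym hf) => n.
rewrite -(cint_FTC (ler0n _ n) cf dF).
apply: eq_cint => x; rewrite mulrA -rmorphM/=; congr (_%:C * _).
have [x0|x0] := leP 0 x.
  rewrite half_line_ge0// mulr1 !indicE; congr ((nat_of_bool _)%:R).
  have n0 : - n%:R <= x by rewrite (le_trans _ x0)// oppr_le0.
  by apply/idP/idP; rewrite !inE/= !in_itv/= x0 n0.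
rewrite half_line_lt0// mulr0 indicE memNset//= in_itv/= leNgt x0.
by [].
Qed.

Lemma expR_le_inv (t : R) : 0 <= t -> expR (- t) <= (1 + t)^-1.
Proof.
move=> t0; rewrite expRN lef_pV2 ?posrE ?expR_gt0 ?ltr_wpDr//.
exact: expR_ge1Dx.
Qed.

(** With [t = y |x| / 2] the exponential is [(e^(-t))^2 <= (1 + t)^(-2) <= 1 / (1 + t^2)], and
    [(1 + 4 / y^2) (1 + t^2) >= 1 + x^2]. *)
Lemma expR_le_cauchy (y x : R) : 0 < y ->
  expR (- (y * `|x|)) <= (1 + 4 / y ^+ 2) * cauchy_weight x.
Proof.
move=> y0; set t := y * `|x| / 2.
have t0 : 0 <= t by rewrite divr_ge0// mulr_ge0// ltW.
have -> : - (y * `|x|) = - t + - t by rewrite /t; field.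
rewrite expRD.
have h := expR_le_inv t0.
apply: (@le_trans _ _ ((1 + t)^-1 * (1 + t)^-1)).
  by apply: ler_pM => //; exact: expR_ge0.
have t1 : 0 < 1 + t by rewrite ltr_wpDr.
rewrite /cauchy_weight -invfM ler_pdivlMr ?ltr_wpDr ?sqr_ge0//.
rewrite mulrC ler_pdivrMr ?mulr_gt0//.
have y2 : 0 < y ^+ 2 by rewrite exprn_gt0.
have e : (1 + 4 / y ^+ 2) * (1 + t ^+ 2) = 1 + x ^+ 2 + (4 / y ^+ 2 + t ^+ 2).
  rewrite /t !expr_div_n exprMn real_normK ?num_real//; field; exact: lt0r_neq0.
apply: (@le_trans _ _ ((1 + 4 / y ^+ 2) * (1 + t ^+ 2))).
  by rewrite e lerDl addr_ge0 ?sqr_ge0// divr_ge0// ltW.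
have h2 : 1 + t ^+ 2 <= (1 + t) * (1 + t) by nra.
by rewrite ler_wpM2l// addr_ge0// divr_ge0// ltW.
Qed.

(** Half of the decay absorbs the factor [|x|], because [t e^(-t) <= 1]. *)
Lemma mul_expR_le (y x : R) : 0 < y ->
  `|x| * expR (- (y * `|x|)) <= 2 / y * expR (- (y / 2 * `|x|)).
Proof.
move=> y0; set t := y / 2 * `|x|.
have t0 : 0 <= t by rewrite mulr_ge0// divr_ge0// ltW.
have -> : - (y * `|x|) = - t + - t by rewrite /t; field.
rewrite expRD mulrA ler_wpM2r ?expR_ge0//.
have -> : `|x| = 2 / y * t by rewrite /t; field; exact: lt0r_neq0.
rewrite -[2 / y * t * _]mulrA ler_piMr//; first by rewrite divr_ge0// ltW.
rewrite expRN ler_pdivrMr ?expR_gt0// mul1r.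
by apply: le_trans (expR_ge1Dx t); rewrite lerDr.
Qed.

Lemma rintg_expR (y : R) : 0 < y -> rintg (fun x => expR (- (y * `|x|))).
Proof.
move=> y0; apply: rintg_le (rintgZ (1 + 4 / y ^+ 2) rintg_cauchy_weight) _.
  apply: measurableT_comp; first exact: measurable_expR.
  apply: measurableT_comp; first exact: (@oppr_measurable R setT).
  apply: measurable_funM; first exact: measurable_cst.
  exact: (@normr_measurable R setT).
by move=> x; rewrite ger0_norm ?expR_ge0//; exact: expR_le_cauchy.
Qed.

Lemma cvg_expR_nat (y : R) : 0 < y -> expR (- (y * n%:R)) @[n --> \oo] --> 0.
Proof.
move=> y0; apply: (@squeeze0 _ _ (fun n => y^-1 * (n.+1%:R)^-1 + (n.+1%:R)^-1)).
  move=> n; rewrite expR_ge0/=.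
  have h : 0 <= y * n%:R by rewrite mulr_ge0// ltW.
  apply: le_trans (expR_le_inv h) _.
  have yn : 0 < 1 + y * n%:R by rewrite ltr_wpDr.
  have n1 : 0 < 1 + n%:R :> R by rewrite ltr_wpDr.
  have yi : 0 < y^-1 by rewrite invr_gt0.
  rewrite -(nat1r n) -[leLHS]mul1r ler_pdivrMr//.
  rewrite [leRHS](_ : _ = 1 + (y^-1 + y * n%:R) / (1 + n%:R)).
    by rewrite lerDl divr_ge0// ?addr_ge0// ltW.
  by field; rewrite !lt0r_neq0.
rewrite -[X in _ --> X]addr0; apply: cvgD; last exact: cvg_harmonic.
by rewrite -(mulr0 y^-1); apply: cvgM; [exact: cvg_cst|exact: cvg_harmonic].
Qed.

(** The exponential [e^(-(y - i s) x)]; on the half line its integral and first moment are the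
    Laplace transforms of [1] and [x] at [y - i s]. *)
Definition half_exp (y s x : R) : R[i] := (expR (- (y * x)))%:C * expi (s * x).

Lemma cder_half_exp (y s : R) :
  cder (half_exp y s) (fun x => - (y +i* - s) * half_exp y s x).
Proof.
have d1 (x : R) : is_derive x 1 (fun x : R => expR (- (y * x))) (- y * expR (- (y * x))).
  by apply: is_derive_eq; rewrite /GRing.scale/=; ring.
have d2 (x : R) : is_derive x 1 (fun x : R => s * x) s.
  by apply: is_derive_eq; rewrite /GRing.scale/= mulr1.
apply: eq_cder (cderM (cder_real d1) (cder_expi d2)) => x; rewrite /half_exp.
have -> : 0 +i* s = - (- 'i%C * s%:C) :> R[i] by apply: eq_complexP => /=; ring.
have -> : y +i* - s = y%:C - 'i%C * s%:C :> R[i] by apply: eq_complexP => /=; ring.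
by rewrite rmorphM rmorphN/=; ring.
Qed.

Lemma cabs_half_exp (y s x : R) : cabs (half_exp y s x) = expR (- (y * x)).
Proof. by rewrite /half_exp cabs_mul_expi cabsR ger0_norm ?expR_ge0. Qed.

Lemma cintg_half_exp (y s : R) : 0 < y ->
  cintg (fun x => (half_line x)%:C * half_exp y s x).
Proof.
move=> y0; apply: cintg_le (rintg_expR y0) _.
  apply: cmeasM; first by apply: cmeasR; exact: measurable_half_line.
  exact/ccont_meas/(cder_cont (cder_half_exp y s)).
move=> x; rewrite cabsM cabs_half_exp cabsR.
have [x0|x0] := leP 0 x; first by rewrite half_line_ge0// normr1 mul1r ger0_norm.
by rewrite half_line_lt0// normr0 mul0r expR_ge0.
Qed.

Lemma cintg_x_half_exp (y s : R) : 0 < y ->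
  cintg (fun x => (half_line x)%:C * (x%:C * half_exp y s x)).
Proof.
move=> y0.
have y2 : 0 < y / 2 by rewrite divr_gt0.
apply: cintg_le (rintgZ (2 / y) (rintg_expR y2)) _.
  apply: cmeasM; first by apply: cmeasR; exact: measurable_half_line.
  apply: cmeasM; first by apply: cmeasR; exact: measurable_id.
  exact/ccont_meas/(cder_cont (cder_half_exp y s)).
move=> x; rewrite (cabsM (half_line x)%:C) (cabsM x%:C) cabs_half_exp !cabsR.
have [x0|x0] := leP 0 x.
  by rewrite half_line_ge0// normr1 mul1r -{2}(ger0_norm x0); exact: mul_expR_le.
by rewrite half_line_lt0// normr0 mul0r mulr_ge0 ?expR_ge0// divr_ge0// ltW.
Qed.

Lemma Complex_neq0 (y s : R) : 0 < y -> y +i* s != 0 :> R[i].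
Proof. by move=> y0; rewrite eq_complex /= negb_and gt_eqF. Qed.

Lemma cint_half_exp (y s : R) : 0 < y ->
  cint (fun x => (half_line x)%:C * half_exp y s x) = (y +i* - s)^-1.
Proof.
move=> y0; have zn := Complex_neq0 (- s) y0; set z := y +i* - s in zn *.
rewrite (@cint_FTC_half (fun x => - z^-1 * half_exp y s x) _ 0).
- by rewrite /half_exp !mulr0 oppr0 expR0 expi0 mulr1 sub0r; ring.
- exact: cder_cont (cder_half_exp y s).
- exact: cintg_half_exp.
- apply: eq_cder (cderZ (- z^-1) (cder_half_exp y s)) => x.
  by rewrite -/z; field.
- rewrite -(mulr0 (- z^-1)); apply: ccvgM; first exact: ccvg_cst.
  apply: ccvg_le (cvg_expR_nat y0) => n.
  by rewrite subr0 cabs_half_exp.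
Qed.

Lemma cint_x_half_exp (y s : R) : 0 < y ->
  cint (fun x => (half_line x)%:C * (x%:C * half_exp y s x)) = (y +i* - s)^-2.
Proof.
move=> y0; have zn := Complex_neq0 (- s) y0; set z := y +i* - s in zn *.
have dx : cder (fun x : R => x%:C) (fun=> 1).
  apply: eq_cder (cder_real (h' := fun=> 1) _) => // x.
(* Integration by parts gives this primitive of [x e^(-z x)]; it tends to 0 at infinity and equals
   [- z^(-2)] at 0. *)
rewrite (@cint_FTC_half (fun x => - (z^-1 * x%:C + z^-2) * half_exp y s x) _ 0).
- by rewrite /half_exp !mulr0 oppr0 expR0 expi0 mulr1 sub0r add0r; ring.
- apply: ccontM; first exact: cder_cont dx.
  exact: cder_cont (cder_half_exp y s).
- exact: cintg_x_half_exp.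
- have d1 : cder (fun x : R => - (z^-1 * x%:C + z^-2)) (fun=> - z^-1).
    have := cderZ (-1) (cderD (cderZ (z^-1) dx) (cder_cst (z^-2))).
    move=> h; apply: eq_cderl (eq_cder _ h) => x; by rewrite mulN1r ?addr0 ?mulr1.
  apply: eq_cder (cderM d1 (cder_half_exp y s)) => x.
  by rewrite -/z; field.
- have e n : - (z^-1 * n%:R%:C + z^-2) * half_exp y s n%:R =
     - z^-1 * (n%:R%:C * half_exp y s n%:R) + - z^-2 * half_exp y s n%:R.
    by ring.
  apply: eq_ccvg (fun n => esym (e n)) _.
  rewrite -(addr0 0) -{1}(mulr0 (- z^-1)) -[X in _ + X](mulr0 (- z^-2)).
  apply: ccvgD; apply: ccvgM; try exact: ccvg_cst.
    have y2 : 0 < y / 2 by rewrite divr_gt0.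
    apply: (@ccvg_le _ _ (fun n => 2 / y * expR (- (y / 2 * n%:R)))) => [n|].
      rewrite subr0 cabsM cabs_half_exp cabsR.
      by have := mul_expR_le n%:R y0; rewrite !(ger0_norm (ler0n _ _)).
    rewrite -(mulr0 (2 / y)); apply: cvgM; first exact: cvg_cst.
    exact: cvg_expR_nat.
  apply: ccvg_le (cvg_expR_nat y0) => n.
  by rewrite subr0 cabs_half_exp.
Qed.

End ComplexCalculus.

(** * Poisson kernels and Fourier inversion *)

Section Inversion.
Context {R : realType}.
Local Notation mu := (@lebesgue_measure R).
Local Notation cabs := (@Normc.normc R).
Implicit Types (f g : R -> R[i]).

Lemma ae_neq (a : R) : {ae mu, forall x, x != a}.
Proof.
exists [set a]; split; [exact: measurable_set1|exact: lebesgue_measure_set1|].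
by move=> x /= /negP; rewrite negbK => /eqP.
Qed.

(** The indefinite integral from [-n] vanishes identically, and Lebesgue differentiation recovers
    [h] from it almost everywhere on []-n, +oo[]; countably many [n] suffice. *)
Lemma interval_integrals_ae0 (h : R -> R) : measurable_fun setT h ->
  (forall a b, rintg (fun x => \1_`[a, b] x * h x)) ->
  (forall a b, a <= b -> rint (fun x => \1_`[a, b] x * h x) = 0) ->
  {ae mu, forall x, h x = 0}.
Proof.
move=> mh ih h0.
have ihab a b : mu.-integrable `[a, b] (EFin \o h).
  apply: (proj2 (@integrable_mkcond _ _ R mu `[a, b]%classic _ (measurable_itv _))).
  have := ih a b; rewrite /rintg; congr (is_true (integrable _ _ _)).
  apply/funext => x.
  by rewrite /= patchE indicE; case: ifPn => _; rewrite ?mul1r ?mul0r.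
have loc : locally_integrable setT h.
  split => //; first exact: openT.
  move=> K _ cK; have mK := compact_measurable cK.
  have [M [_ /(_ (M + 1))]] := compact_bounded cK.
  rewrite ltrDl ltr01 => /(_ isT) KM.
  have /integrableP[_] := ihab (- (M + 1)) (M + 1).
  apply: le_lt_trans; apply: ge0_subset_integral => //.
  - apply/measurable_EFinP; apply: measurableT_comp => //.
    exact: measurable_funTS.
  - by move=> x /KM /=; rewrite in_itv/= -ler_norml.
suff H (n : nat) : {ae mu, forall x, - n%:R < x -> h x = 0}.
  have : {ae mu, forall x, forall n : nat, - n%:R < x -> h x = 0}.
    by apply/ae_foralln => n; exact: H.
  apply: ae_mono => x hx; apply: (hx (Num.bound `|x|)).
  by rewrite ltrNl (le_lt_trans (ler_norm _))// normrN archi_boundP.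
have := @FTC1 R h (BLeft (- n%:R)) (ihab _) loc.
apply: ae_mono => x hx nx.
have [|_ <-] := hx; first by rewrite /= lte_fin.
rewrite (_ : (fun x => _) = cst 0); first exact: derive1_cst.
apply/funext => y /=; have [ny|yn] := leP (- n%:R) y.
  by rewrite Rintegral_indic// h0.
by rewrite set_itv_ge ?Rintegral_set0// bnd_simp -ltNge.
Qed.

Lemma interval_cintegrals_ae0 f : cmeasurable f ->
  (forall a b, cintg (fun x => (\1_`[a, b] x)%:C * f x)) ->
  (forall a b, a <= b -> cint (fun x => (\1_`[a, b] x)%:C * f x) = 0) ->
  {ae mu, forall x, f x = 0}.
Proof.
move=> [f1 f2] hf f0.
have e1 a b x : complex.Re ((\1_`[a, b] x)%:C * f x) = \1_`[a, b] x * complex.Re (f x).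
  by rewrite cReM /= mul0r subr0.
have e2 a b x : complex.Im ((\1_`[a, b] x)%:C * f x) = \1_`[a, b] x * complex.Im (f x).
  by rewrite cImM /= mul0r addr0.
have h1 : {ae mu, forall x, complex.Re (f x) = 0}.
  apply: interval_integrals_ae0 => // a b.
    by have := cintg_Re (hf a b); rewrite (funext (e1 a b)).
  move=> /f0 /(congr1 (@complex.Re R)); rewrite cintE /=.
  by rewrite (funext (e1 a b)).
have h2 : {ae mu, forall x, complex.Im (f x) = 0}.
  apply: interval_integrals_ae0 => // a b.
    by have := cintg_Im (hf a b); rewrite (funext (e2 a b)).
  move=> /f0 /(congr1 (@complex.Im R)); rewrite cintE /=.
  by rewrite (funext (e2 a b)).
by apply: ae_mono2 h1 h2 => x a b; exact: eq_complexP.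
Qed.

(** The Poisson kernel of the half plane normalised to total mass [2 pi], so that it is exactly the
    transform of [e^(-y |xi|)]. *)
Definition poisson (y s : R) : R := 2 * y / (y ^+ 2 + s ^+ 2).

Definition abel (y a xi : R) : R[i] := (expR (- (y * `|xi|)))%:C * expi (a * xi).

Lemma measurable_mull (a : R) : measurable_fun setT (fun x : R => a * x).
Proof. by apply: measurable_funM; [exact: measurable_cst|exact: measurable_id]. Qed.

Lemma cintg_abel (y a : R) : 0 < y -> cintg (abel y a).
Proof.
move=> y0; apply: cintg_expi; first exact: measurable_mull.
exact/cintgR/rintg_expR.
Qed.

Lemma cabs_abel_le1 (y a xi : R) : 0 < y -> cabs (abel y a xi) <= 1.
Proof.
move=> y0; rewrite cabs_mul_expi cabsR ger0_norm ?expR_ge0//.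
by rewrite expR_le1 oppr_le0 mulr_ge0// ltW.
Qed.

Lemma sqintg_abel (y a : R) : 0 < y -> sqintg (abel y a).
Proof.
move=> y0; apply: (@sqintg_bd _ _ 1); first exact: cintg_abel.
by move=> xi; exact: cabs_abel_le1.
Qed.

(** Cut at the origin, the integral is a sum of two Laplace integrals,
    [1 / (y - i s) + 1 / (y + i s)] with [s = a - x]. *)
Lemma ft_abel (y a x : R) : 0 < y -> ft (abel y a) x = (poisson y (x - a))%:C.
Proof.
move=> y0.
pose H s xi := (half_line xi)%:C * half_exp y s xi.
have iH s : cintg (H s) by exact: cintg_half_exp.
rewrite /ft (@cint_ae R _ (fun xi => H (a - x) xi + H (x - a) (- xi))); last 3 first.
- exact: (cintg_ft x (cintg_abel a y0)).1.
- by apply: cmeasD; [exact: (iH _).1|exact: (cintg_opp (iH _)).1].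
- apply: ae_mono (ae_neq 0) => xi xi0; rewrite /H /abel /half_exp -mulrA -expiD.
  have [xp|xp] := ltP 0 xi.
    rewrite half_line_ge0 ?ltW// (@half_line_lt0 _ (- xi)) ?oppr_lt0//.
    by rewrite mul0r addr0 mul1r gtr0_norm//; congr (_ * expi _); ring.
  have xn : xi < 0 by rewrite lt_neqAle xi0.
  rewrite half_line_lt0// half_line_ge0 ?oppr_ge0//.
  by rewrite mul0r add0r mul1r ltr0_norm//; congr (_ * expi _); ring.
rewrite cintD//; last exact: cintg_opp.
rewrite (cint_opp (iH _)) !cint_half_exp//.
have n1 : y ^+ 2 + (x - a) ^+ 2 != 0.
  by rewrite gt_eqF// ltr_pwDl ?sqr_ge0// exprn_gt0.
have e1 : (- (a - x)) ^+ 2 = (x - a) ^+ 2 by ring.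
have e2 : (- (x - a)) ^+ 2 = (x - a) ^+ 2 by ring.
by apply: eq_complexP; rewrite /poisson /= e1 e2; field.
Qed.

Lemma poisson_ge0 y s : 0 < y -> 0 <= poisson y s.
Proof.
move=> y0; rewrite /poisson divr_ge0 ?addr_ge0 ?sqr_ge0//.
by rewrite mulr_ge0// ltW.
Qed.

(** Peetre's inequality, here [1 + x^2 <= 2 (1 + a^2) (1 + (x - a)^2)]: kernels centred at any [a]
    get a majorant centred at 0. *)
Lemma peetre (x a : R) : cauchy_weight (x - a) <= 2 * (1 + a ^+ 2) * cauchy_weight x.
Proof.
rewrite /cauchy_weight ler_pdivlMr ?ltr_wpDr ?sqr_ge0//.
rewrite mulrC ler_pdivrMr ?ltr_wpDr ?sqr_ge0//.
have := sqr_ge0 (x - 2 * a); have := sqr_ge0 (a * (x - a)).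
rewrite !expr2 => h1 h2; nra.
Qed.

Lemma poisson_le (y s : R) : 0 < y -> y <= 1 ->
  poisson y s <= 2 / y * cauchy_weight s.
Proof.
move=> y0 y1; rewrite /poisson /cauchy_weight.
have s0 := sqr_ge0 s.
have h1 : 0 < 1 + s ^+ 2 by rewrite ltr_wpDr.
have h2 : 0 < y ^+ 2 + s ^+ 2 by rewrite ltr_pwDl// exprn_gt0.
rewrite ler_pdivrMr// mulrAC ler_pdivlMr//.
rewrite (_ : 2 / y * _ = 2 * y + 2 / y * s ^+ 2); last first.
  by field; exact: lt0r_neq0.
rewrite mulrDr mulr1 lerD2l ler_wpM2r// ler_pM2l//.
rewrite (le_trans y1)// -[leLHS]invr1 lef_pV2 ?posrE//.
Qed.

Lemma measurable_poisson (y a : R) : 0 < y ->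
  measurable_fun setT (fun x : R => poisson y (x - a)).
Proof.
move=> y0; have := (cmeas_ft (cintg_abel a y0)).1.
rewrite (_ : (fun x => _) = fun x => poisson y (x - a))//.
by apply/funext => x; rewrite ft_abel.
Qed.

Lemma cauchy_weight_sq : sqintg (fun x : R => (cauchy_weight x)%:C).
Proof.
apply: (@sqintg_bd _ _ 1); first exact: cintgR rintg_cauchy_weight.
by move=> x; rewrite cabsR gtr0_norm ?cauchy_weight_gt0// cauchy_weight_le1.
Qed.

Lemma rintg_sqintg_weight f : sqintg f -> rintg (fun x => cabs (f x) * cauchy_weight x).
Proof.
move=> hf; have [_] := sqintg_mul hf cauchy_weight_sq.
by under eq_fun do rewrite cabsM cabsR gtr0_norm ?cauchy_weight_gt0//.
Qed.

Lemma cintg_mul_poisson f (y a : R) : sqintg f -> 0 < y -> y <= 1 ->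
  cintg (fun x => f x * (poisson y (x - a))%:C).
Proof.
move=> hf y0 y1.
apply: cintg_le (rintgZ (2 / y * (2 * (1 + a ^+ 2))) (rintg_sqintg_weight hf)) _.
  by apply: cmeasM; [exact: hf.1|apply: cmeasR; exact: measurable_poisson].
move=> x; rewrite cabsM cabsR ger0_norm ?poisson_ge0// [leRHS]mulrCA ler_wpM2l ?cabs_ge0//.
apply: le_trans (poisson_le _ y0 y1) _.
rewrite -[leRHS]mulrA ler_wpM2l//; first by rewrite divr_ge0// ltW.
exact: peetre.
Qed.

Definition poisson_mass (y c d x : R) : R :=
  2 * atan ((x - c) / y) - 2 * atan ((x - d) / y).

Lemma continuous_poisson (y x : R) : 0 < y ->
  continuous (fun a : R => poisson y (x - a)).
Proof.
move=> y0 a; rewrite /poisson; apply: cvgM; first exact: cvg_cst.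
apply: cvgV; first by rewrite gt_eqF// ltr_pwDl ?sqr_ge0// exprn_gt0.
apply: cvgD; first exact: cvg_cst.
apply: (@continuous_comp _ _ _ (fun a => x - a) (fun s => s ^+ 2)).
  by apply: cvgB; [exact: cvg_cst|exact: cvg_id].
exact: exprn_continuous.
Qed.

Lemma rint_poisson (y c d x : R) : 0 < y -> c <= d ->
  rint (fun a => \1_`[c, d] a * poisson y (x - a)) = poisson_mass y c d x.
Proof.
move=> y0 cd; have yn := lt0r_neq0 y0.
have n1 (s : R) : y ^+ 2 + s ^+ 2 != 0.
  by rewrite gt_eqF// ltr_pwDl ?sqr_ge0// exprn_gt0.
have dF (a : R) : is_derive a 1 (fun a => - (2 * atan ((x - a) / y)))
    (poisson y (x - a)).
  apply: is_derive_eq; rewrite /GRing.scale/= /poisson; field.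
  by rewrite yn n1.
rewrite (rint_FTC cd (@continuous_poisson y x y0) dF).
by rewrite /poisson_mass; ring.
Qed.

Lemma rintg_itv_poisson (y c d x : R) : 0 < y ->
  rintg (fun a => \1_`[c, d] a * poisson y (x - a)).
Proof.
by move=> y0; apply: rintg_itv; exact: continuous_poisson.
Qed.

(** The point is that the constant does not depend on [y]: this is the domination needed as [y]
    tends to 0. *)
Lemma poisson_mass_le (y c d x : R) : 0 < y -> y <= 1 -> c <= d ->
  `|poisson_mass y c d x| <=
  (16 * (d - c) + 2 * pi * (1 + 4 * (1 + `|c| + `|d|) ^+ 2)) * cauchy_weight x.
Proof.
move=> y0 y1 cd; set D := 1 + `|c| + `|d|.
have D1 : 1 <= D by rewrite /D -addrA lerDl addr_ge0.
have cw0 := cauchy_weight_gt0 x.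
have x0 := sqr_ge0 x.
have p0 := pi_gt0 R.
have dc : 0 <= d - c by rewrite subr_ge0.
have D20 : 0 <= 1 + 4 * D ^+ 2 by have := sqr_ge0 D; lra.
rewrite mulrDl -[leLHS]addr0 [leLHS]addrC.
(* Far from [[c, d]] the kernel itself is small: [1 + x^2 <= 2 x^2 <= 8 (x - a)^2], whence the
   constant 16. Near it the total mass [2 pi] suffices, since there [1 <= (1 + 4 D^2)] times the
   weight. *)
have [xD|xD] := leP (2 * D) `|x|.
  rewrite [leRHS]addrC; apply: lerD.
    by rewrite !mulr_ge0// ltW.
  rewrite -rint_poisson//.
  apply: le_trans (rint_abs (rintg_itv_poisson c d x y0)) _.
  have -> : 16 * (d - c) * cauchy_weight x =
      rint (fun a => \1_`[c, d] a * (16 * cauchy_weight x)).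
    have dF (a : R) : is_derive a 1 (fun a => a * (16 * cauchy_weight x))
        (16 * cauchy_weight x).
      by apply: is_derive_eq; rewrite /GRing.scale/=; ring.
    by rewrite (rint_FTC cd (fun a => cvg_cst _) dF); ring.
  apply: rint_le.
  - exact: rintg_abs (rintg_itv_poisson c d x y0).
  - by apply: rintg_itv => a; exact: cvg_cst.
  move=> a; rewrite normrM indicE.
  have [|_] := boolP (a \in _); last by rewrite normr0 !mul0r.
  rewrite inE/= in_itv/= => /andP[ca ad]; rewrite normr1 !mul1r.
  rewrite ger0_norm ?poisson_ge0//.
  have aD : `|a| <= D.
    rewrite ler_norml; apply/andP; split.
      have := ler_norm (- c); rewrite normrN => h.
      by have := normr_ge0 d; rewrite /D; lra.
    by have := ler_norm d; have := normr_ge0 c; rewrite /D; lra.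
  have sx : x ^+ 2 <= 4 * (x - a) ^+ 2.
    have h1 : `|x| / 2 <= `|x - a|.
      have := ler_distD a x 0; rewrite !subr0 => h.
      by lra.
    rewrite -(real_normK (num_real x)) -(real_normK (num_real (x - a))).
    by have := normr_ge0 x; nra.
  have x2 : 1 <= x ^+ 2.
    by rewrite -(real_normK (num_real x)); nra.
  rewrite /poisson /cauchy_weight ler_pdivlMr ?ltr_wpDr//.
  rewrite mulrAC ler_pdivrMr; last by rewrite ltr_pwDl ?sqr_ge0// exprn_gt0.
  have y2 := sqr_ge0 y.
  nra.
apply: lerD; first by rewrite !mulr_ge0// ltW.
apply: (@le_trans _ _ (2 * pi)).
  rewrite /poisson_mass.
  have := atan_gtNpi2 ((x - c) / y); have := atan_ltpi2 ((x - c) / y).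
  have := atan_gtNpi2 ((x - d) / y); have := atan_ltpi2 ((x - d) / y).
  by move=> *; rewrite ler_norml; apply/andP; split; lra.
rewrite -[leLHS]mulr1 -[leRHS]mulrA ler_wpM2l//; first by rewrite mulr_ge0// ltW.
rewrite /cauchy_weight ler_pdivlMr ?ltr_wpDr// mul1r lerD2l.
rewrite -(real_normK (num_real x)).
by have := normr_ge0 x; nra.
Qed.

Lemma cvg_atan_sg (t : R) :
  2 * atan (t / (n.+1%:R)^-1) @[n --> \oo] --> pi * Num.sg t.
Proof.
have key (s : R) : 0 < s -> atan (s / (n.+1%:R)^-1) @[n --> \oo] --> (pi / 2 : R).
  move=> s0; under eq_fun do rewrite invrK.
  have lim : s * n.+1%:R @[n --> \oo] --> +oo%R.
    apply/cvgryPge => A; exists (Num.bound `|A / s|) => // n /= nA.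
    rewrite mulrC -ler_pdivrMr// (le_trans (ler_norm _))//.
    rewrite (le_trans (ltW (archi_boundP (normr_ge0 (A / s)))))//.
    by rewrite ler_nat ltnW// ltnS.
  exact: (@cvg_comp _ _ _ (fun n : nat => s * n.+1%:R) (@atan R) _ _ _ lim (@cvgy_atan R)).
have [t0|t0|<-] := ltgtP 0 t.
- rewrite gtr0_sg// mulr1 (_ : pi = 2 * (pi / 2)); last by field.
  by apply: cvgM; [exact: cvg_cst|exact: key].
- have := key (- t); rewrite oppr_gt0 => /(_ t0) h.
  rewrite ltr0_sg// (_ : pi * -1 = - 2 * (pi / 2)); last by field.
  have e (n : nat) : 2 * atan (t / (n.+1%:R)^-1) = - 2 * atan (- t / (n.+1%:R)^-1).
    by rewrite (mulNr t) atanN; ring.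
  under eq_fun do rewrite e.
  by apply: cvgM; [exact: cvg_cst|exact: h].
- rewrite sgr0 mulr0; under eq_fun do rewrite mul0r atan0 mulr0.
  exact: cvg_cst.
Qed.

Lemma sg_indic (t : R) : Num.sg t = \1_`]0, +oo[ t - \1_`]-oo, 0[ t.
Proof.
rewrite !indicE; have [t0|t0|<-] := ltgtP 0 t.
- rewrite gtr0_sg// mem_set/= ?in_itv/= ?t0// memNset/= ?in_itv/= ?subr0//.
  by apply/negP; rewrite -leNgt ltW.
- rewrite ltr0_sg// memNset/= ?in_itv/=; last by rewrite andbT; apply/negP; rewrite -leNgt ltW.
  by rewrite mem_set/= ?in_itv/= ?sub0r.
- by rewrite sgr0 !memNset/= ?in_itv/= ?ltxx ?subr0.
Qed.

Lemma measurable_sg (a : R) : measurable_fun setT (fun x : R => Num.sg (x - a)).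
Proof.
have ms : measurable_fun setT (fun x : R => x - a).
  by apply: measurable_funB; [exact: measurable_id|exact: measurable_cst].
under eq_fun do rewrite sg_indic.
apply: measurable_funB.
  exact: (measurableT_comp (measurable_indic_itv _) ms).
exact: (measurableT_comp (measurable_indic_itv _) ms).
Qed.

Lemma invn_gt0 (n : nat) : 0 < (n.+1%:R)^-1 :> R.
Proof. by rewrite invr_gt0 ltr0n. Qed.

Lemma invn_le1 (n : nat) : (n.+1%:R)^-1 <= 1 :> R.
Proof. by rewrite invf_le1 ?ltr0n// ler1n. Qed.

(* The Poisson integrals of f, integrated over [c, d], are integrals of f
   against functions which converge to 2 pi times the indicator of [c, d]. *)
Lemma poisson_limit_ae f g (M M' : R) : sqintg f -> cmeasurable g ->
  (forall a, cabs (g a) <= M) ->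
  (forall n a, cabs (cint (fun x => f x * (poisson (n.+1%:R)^-1 (x - a))%:C)) <= M') ->
  (forall a, ccvg (fun n : nat => cint (fun x => f x * (poisson (n.+1%:R)^-1 (x - a))%:C))
     ((2 * pi)%:C * g a)) ->
  {ae mu, forall x, f x = g x}.
Proof.
move=> hf mg gM PM Pg.
set P := fun (n : nat) a => cint (fun x => f x * (poisson (n.+1%:R)^-1 (x - a))%:C) in PM Pg *.
have ig a b : cintg (fun x => (\1_`[a, b] x)%:C * g x).
  have h := cintg_bdM mg gM (cintgR (rintg_indic a b)).
  by move: h; under eq_fun do rewrite mulrC.
have if_ a b : cintg (fun x => (\1_`[a, b] x)%:C * f x) by exact: cintg_window.
suff H c d : c <= d -> cint (fun x => (\1_`[c, d] x)%:C * f x) =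
    cint (fun x => (\1_`[c, d] x)%:C * g x).
  have : {ae mu, forall x, f x - g x = 0}.
    apply: interval_cintegrals_ae0.
    - by apply: cmeasD; [exact: hf.1|exact: cmeasN].
    - by move=> a b; under eq_fun do rewrite mulrBr; exact: cintgB.
    - move=> a b ab; under eq_cint do rewrite mulrBr.
      by rewrite cintB// H// subrr.
  by apply: ae_mono => x /subr0_eq.
move=> cd.
pose W n x : R[i] := f x * (poisson_mass (n.+1%:R)^-1 c d x)%:C.
(* Interchanging the integrals in [a] and [x] replaces the kernel by its integral over [[c, d]],
   known in closed form. *)
have fub n : cintg (fun a => (\1_`[c, d] a)%:C * P n a) /\
    cint (fun a => (\1_`[c, d] a)%:C * P n a) = cint (W n).
  have y0 := invn_gt0 n; have y1 := invn_le1 n; set y := (n.+1%:R)^-1 in y0 y1.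
  pose C0 : R := 2 / y * (2 * (1 + (`|c| + `|d|) ^+ 2)).
  have hm : cmeas2 (fun a x : R => (\1_`[c, d] a)%:C *
      (f x * (poisson y (x - a))%:C)).
    apply: cmeas2M; first exact: cmeas2_fst (cmeas_indic _).
    apply: cmeas2M; first exact: cmeas2_snd hf.1.
    have mp : cmeasurable (fun s : R => (poisson y s)%:C).
      apply: cmeasR; have := measurable_poisson 0 y0.
      by under eq_fun do rewrite subr0.
    apply: (@cmeas2_comp R (fun s => (poisson y s)%:C) (fun p => p.2 - p.1) mp).
    by apply: measurable_funB; [exact: measurable_snd|exact: measurable_fst].
  have [||x|a x|h1 h2 h3] := cfubini_prod (a := fun a => C0 * \1_`[c, d] a)
     (b := fun x => cabs (f x) * cauchy_weight x) hm _ (rintg_sqintg_weight hf).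
  - exact/rintgZ/rintg_indic.
  - by move=> a; rewrite !mulr_ge0 ?addr_ge0 ?sqr_ge0 ?indicE// ltW// invr_gt0.
  - by rewrite mulr_ge0 ?cabs_ge0// ltW// cauchy_weight_gt0.
  - rewrite !cabsM !cabsR (ger0_norm (poisson_ge0 _ y0)) indicE.
    have [|_] := boolP (a \in _); last by rewrite normr0 mulr0 !mul0r.
    rewrite inE/= in_itv/= => /andP[ca ad]; rewrite normr1 mulr1 mul1r.
    rewrite [leRHS]mulrCA ler_wpM2l ?cabs_ge0//.
    apply: le_trans (poisson_le _ y0 y1) _.
    rewrite /C0 -[leRHS]mulrA ler_wpM2l//; first by rewrite divr_ge0// ltW.
    apply: le_trans (peetre _ _) _.
    apply: ler_wpM2r; first exact/ltW/cauchy_weight_gt0.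
    rewrite ler_pM2l// lerD2l.
    rewrite -(real_normK (num_real a)) ler_pXn2r ?nnegrE ?addr_ge0//.
    rewrite ler_norml; apply/andP; split.
      have := ler_norm (- c); rewrite normrN => h.
      by have := normr_ge0 d; lra.
    by have := ler_norm d; have := normr_ge0 c; lra.
  have e1 a : cint (fun x => (\1_`[c, d] a)%:C * (f x * (poisson y (x - a))%:C)) =
      (\1_`[c, d] a)%:C * P n a.
    by rewrite cintZ; [by []|exact: cintg_mul_poisson].
  have e2 x : cint (fun a => (\1_`[c, d] a)%:C * (f x * (poisson y (x - a))%:C)) =
      W n x.
    have -> : W n x =
        f x * cint (fun a => (\1_`[c, d] a * poisson y (x - a))%:C).
      by rewrite cintR (rint_poisson x y0 cd).
    rewrite -cintZ; last exact/cintgR/rintg_itv_poisson.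
    by apply: eq_cint => a; rewrite (realCM (\1_`[c, d] a)) mulrCA.
  rewrite (funext e1) in h1 h3; rewrite (funext e2) in h3.
  by split.
have lhs : ccvg (fun n => cint (W n))
    (cint (fun a => (\1_`[c, d] a)%:C * ((2 * pi)%:C * g a))).
  apply: eq_ccvg (fun n => (fub n).2) _.
  apply: (cint_dct (g := fun a => M' * \1_`[c, d] a) _ _ _ _ _).2.
  - by move=> n; exact: (fub n).1.1.
  - apply: cmeasM; first exact: cmeas_indic.
    by apply: cmeasM => //; exact: cmeas_cst.
  - exact/rintgZ/rintg_indic.
  - move=> n a; rewrite cabsM cabsR ger0_norm ?indicE// mulrC ler_wpM2r//.
    exact: PM.
  - by move=> a; apply: ccvgM; [exact: ccvg_cst|exact: Pg].
(* The pointwise limit of [poisson_mass]. At [c] and [d] it may differ from [2 pi] times the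
   indicator, which is why these two points are discarded below. *)
pose L x : R := pi * Num.sg (x - c) - pi * Num.sg (x - d).
have rhs : ccvg (fun n => cint (W n)) (cint (fun x => f x * (L x)%:C)).
  pose K := 16 * (d - c) + 2 * pi * (1 + 4 * (1 + `|c| + `|d|) ^+ 2).
  apply: (cint_dct (g := fun x => K * (cabs (f x) * cauchy_weight x)) _ _ _ _ _).2.
  - move=> n; apply: cmeasM; first exact: hf.1.
    apply: cmeasR; have mc (e : R) : measurable_fun setT
        (fun x : R => 2 * atan ((x - e) / (n.+1%:R)^-1)).
      apply: measurable_funM; first exact: measurable_cst.
      apply: measurableT_comp.
        by apply: continuous_measurable_fun; exact: continuous_atan.
      apply: measurable_funM; last exact: measurable_cst.
      by apply: measurable_funB; [exact: measurable_id|exact: measurable_cst].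
    by apply: measurable_funB; exact: mc.
  - apply: cmeasM; first exact: hf.1.
    apply: cmeasR; apply: measurable_funB;
      by apply: measurable_funM; [exact: measurable_cst|exact: measurable_sg].
  - exact/rintgZ/rintg_sqintg_weight.
  - move=> n x; rewrite cabsM cabsR mulrCA ler_wpM2l ?cabs_ge0//.
    exact: (poisson_mass_le x (invn_gt0 n) (invn_le1 n) cd).
  - move=> x; apply: ccvgM; first exact: ccvg_cst.
    by apply: ccvgR; apply: cvgB; exact: cvg_atan_sg.
have := ccvg_uniq lhs rhs.
have -> : cint (fun x => f x * (L x)%:C) =
    (2 * pi)%:C * cint (fun x => (\1_`[c, d] x)%:C * f x).
  rewrite -cintZ//; apply: cint_ae.
  - apply: cmeasM; first exact: hf.1.
    apply: cmeasR; apply: measurable_funB;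
      by apply: measurable_funM; [exact: measurable_cst|exact: measurable_sg].
  - by apply: cmeasM; [exact: cmeas_cst|exact: (if_ _ _).1].
  apply: ae_mono2 (ae_neq c) (ae_neq d) => x xc xd.
  suff -> : L x = 2 * pi * \1_`[c, d] x.
    by rewrite (realCM (2 * pi)) mulrCA [f x * _]mulrC.
  rewrite /L indicE; have [xltc|cltx|xec] := ltgtP x c; last by rewrite xec eqxx in xc.
    rewrite !ltr0_sg ?subr_lt0// ?(lt_le_trans xltc)// memNset ?mulr0 ?subrr//=.
    by rewrite in_itv/= leNgt xltc.
  rewrite (@gtr0_sg _ (x - c)) ?subr_gt0//.
  have [xltd|dltx|xed] := ltgtP x d; last by rewrite xed eqxx in xd.
    rewrite ltr0_sg ?subr_lt0// mem_set/= ?in_itv/= ?ltW//.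
    by ring.
  rewrite gtr0_sg ?subr_gt0// memNset ?mulr0 ?subrr//=.
  by rewrite in_itv/= [x <= d]leNgt dltx andbF.
under eq_cint do rewrite mulrCA.
rewrite cintZ// => /mulfI -> //.
by rewrite eq_complex /= negb_and mulf_neq0// gt_eqF// pi_gt0.
Qed.

Definition ift g (x : R) : R[i] := cint (fun xi => g xi * expi (x * xi)).

Lemma cintg_ift g x : cintg g -> cintg (fun xi => g xi * expi (x * xi)).
Proof. by apply: cintg_expi; exact: measurable_mull. Qed.

Lemma ift_ft g x : ift g x = ft g (- x).
Proof. by apply: eq_cint => xi; congr (_ * expi _); ring. Qed.

Lemma ift_le g x : cintg g -> cabs (ift g x) <= rint (fun x => cabs (g x)).
Proof. by move=> hg; rewrite ift_ft; exact: ft_le. Qed.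

Lemma cmeas_ift g : cintg g -> cmeasurable (ift g).
Proof.
move=> /cmeas_ft h; rewrite (_ : ift g = fun x => ft g (- x)).
  by apply: cmeas_comp h _; exact: (@oppr_measurable R setT).
by apply/funext => x; exact: ift_ft.
Qed.

(** The Poisson integral of [f] is the Abel mean of its inversion integral, with no integrability
    asked of either [f] or [fh]. *)
Lemma parseval_abel f fh (y a : R) : is_fourier f fh -> 0 < y -> y <= 1 ->
  cint (fun x => f x * (poisson y (x - a))%:C) = cint (fun xi => fh xi * abel y a xi).
Proof.
move=> hf y0 y1; have [/L2P sf _ _] := hf.
rewrite -(is_fourier_parseval hf (cintg_abel a y0) (sqintg_abel a y0)).
  by apply: eq_cint => x; rewrite ft_abel.
under eq_fun do rewrite ft_abel//.
exact: cintg_mul_poisson.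
Qed.

Lemma abel_cvg (a xi : R) : ccvg (fun n : nat => abel (n.+1%:R)^-1 a xi) (expi (a * xi)).
Proof.
rewrite -[X in ccvg _ X]mul1r; apply: ccvgM; last exact: ccvg_cst.
apply: ccvgR.
have h : - ((n.+1%:R)^-1 * `|xi|) @[n --> \oo] --> (0 : R).
  rewrite -[X in _ --> X]oppr0; apply: cvgN.
  rewrite -[X in _ --> X](mul0r `|xi|); apply: cvgM; last exact: cvg_cst.
  exact: cvg_harmonic.
have : expR (- ((n.+1%:R)^-1 * `|xi|)) @[n --> \oo] --> expR (0 : R).
  exact: (cvg_comp _ _ h (@continuous_expR R 0)).
by rewrite expR0.
Qed.

(** On the frequency side the Abel factor tends to a pure exponential and [|fh|] dominates; on the
    other side [poisson_limit_ae] identifies the limit of the Poisson integrals with [f]. *)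
Lemma fourier_inversion f fh : is_fourier f fh -> cintg fh ->
  {ae mu, forall x, f x = (2 * pi)^-1%:C * ift fh x}.
Proof.
move=> hf ih; have [/L2P sf _ _] := hf.
have p2 : (0 : R) <= (2 * pi)^-1 by rewrite invr_ge0 mulr_ge0// ltW// pi_gt0.
apply: (@poisson_limit_ae _ _ ((2 * pi)^-1 * rint (fun x => cabs (fh x)))
   (rint (fun x => cabs (fh x)))) => //.
- by apply: cmeasM; [exact: cmeas_cst|exact: cmeas_ift].
- by move=> a; rewrite cabsM cabsR ger0_norm// ler_wpM2l//; exact: ift_le.
- move=> n a; have y0 := invn_gt0 n; rewrite (parseval_abel a hf y0 (invn_le1 n)).
  have h : cintg (fun xi => fh xi * abel (n.+1%:R)^-1 a xi).
    under eq_fun do rewrite mulrC.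
    apply: (@cintg_bdM _ _ _ 1) => //; first exact: (cintg_abel a y0).1.
    by move=> xi; exact: cabs_abel_le1.
  apply: le_trans (cint_le h) _; apply: rint_le; [exact: h.2|exact: ih.2|].
  move=> xi; rewrite cabsM ler_piMr ?cabs_ge0//; exact: cabs_abel_le1.
- move=> a; rewrite mulrA -realCM divff ?mul1r; last first.
    by rewrite mulf_neq0// gt_eqF// pi_gt0.
  apply: eq_ccvg (fun n => esym (parseval_abel a hf (invn_gt0 n) (invn_le1 n))) _.
  apply: (cint_dct (g := fun xi => cabs (fh xi)) _ _ _ _ _).2.
  + move=> n; apply: cmeasM; first exact: ih.1.
    exact: (cintg_abel a (invn_gt0 n)).1.
  + exact: (cintg_ift a ih).1.
  + exact: ih.2.
  + move=> n xi; rewrite cabsM ler_piMr ?cabs_ge0//; apply: cabs_abel_le1.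
    exact: invn_gt0.
  + by move=> xi; apply: ccvgM; [exact: ccvg_cst|exact: abel_cvg].
Qed.

(** The transforms agree, so every Poisson integral of [g - f (. - tau)] vanishes and so does their
    limit. This works for square integrable functions, where the inversion integral need not
    converge. *)
Lemma is_fourier_translate f fh g gh (tau : R) : is_fourier f fh ->
  is_fourier g gh ->
  {ae mu, forall xi, gh xi = expi (- (tau * xi)) * fh xi} ->
  {ae mu, forall x, g x = f (x - tau)}.
Proof.
move=> hf hg hgf; have [/L2P sf /L2P sfh _] := hf; have [/L2P sg /L2P sgh _] := hg.
have sft : sqintg (fun x => f (x - tau)) by exact: sqintg_shift.
have d0 n a : cint (fun x => (g x - f (x - tau)) *
    (poisson (n.+1%:R)^-1 (x - a))%:C) = 0.
  have y0 := invn_gt0 n; have y1 := invn_le1 n; set y := (n.+1%:R)^-1 in y0 y1 *.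
  under eq_cint do rewrite mulrBl.
  rewrite cintB; try exact: cintg_mul_poisson.
  rewrite (parseval_abel a hg y0 y1).
  have -> : cint (fun x => f (x - tau) * (poisson y (x - a))%:C) =
      cint (fun x => f x * (poisson y (x - (a - tau)))%:C).
    rewrite -[RHS](cint_shift (- tau)); last exact: cintg_mul_poisson.
    by apply: eq_cint => x; congr (_ * (poisson _ _)%:C); ring.
  rewrite (parseval_abel _ hf y0 y1); apply/eqP; rewrite subr_eq0; apply/eqP.
  apply: cint_ae.
  - by apply: cmeasM; [exact: sgh.1|exact: (cintg_abel _ y0).1].
  - by apply: cmeasM; [exact: sfh.1|exact: (cintg_abel _ y0).1].
  apply: ae_mono hgf => xi ->; rewrite /abel.
  rewrite (_ : (a - tau) * xi = - (tau * xi) + a * xi); last by ring.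
  by rewrite expiD; ring.
have : {ae mu, forall x, g x - f (x - tau) = 0}.
  apply: (@poisson_limit_ae _ (fun=> 0) 0 0).
  - by apply: sqintgD => //; exact: sqintgN.
  - exact: cmeas_cst.
  - by move=> a; rewrite cabs0.
  - by move=> n a; rewrite d0 cabs0.
  - by move=> a; rewrite mulr0; apply: eq_ccvg (ccvg_cst 0) => n; rewrite d0.
by apply: ae_mono => x /subr0_eq.
Qed.

(** Tested by duality against indicators of intervals, both transforms have the same integral over
    every interval. *)
Lemma is_fourier_ft f fh : is_fourier f fh -> cintg f ->
  {ae mu, forall xi, fh xi = ft f xi}.
Proof.
move=> hf intf; have [_ /L2P sfh _] := hf.
have hft a b : cintg (fun x => (\1_`[a, b] x)%:C * ft f x).
  have h := cintg_bdM (cmeas_ft intf) (fun xi => ft_le xi intf) (cintgR (rintg_indic a b)).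
  by move: h; under eq_fun do rewrite mulrC.
have : {ae mu, forall xi, fh xi - ft f xi = 0}.
  apply: interval_cintegrals_ae0.
  - by apply: cmeasD; [exact: sfh.1|exact/cmeasN/cmeas_ft].
  - move=> a b; under eq_fun do rewrite mulrBr.
    by apply: cintgB => //; exact: cintg_window.
  - move=> a b ab; under eq_cint do rewrite mulrBr.
    rewrite cintB//; last exact: cintg_window.
    have ik := cintgR (rintg_indic a b).
    have sk : sqintg (fun x => (\1_`[a, b] x)%:C).
      apply: (@sqintg_bd _ _ 1) => // x; rewrite cabsR indicE.
      by case: (_ \in _); rewrite ?normr1 ?normr0.
    have [h1 _ h2] := ft_fubini intf ik.
    have := is_fourier_parseval hf ik sk h1; rewrite h2 => h3.
    apply/eqP; rewrite subr_eq0; apply/eqP.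
    under eq_cint do rewrite mulrC; rewrite -h3.
    by apply: eq_cint => x; rewrite mulrC.
by apply: ae_mono => x /subr0_eq.
Qed.

End Inversion.

(** * Smooth functions of one variable and a compactly supported bump *)

Section SmoothFunctions.
Context {R : realType}.
Implicit Types (f g a b : R -> R).

Fixpoint nsmooth (n : nat) f : Prop :=
  if n is m.+1 then (forall x, derivable f x 1) /\ nsmooth m (derive1 f)
  else True.

Definition smooth1 f : Prop := forall n, nsmooth n f.

Lemma smooth1_derivable f (x : R) : smooth1 f -> derivable f x 1.
Proof. by move=> /(_ 1%N) [+ _]; apply. Qed.

Lemma smooth1_derive f : smooth1 f -> smooth1 (derive1 f).
Proof. by move=> sf n; have [] := sf n.+1. Qed.

Lemma smooth1_is_derive f (x : R) : smooth1 f -> is_derive x 1 f (derive1 f x).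
Proof.
by move=> sf; rewrite derive1E; exact/derivableP/smooth1_derivable.
Qed.

Lemma smooth1_continuous f : smooth1 f -> continuous f.
Proof.
by move=> sf; apply: is_derive_continuous => x; exact: smooth1_is_derive.
Qed.

Lemma derive1_eq f f' : (forall x : R, is_derive x 1 f (f' x)) -> derive1 f = f'.
Proof. by move=> df; apply/funext => x; rewrite derive1E; exact: derive_val. Qed.

Lemma nsmoothS f f' n : (forall x : R, is_derive x 1 f (f' x)) ->
  nsmooth n f' -> nsmooth n.+1 f.
Proof.
move=> df nf'; split; first by move=> x; have [] := df x.
by rewrite (derive1_eq df).
Qed.

Lemma nsmooth_pred n f : nsmooth n.+1 f -> nsmooth n f.
Proof. by elim: n f => // n IH f [df /IH nf]; split. Qed.

Lemma nsmooth_derive n f (x : R) : nsmooth n.+1 f -> is_derive x 1 f (derive1 f x).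
Proof. by move=> [df _]; rewrite derive1E; exact: derivableP. Qed.

Lemma nsmoothD n f g : nsmooth n f -> nsmooth n g ->
  nsmooth n (fun x => f x + g x).
Proof.
elim: n f g => // n IH f g nf ng.
apply: (@nsmoothS _ (fun x => derive1 f x + derive1 g x)).
  move=> x; have df := nsmooth_derive x nf; have dg := nsmooth_derive x ng.
  exact: is_deriveD.
by apply: IH; [exact: nf.2|exact: ng.2].
Qed.

Lemma nsmoothM n f g : nsmooth n f -> nsmooth n g ->
  nsmooth n (fun x => f x * g x).
Proof.
elim: n f g => // n IH f g nf ng.
apply: (@nsmoothS _ (fun x => derive1 f x * g x + f x * derive1 g x)).
  move=> x; have df := nsmooth_derive x nf; have dg := nsmooth_derive x ng.
  by apply: is_derive_eq; rewrite /GRing.scale/=; ring.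
apply: nsmoothD.
  exact: IH nf.2 (nsmooth_pred ng).
exact: IH (nsmooth_pred nf) ng.2.
Qed.

Lemma nsmooth_cst n (k : R) : nsmooth n (fun=> k).
Proof.
elim: n k => // n IH k; apply: (@nsmoothS _ (fun=> 0)); exact: IH.
Qed.

Lemma nsmooth_affine n f (k c : R) : nsmooth n f ->
  nsmooth n (fun x => f (k * x + c)).
Proof.
elim: n f => // n IH f nf.
apply: (@nsmoothS _ (fun x => k * derive1 f (k * x + c))).
  move=> x; have df := nsmooth_derive (k * x + c) nf.
  have dk : is_derive x 1 (fun x : R => k * x + c) k.
    by apply: is_derive_eq; rewrite /GRing.scale/=; ring.
  by apply: is_derive_eq; rewrite /GRing.scale/=; ring.
by apply: nsmoothM; [exact: nsmooth_cst|apply: IH; exact: nf.2].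
Qed.

Lemma smooth1M f g : smooth1 f -> smooth1 g -> smooth1 (fun x => f x * g x).
Proof. by move=> sf sg n; exact: nsmoothM. Qed.

Lemma smooth1Z (k : R) f : smooth1 f -> smooth1 (fun x => k * f x).
Proof. by move=> sf; apply: smooth1M => // n; exact: nsmooth_cst. Qed.

Lemma smooth1_scale f (k : R) : smooth1 f -> smooth1 (fun x => f (k * x)).
Proof.
move=> sf n; have := nsmooth_affine k 0 (sf n).
by under eq_fun do rewrite addr0.
Qed.

Lemma smooth1_cos_sin : smooth1 (@cos R) /\ smooth1 (@sin R).
Proof.
suff H n : nsmooth n (@cos R) /\ nsmooth n (@sin R).
  by split => n; have [] := H n.
elim: n => // n [IHc IHs]; split; last exact: (@nsmoothS _ cos).
apply: (@nsmoothS _ (fun x => -1 * sin x)).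
  by move=> x; apply: is_derive_eq; rewrite mulN1r.
by apply: nsmoothM => //; exact: nsmooth_cst.
Qed.

(** The derivative of each [flat k] is a combination of two others, so smoothness of [e^(-1/x)]
    follows by an induction that treats all [k] at once. *)
Definition flat (k : nat) (x : R) : R :=
  if 0 < x then x^-1 ^+ k * expR (- x^-1) else 0.

Lemma flat_ge0 k x : 0 <= flat k x.
Proof.
rewrite /flat; case: ifP => // x0.
by rewrite mulr_ge0 ?expR_ge0// exprn_ge0// invr_ge0 ltW.
Qed.

(** From [e^(1/x) >= (1/x)^(k+2) / (k+2)!]. Quadratic vanishing at 0 is exactly what gives
    derivative 0 there. *)
Lemma flat_le k x : flat k x <= (k.+2)`!%:R * x ^+ 2.
Proof.
rewrite /flat; case: ifP => [x0|_]; last by rewrite mulr_ge0 ?sqr_ge0.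
have xi : 0 <= x^-1 by rewrite invr_ge0 ltW.
have := expR_ge1Dxn k.+1 xi; set F := (k.+2)`!%:R => h.
have F0 : 0 < F by rewrite ltr0n fact_gt0.
rewrite expRN ler_pdivrMr ?expR_gt0//.
apply: (@le_trans _ _ (F * x ^+ 2 * (x^-1 ^+ k.+2 / F))).
  rewrite !exprS le_eqVlt; apply/orP; left; apply/eqP; field.
  by rewrite (lt0r_neq0 x0) (lt0r_neq0 F0).
rewrite ler_wpM2l//; first by rewrite mulr_ge0 ?sqr_ge0// ltW.
by apply: le_trans h; rewrite lerDr.
Qed.

Lemma is_derive0_quadratic f (C : R) : f 0 = 0 ->
  (forall x, `|f x| <= C * x ^+ 2) -> is_derive (0 : R) 1 f 0.
Proof.
move=> f0 fC.
have C0 : 0 <= C by have := fC 1; rewrite expr1n mulr1; exact: le_trans.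
have cv : h^-1 *: (f (h *: (1 : R) + 0) - f 0) @[h --> 0^'] --> (0 : R).
  apply: norm_cvg0.
  have lim : C * `|h| @[h --> (0 : R)^'] --> (0 : R).
    have h : C * `|h| @[h --> (0 : R)] --> (0 : R).
      rewrite -[X in _ --> X](mulr0 C) -[X in C * X](@normr0 R R).
      by apply: cvgM; [exact: cvg_cst|apply: cvg_norm; exact: cvg_id].
    by move=> A /h; exact: nbhs_dnbhs.
  apply: (@squeeze_cvgr _ _ _ _ (cst 0) _ _ _ _ _ lim); last exact: cvg_cst.
  near=> h; rewrite normr_ge0/=.
  have h0 : h != 0 by near: h; exact: nbhs_dnbhs_neq.
  rewrite f0 subr0 addr0 /GRing.scale/= mulr1 normrM normfV.
  rewrite mulrC ler_pdivrMr ?normr_gt0//.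
  by rewrite -mulrA -expr2 real_normK ?num_real.
apply: DeriveDef; first by apply/cvg_ex; exists 0.
exact: cvg_lim cv.
Unshelve. all: by end_near. Qed.

Lemma is_derive_flat k (x : R) :
  is_derive x 1 (flat k) (flat k.+2 x - k%:R * flat k.+1 x).
Proof.
have [x0|x0|<-] := ltgtP 0 x.
- have xn : x != 0 by exact: lt0r_neq0.
  apply: (@near_eq_is_derive R R R (fun y : R => y^-1 ^+ k * expR (- y^-1)) (flat k) x 1).
    by near=> y; rewrite /flat ifT//; near: y; exact: lt_nbhsr.
  have dV : is_derive x 1 (fun y : R => y^-1) (- x^-1 ^+ 2).
    apply: is_derive_eq; first exact: (@is_deriveV R (fun y => y) x 1 1 xn).
    by rewrite /GRing.scale/= mulr1 exprVn.
  have dX : is_derive x 1 (fun y : R => y^-1 ^+ k)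
      (k%:R * x^-1 ^+ k.-1 * (- x^-1 ^+ 2)).
    elim: k => [|k IH].
      by rewrite !mul0r; under eq_fun do rewrite expr0; exact: is_derive_cst.
    under eq_fun do rewrite exprS.
    apply: is_derive_eq.
    rewrite /GRing.scale/= -natr1; clear IH.
    by case: k => [|k]; rewrite /= ?exprS ?expr0; ring.
  have dE : is_derive x 1 (fun y : R => expR (- y^-1)) (x^-1 ^+ 2 * expR (- x^-1)).
    by apply: is_derive_eq; rewrite /GRing.scale/=; ring.
  apply: is_derive_eq.
  rewrite /flat x0 /GRing.scale/=.
  by clear dX; case: k => [|k] /=; rewrite !exprS ?expr0; ring.
- apply: (@near_eq_is_derive R R R (fun=> 0) (flat k) x 1).
    near=> y; rewrite /flat ifF//; apply/negbTE; rewrite -leNgt.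
    by apply/ltW; near: y; exact: lt_nbhsl.
  rewrite /flat ltNge (ltW x0)/= mulr0 subr0; exact: is_derive_cst.
- rewrite {2 3}/flat ltxx mulr0 subr0.
  apply: (@is_derive0_quadratic _ (k.+2)`!%:R); first by rewrite /flat ltxx.
  by move=> y; rewrite ger0_norm ?flat_ge0//; exact: flat_le.
Unshelve. all: by end_near. Qed.

Lemma smooth1_flat k : smooth1 (flat k).
Proof.
move=> n; elim: n k => // n IH k.
apply: nsmoothS (is_derive_flat k) _.
have := nsmoothD (IH k.+2) (nsmoothM (nsmooth_cst n (- k%:R)) (IH k.+1)).
by under eq_fun do rewrite mulNr.
Qed.

Definition cutoff (x : R) : R := flat 0 (1 + x) * flat 0 (1 - x).

Lemma smooth1_cutoff : smooth1 cutoff.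
Proof.
move=> n; apply: nsmoothM.
  have := nsmooth_affine 1 1 (@smooth1_flat 0 n).
  by under eq_fun do rewrite mul1r addrC.
have := nsmooth_affine (-1) 1 (@smooth1_flat 0 n).
by under eq_fun do rewrite mulN1r addrC.
Qed.

Lemma cutoff_ge0 x : 0 <= cutoff x.
Proof. by rewrite mulr_ge0 ?flat_ge0. Qed.

Lemma cutoff_out x : 1 <= `|x| -> cutoff x = 0.
Proof.
rewrite /cutoff /flat ler_normr => /orP[x1|x1].
  by rewrite [X in _ * X]ifF ?mulr0//; apply/negbTE; rewrite -leNgt subr_le0.
by rewrite ifF ?mul0r//; apply/negbTE; rewrite -leNgt addrC -lerBrDr sub0r lerNr.
Qed.

Lemma cutoff0_gt0 : 0 < cutoff 0.
Proof.
by rewrite /cutoff /flat addr0 subr0 ltr01 mulr_gt0// mulr_gt0 ?exprn_gt0 ?expR_gt0.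
Qed.

Definition compactly_supported (K : R) f : Prop := forall x, K < `|x| -> f x = 0.

Lemma compactly_supported_derive K f : compactly_supported K f ->
  compactly_supported K (derive1 f).
Proof.
move=> sf x Kx; rewrite derive1E.
suff h : is_derive x 1 f 0 by exact: derive_val.
apply: (@near_eq_is_derive R R R (fun=> 0) f x 1).
near=> y; rewrite sf//; near: y.
have := @norm_continuous R R x.
by move=> /cvgr_gt /(_ _ Kx).
Unshelve. all: by end_near. Qed.

Lemma compactly_supported_bounded K f : compactly_supported K f ->
  continuous f -> exists M : R, 0 <= M /\ forall x, `|f x| <= M.
Proof.
move=> sf cf.
have [K0|K0] := leP K 0.
  exists `|f 0|; split => // x; have [->//|x0] := eqVneq x 0.
  by rewrite sf ?normr0// (le_lt_trans K0)// normr_gt0.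
have K2 : - K <= K by lra.
have cn : {within `[- K, K], continuous (fun x => `|f x|)}.
  by apply: continuous_subspaceT => x; apply: cvg_norm; exact: cf.
have [c _ hc] := EVT_max K2 cn.
exists `|f c|; split => // x; have [xK|Kx] := leP `|x| K.
  by apply: hc; rewrite in_itv/= -ler_norml.
by rewrite sf// normr0.
Qed.

Lemma smooth_bounded K f : smooth1 f -> compactly_supported K f ->
  exists M : R, 0 <= M /\ forall x, `|f x| <= M.
Proof.
by move=> sf cf; apply: compactly_supported_bounded cf _; exact: smooth1_continuous.
Qed.

End SmoothFunctions.


(** * Test functions on the plane that travel with the wave *)

Section TestFunctions.
Context {R : realType}.
Implicit Types (a b : R -> R) (v : R).

(* A class stable under both partial derivatives: its members are smooth. *)
Inductive separated v : (R * R -> R) -> Prop :=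
| separated_prod a b : smooth1 a -> smooth1 b ->
    separated v (fun p => a p.1 * b (p.2 - v * p.1))
| separated_add f g : separated v f -> separated v g ->
    separated v (fun p => f p + g p).

Lemma dir_cvg_t (f : R * R -> R) p :
  (fun h : R => h^-1 *: (f (h *: dir_t R + p) - f p)) =
  (fun h : R => h^-1 *: (f (h *: (1 : R) + p.1, p.2) - f (p.1, p.2))).
Proof.
apply/funext => h; case: p => t x; rewrite /dir_t.
rewrite (_ : h *: _ + _ = (h *: (1 : R) + t, x))//.
by apply: injective_projections; rewrite /= ?scaler0 ?add0r.
Qed.

Lemma dir_cvg_x (f : R * R -> R) p :
  (fun h : R => h^-1 *: (f (h *: dir_x R + p) - f p)) =
  (fun h : R => h^-1 *: (f (p.1, h *: (1 : R) + p.2) - f (p.1, p.2))).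
Proof.
apply/funext => h; case: p => t x; rewrite /dir_x.
rewrite (_ : h *: _ + _ = (t, h *: (1 : R) + x))//.
by apply: injective_projections; rewrite /= ?scaler0 ?add0r.
Qed.

Lemma is_derive_dir_t (f : R * R -> R) (p : R * R) (d : R) :
  is_derive p.1 1 (fun t => f (t, p.2)) d -> is_derive p (dir_t R) f d.
Proof.
move=> [h1 h2]; apply: DeriveDef.
  by rewrite /derivable dir_cvg_t.
by rewrite /derive dir_cvg_t.
Qed.

Lemma is_derive_dir_x (f : R * R -> R) (p : R * R) (d : R) :
  is_derive p.2 1 (fun x => f (p.1, x)) d -> is_derive p (dir_x R) f d.
Proof.
move=> [h1 h2]; apply: DeriveDef.
  by rewrite /derivable dir_cvg_x.
by rewrite /derive dir_cvg_x.
Qed.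

Lemma is_derive_prod_t v a b (p : R * R) : smooth1 a -> smooth1 b ->
  is_derive p (dir_t R) (fun p => a p.1 * b (p.2 - v * p.1))
    (derive1 a p.1 * b (p.2 - v * p.1) +
     a p.1 * (- v * derive1 b (p.2 - v * p.1))).
Proof.
move=> sa sb; apply: is_derive_dir_t => /=.
have da := smooth1_is_derive p.1 sa.
have db := smooth1_is_derive (p.2 - v * p.1) sb.
have dk : is_derive p.1 1 (fun t : R => p.2 - v * t) (- v).
  by apply: is_derive_eq; rewrite /GRing.scale/=; ring.
by apply: is_derive_eq; rewrite /GRing.scale/=; ring.
Qed.

Lemma is_derive_prod_x v a b (p : R * R) : smooth1 a -> smooth1 b ->
  is_derive p (dir_x R) (fun p => a p.1 * b (p.2 - v * p.1))
    (a p.1 * derive1 b (p.2 - v * p.1)).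
Proof.
move=> sa sb; apply: is_derive_dir_x => /=.
have db := smooth1_is_derive (p.2 - v * p.1) sb.
have dk : is_derive p.2 1 (fun x : R => x - v * p.1) 1.
  by apply: is_derive_eq; rewrite /GRing.scale/=; ring.
by apply: is_derive_eq; rewrite /GRing.scale/=; ring.
Qed.

Lemma partial_t_prod v a b : smooth1 a -> smooth1 b ->
  partial_t (fun p => a p.1 * b (p.2 - v * p.1)) =
  (fun p => derive1 a p.1 * b (p.2 - v * p.1) +
     a p.1 * (- v * derive1 b (p.2 - v * p.1))).
Proof.
move=> sa sb; apply/funext => p.
by have [_ h] := is_derive_prod_t v p sa sb.
Qed.

Lemma partial_x_prod v a b : smooth1 a -> smooth1 b ->
  partial_x (fun p => a p.1 * b (p.2 - v * p.1)) =
  (fun p => a p.1 * derive1 b (p.2 - v * p.1)).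
Proof.
move=> sa sb; apply/funext => p.
by have [_ h] := is_derive_prod_x v p sa sb.
Qed.

Lemma separated_derivable v f : separated v f -> forall p : R * R,
  derivable f p (dir_t R) /\ derivable f p (dir_x R).
Proof.
elim=> [a b sa sb p|{}f g _ IHf _ IHg p].
  have [h1 _] := is_derive_prod_t v p sa sb.
  have [h2 _] := is_derive_prod_x v p sa sb.
  by split; [exact: h1|exact: h2].
have [f1 f2] := IHf p; have [g1 g2] := IHg p.
by split; exact: derivableD.
Qed.

Lemma separated_continuous v f : separated v f -> continuous f.
Proof.
elim=> [a b sa sb p|{}f g _ IHf _ IHg p]; last first.
  by apply: cvgD; [exact: IHf|exact: IHg].
apply: cvgM.
  apply: (@continuous_comp _ _ _ (fun p : R * R => p.1) a); first exact: cvg_fst.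
  exact: smooth1_continuous.
apply: (@continuous_comp _ _ _ (fun p : R * R => p.2 - v * p.1) b).
  apply: cvgB; first exact: cvg_snd.
  by apply: cvgM; [exact: cvg_cst|exact: cvg_fst].
exact: smooth1_continuous.
Qed.

Lemma separated_partial_t v f : separated v f -> separated v (partial_t f).
Proof.
elim=> [a b sa sb|{}f g sf IHf sg IHg].
  rewrite partial_t_prod//; apply: separated_add.
    by apply: separated_prod => //; exact: smooth1_derive.
  apply: (separated_prod v sa (b := fun y => - v * derive1 b y)).
  by apply: smooth1Z; exact: smooth1_derive.
rewrite (_ : partial_t _ = fun p => partial_t f p + partial_t g p).
  exact: separated_add.
apply/funext => p; rewrite /partial_t deriveD//.
  by have [] := separated_derivable sf p.
by have [] := separated_derivable sg p.
Qed.

Lemma separated_partial_x v f : separated v f -> separated v (partial_x f).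
Proof.
elim=> [a b sa sb|{}f g sf IHf sg IHg].
  rewrite partial_x_prod//.
  by apply: separated_prod => //; exact: smooth1_derive.
rewrite (_ : partial_x _ = fun p => partial_x f p + partial_x g p).
  exact: separated_add.
apply/funext => p; rewrite /partial_x deriveD//.
  by have [] := separated_derivable sf p.
by have [] := separated_derivable sg p.
Qed.

Lemma separated_smooth v f : separated v f -> smooth f.
Proof.
move=> sf s; suff ss : separated v (iter_partial s f).
  by split; [exact: separated_continuous ss|exact: separated_derivable ss].
elim: s => [|b s IH] //=.
by case: b; [exact: separated_partial_t|exact: separated_partial_x].
Qed.

(** The support lies in the image of a square under the shear [(t, x) -> (t, x + v t)], which is
    compact and hence closed. *)
Lemma test_function_prod v (K : R) a b : smooth1 a -> smooth1 b ->
  compactly_supported K a -> compactly_supported K b ->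
  test_function (fun p : R * R => a p.1 * b (p.2 - v * p.1)).
Proof.
move=> sa sb ca cb; split; first exact: separated_smooth (separated_prod v sa sb).
pose shear (p : R * R) : R * R := (p.1, p.2 + v * p.1).
pose B : set (R * R) := `[- K, K] `*` `[- K, K].
have cB : compact (shear @` B).
  apply: continuous_compact; last first.
    by apply: compact_setX; exact: segment_compact.
  have c2 : continuous (fun p : R * R => p.2 + v * p.1).
    move=> p; apply: cvgD; first exact: cvg_snd.
    by apply: cvgM; [exact: cvg_cst|exact: cvg_fst].
  apply: continuous_subspaceT => p.
  exact: (cvg_pair (@cvg_fst R R (nbhs p.1) (nbhs p.2) _) (c2 p)).
apply: (subclosed_compact _ cB); first exact: closed_closure.
have clB : closed (shear @` B).
  by apply: (@compact_closed (R * R)%type) => //; apply: (@norm_hausdorff R (R * R)%type).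
rewrite [X in _ `<=` X]((closure_id _).1 clB); apply: closure_subset.
move=> [t x] /= nz; exists (t, x - v * t); last by rewrite /shear /= subrK.
move: nz; rewrite mulf_eq0 negb_or => /andP[an bn].
split; rewrite /= in_itv/= -ler_norml leNgt; apply/negP.
  by move=> /ca h; rewrite h eqxx in an.
by move=> /cb h; rewrite h eqxx in bn.
Qed.

End TestFunctions.

(** * From the distributional equation to the profile *)

Section WeakEquation.
Context {R : realType}.
Local Notation mu := (@lebesgue_measure R).
Local Notation cabs := (@Normc.normc R).
Implicit Types (f g k : R -> R[i]).

Lemma ae0_continuous (f : R -> R) : continuous f ->
  {ae mu, forall x, f x = 0} -> forall c, f c = 0.
Proof.
move=> cf [N [mN N0 sN]] c; apply/eqP/negPn/negP => fc.
have n0 : 0 < `|f c| by rewrite normr_gt0.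
have [e /= e0 he] : exists2 e : R, 0 < e & forall x, `|x - c| < e -> f x != 0.
  have := cf c; move=> /cvgrPdist_lt /(_ _ n0) /nbhs_ballP[e /= e0 he].
  exists e => // x xe; apply/negP => /eqP fx.
  have : ball c e x by rewrite /ball /= distrC.
  by move=> /he; rewrite /= fx subr0 ltxx.
pose I := `]c - e, c + e[%classic.
have sub : I `<=` N.
  move=> x; rewrite /I /= in_itv/= => /andP[h1 h2]; apply: sN => /= /eqP.
  apply/negP; apply: he; rewrite ltr_norml; apply/andP; split; lra.
have h : (mu I <= 0)%E.
  have <- : mu N = 0%E := N0.
  by apply: le_measure => //; rewrite inE//; exact: measurable_itv.
move: h; rewrite /I lebesgue_measure_itv/= lte_fin ifT; last by lra.
by rewrite -EFinB lee_fin; lra.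
Qed.

Lemma cintg_compact f (K : R) : ccont f -> (forall x, K < `|x| -> f x = 0) ->
  cintg f.
Proof.
move=> cf f0; have := cintg_itv (- K) K cf.
rewrite (_ : (fun x => _) = f)//; apply/funext => x.
have [xK|Kx] := leP `|x| K; last by rewrite f0 ?mulr0.
by rewrite indicE mem_set ?mul1r//= in_itv/= -ler_norml.
Qed.

Lemma cint_der_compact F f (K : R) : ccont f -> cder F f ->
  (forall x, K < `|x| -> f x = 0) -> (forall x, K < `|x| -> F x = 0) ->
  cint f = 0.
Proof.
move=> cf dF f0 F0; pose L := `|K| + 1.
have KL : K < L by rewrite /L; have := ler_norm K; lra.
have L0 : 0 <= L by rewrite addr_ge0.
have e1 : F L = 0 by rewrite F0// ger0_norm.
have e2 : F (- L) = 0 by rewrite F0// normrN ger0_norm.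
have LL : - L <= L by lra.
have := cint_FTC LL cf dF; rewrite e1 e2 subr0 => <-.
apply: eq_cint => x; have [xL|Lx] := leP `|x| L.
  by rewrite indicE mem_set ?mul1r//= in_itv/= -ler_norml.
by rewrite f0 ?mulr0// (lt_trans KL).
Qed.

Lemma ft_translate f (tau xi : R) : cintg f ->
  ft (fun x => f (x - tau)) xi = expi (- (tau * xi)) * ft f xi.
Proof.
move=> hf; rewrite /ft -cintZ; last exact: cintg_ft.
rewrite -[RHS](cint_shift (- tau)); last exact/cintgZ/cintg_ft.
apply: eq_cint => x; rewrite mulrCA -expiD; congr (_ * expi _); ring.
Qed.

Lemma H1plus_sqintg f : H1plus f -> sqintg f.
Proof. by move=> [fh [[/L2P sf _ _] _ _]]. Qed.

Definition density (Q : R -> R[i]) (x : R) : R[i] := (normsq (Q x))%:C.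

Lemma cintg_density Q : sqintg Q -> cintg (density Q).
Proof. by move=> sQ; exact: cintgR sQ.2. Qed.

Lemma normsq_expi (a : R) (z : R[i]) : normsq (expi a * z) = normsq z.
Proof. by rewrite -!cabs_normsq cabsM cabs_expi mul1r. Qed.

Lemma normsqM (z w : R[i]) : normsq (z * w) = normsq z * normsq w.
Proof. by rewrite -!cabs_normsq cabsM exprMn. Qed.

Section Wave.
Variables (u N : R -> R -> R[i]) (omega v : R) (Q : R -> R[i]).
Hypothesis sQ : sqintg Q.
Hypothesis su : forall t, sqintg (u t).
Hypothesis hN : forall t, is_D_plus_absD (fun x => (normsq (u t x))%:C) (N t).
Hypothesis hu : forall t, {ae mu, forall x,
  u t x = expi (omega * t) * Q (x - v * t)}.

(** The phase of [u t] disappears in its squared modulus, which is thus the density of [Q]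
    translated by [v t]; a translation is a phase on the Fourier side. *)
Lemma wave_N_fourier t : exists Nh, is_fourier (N t) Nh /\
  {ae mu, forall xi, Nh xi =
    (xi + `|xi|)%:C * (expi (- (v * t * xi)) * ft (density Q) xi)}.
Proof.
have [dh [Nh [hd hNh e]]] := hN t; exists Nh; split => //.
have id : cintg (density (u t)) by exact: cintg_density.
have e1 := is_fourier_ft hd id.
have e2 xi : ft (density (u t)) xi = expi (- (v * t * xi)) * ft (density Q) xi.
  rewrite -ft_translate; last exact: cintg_density.
  have iQ : cintg (fun x => density Q (x - v * t)).
    by apply: cintg_shift; exact: cintg_density.
  apply: cint_ae.
  - exact: (cintg_ft xi id).1.
  - exact: (cintg_ft xi iQ).1.
  by apply: ae_mono (hu t) => x ux; rewrite /density ux normsq_expi.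
by apply: ae_mono2 e e1 => xi -> ->; rewrite e2.
Qed.

Lemma wave_N_sqintg t : sqintg (N t).
Proof. by have [Nh [[/L2P sN _ _] _]] := wave_N_fourier t. Qed.

(** Fourier multipliers commute with translations. The choices of [N t] for different [t] are a
    priori unrelated; this links them all to [N 0]. *)
Lemma wave_N_translate t : {ae mu, forall x, N t x = N 0 (x - v * t)}.
Proof.
have [N0h [h0 e0]] := wave_N_fourier 0; have [Nth [ht et]] := wave_N_fourier t.
apply: is_fourier_translate h0 ht _.
apply: ae_mono2 e0 et => xi -> ->.
by rewrite mulr0 mul0r oppr0 expi0 mul1r mulrCA.
Qed.

Hypothesis weak : forall phi : R * R -> R, test_function phi ->
  cintegral setT (fun t => cintegral setT (fun x =>
    - (0 +i* 1) * u t x * (partial_t phi (t, x))%:C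
    + u t x * (partial_x (partial_x phi) (t, x))%:C
    + N t x * u t x * (phi (t, x))%:C)) = 0.

Lemma measurable_smooth (b : R -> R) (c : R) : smooth1 b ->
  measurable_fun setT (fun x : R => b (x - c)).
Proof.
move=> sb; have mb := continuous_measurable_fun (smooth1_continuous sb).
by apply: (measurableT_comp mb);
  apply: measurable_funB; [exact: measurable_id|exact: measurable_cst].
Qed.

Lemma sqintg_smooth_cintg f (b : R -> R) (K : R) : sqintg f -> smooth1 b ->
  compactly_supported K b -> cintg (fun x => f x * (b x)%:C).
Proof.
move=> sf sb cb; apply: sqintg_mul => //.
have cb' : ccont (fun x => (b x)%:C) by apply: ccontR; exact: smooth1_continuous.
have [M [M0 bM]] := smooth_bounded sb cb.
apply: (@sqintg_bd _ _ M); last by move=> x; rewrite cabsR.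
by apply: (cintg_compact (K := K)) => // x /cb ->.
Qed.

Lemma cintg_smooth f (b : R -> R) (K : R) : cintg f -> smooth1 b ->
  compactly_supported K b -> cintg (fun x => f x * (b x)%:C).
Proof.
move=> sf sb cb; have [M [M0 bM]] := smooth_bounded sb cb.
under eq_fun do rewrite mulrC.
apply: (@cintg_bdM _ _ _ M) => // [|x]; last by rewrite cabsR.
by apply: cmeasR; exact: continuous_measurable_fun (smooth1_continuous sb).
Qed.

Lemma cintg_NQ : cintg (fun x => N 0 x * Q x).
Proof. by apply: sqintg_mul => //; exact: wave_N_sqintg. Qed.

(** Testing with [a(t) b(x - v t)] leaves [c1 a' e^(i omega t) + c2 a e^(i omega t)] under the time
    integral. By parts this is [(c2 - i omega c1) J], where [J] is the integral of
    [a e^(i omega t)], and [a] is chosen to make [J] nonzero. *)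
Lemma weak_profile (b : R -> R) (K : R) : smooth1 b -> compactly_supported K b ->
  cint (fun x => Q x * (derive1 (derive1 b) x)%:C
    + (0 +i* v) * (Q x * (derive1 b x)%:C)
    + - omega%:C * (Q x * (b x)%:C) + N 0 x * Q x * (b x)%:C) = 0.
Proof.
move=> sb cb.
have sb1 := smooth1_derive sb; have sb2 := smooth1_derive sb1.
have cb1 := compactly_supported_derive cb; have cb2 := compactly_supported_derive cb1.
(* This keeps [|omega t| < 1 < pi / 2] on the support of [a], so that [cos (omega t)] is positive
   there and [Re J] cannot vanish. *)
pose kap : R := 1 + `|omega|.
have kap1 : 1 <= kap by rewrite lerDl.
pose a (t : R) := cutoff (kap * t).
have sa : smooth1 a by apply: smooth1_scale; exact: smooth1_cutoff.
have ca1 (t : R) : kap^-1 < `|t| -> a t = 0.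
  move=> h; apply: cutoff_out; rewrite normrM gtr0_norm; last by lra.
  by rewrite -ler_pdivrMl ?mulr1; [exact: ltW|lra].
have ki : kap^-1 <= 1 by rewrite invf_le1//; lra.
pose L := `|K| + 1.
have KL : K < L by rewrite /L; have := ler_norm K; lra.
have L1 : 1 <= L by rewrite lerDr.
have ca : compactly_supported L a by move=> t tL; apply: ca1; lra.
have cbL : compactly_supported L b by move=> t tL; apply: cb; lra.
have ca' := compactly_supported_derive ca.
have sa' := smooth1_derive sa.
have i0 := sqintg_smooth_cintg sQ sb cb.
have i1 := sqintg_smooth_cintg sQ sb1 cb1.
have i2 := sqintg_smooth_cintg sQ sb2 cb2.
have i3 := cintg_smooth cintg_NQ sb cb.
pose c1 : R[i] := cint (fun x => - (0 +i* 1) * (Q x * (b x)%:C)).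
pose G2 x : R[i] := Q x * (derive1 (derive1 b) x)%:C
    + (0 +i* v) * (Q x * (derive1 b x)%:C) + N 0 x * Q x * (b x)%:C.
have iG2 : cintg G2 by apply: cintgD => //; apply: cintgD => //; exact: cintgZ.
pose c2 := cint G2.
have := weak (test_function_prod v sa sb ca cbL).
rewrite (partial_t_prod v sa sb) (partial_x_prod v sa sb) (partial_x_prod v sa sb1).
rewrite cintegralT.
(* At fixed [t] substitute [z = x - v t]: the remaining integrals over [z] are the constants [c1]
   and [c2]. The time derivative falling on [b] produces the term in [i v]. *)
have inner t : cintegral setT (fun x =>
    - (0 +i* 1) * u t x * (derive1 a (t, x).1 * b ((t, x).2 - v * (t, x).1) +
       a (t, x).1 * (- v * derive1 b ((t, x).2 - v * (t, x).1)))%:C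
    + u t x * (a (t, x).1 * derive1 (derive1 b) ((t, x).2 - v * (t, x).1))%:C
    + N t x * u t x * (a (t, x).1 * b ((t, x).2 - v * (t, x).1))%:C) =
    c1 * ((derive1 a t)%:C * expi (omega * t)) + c2 * ((a t)%:C * expi (omega * t)).
  rewrite cintegralT /=.
  pose G z : R[i] := (derive1 a t)%:C * expi (omega * t) *
       (- (0 +i* 1) * (Q z * (b z)%:C)) + (a t)%:C * expi (omega * t) * G2 z.
  have iG : cintg G.
    by apply: cintgD; apply: cintgZ => //; exact: cintgZ.
  transitivity (cint (fun x => G (x - v * t))); last first.
    rewrite (cint_shift (- (v * t)) iG) /G cintD; [|by apply: cintgZ; exact: cintgZ|exact: cintgZ].
    rewrite cintZ; last exact: cintgZ.
    by rewrite cintZ// -/c1 -/c2 [c1 * _]mulrC [c2 * _]mulrC.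
  apply: cint_ae.
  - have mu_ := (su t).1; have mN := (wave_N_sqintg t).1.
    have mb := measurable_smooth (v * t) sb.
    have mb1 := measurable_smooth (v * t) sb1.
    have mb2 := measurable_smooth (v * t) sb2.
    have mk (k : R) (h : R -> R) : measurable_fun setT h ->
        measurable_fun setT (fun x => k * h x).
      by move=> mh; apply: measurable_funM => //; exact: measurable_cst.
    apply: cmeasD; first apply: cmeasD.
    + apply: cmeasM; first by apply: cmeasM => //; exact: cmeas_cst.
      apply: cmeasR; apply: measurable_funD; first exact: mk.
      by apply: (mk _ (fun x => _ * _)); exact: mk.
    + by apply: cmeasM => //; apply: cmeasR; exact: mk.
    + by apply: cmeasM; [exact: cmeasM|apply: cmeasR; exact: mk].
  - exact: (cintg_shift _ iG).1.
  apply: ae_mono2 (hu t) (wave_N_translate t) => x -> ->.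
  rewrite /G /G2.
  have re (p q : R) : (p + q)%:C = p%:C + q%:C :> R[i] by exact: rmorphD.
  have ev : 0 +i* v = (0 +i* 1) * v%:C :> R[i].
    by apply: eq_complexP; rewrite /=; ring.
  have en : (- v)%:C = - v%:C :> R[i] by exact: rmorphN.
  rewrite re !realCM en ev; ring.
rewrite (funext inner).
have ai (h : R -> R) : smooth1 h -> compactly_supported L h ->
    cintg (fun t => (h t)%:C * expi (omega * t)).
  move=> sh ch; apply: (cintg_compact (K := L)).
    apply: ccontM; first by apply: ccontR; exact: smooth1_continuous.
    apply: (cder_cont (f := fun x => (0 +i* omega) * expi (omega * x))).
    apply: (cder_expi (h' := fun=> omega)) => x.
    by apply: is_derive_eq; rewrite /GRing.scale/=; ring.
  by move=> x /ch ->; rewrite mul0r.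
have ia := ai _ sa ca; have ia' := ai _ sa' ca'.
rewrite cintD; [|exact: cintgZ|exact: cintgZ].
rewrite cintZ// cintZ//.
set J := cint (fun t => (a t)%:C * expi (omega * t)).
have dE : cder (fun x => expi (omega * x)) (fun x => (0 +i* omega) * expi (omega * x)).
  apply: (cder_expi (h' := fun=> omega)) => x.
  by apply: is_derive_eq; rewrite /GRing.scale/=; ring.
have ibp : cint (fun t => (derive1 a t)%:C * expi (omega * t)) = - (0 +i* omega) * J.
  have dA : cder (fun x => (a x)%:C) (fun x => (derive1 a x)%:C).
    by apply: cder_real => x; exact: smooth1_is_derive.
  have dP := cderM dA dE.
  have : cint (fun x => (derive1 a x)%:C * expi (omega * x) +
      (a x)%:C * ((0 +i* omega) * expi (omega * x))) = 0.
    apply: (cint_der_compact (K := L)) dP _ _.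
    - apply: ccontD; apply: ccontM; try exact: cder_cont dE.
      + by apply: ccontR; exact: smooth1_continuous.
      + by apply: ccontR; exact: smooth1_continuous.
      + by apply: ccontM; [exact: ccont_cst|exact: cder_cont dE].
    - by move=> x xL; rewrite ca// ca'// !mul0r addr0.
    - by move=> x xL; rewrite ca// mul0r.
  under eq_cint do rewrite [_%:C * (_ * _)]mulrCA.
  rewrite cintD//; last exact: cintgZ.
  rewrite (cintZ _ ia) -/J => /eqP; rewrite addr_eq0 => /eqP ->.
  by rewrite mulNr.
have J0 : J != 0.
  apply/eqP => J0.
  have := congr1 (@complex.Re R) J0; rewrite /J cintE /=.
  have ec x : complex.Re ((a x)%:C * expi (omega * x)) = a x * cos (omega * x).
    by rewrite cReM /= mul0r subr0.
  rewrite (funext ec) => h0.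
  have irg : rintg (fun x => a x * cos (omega * x)).
    by have := cintg_Re ia; rewrite (funext ec).
  have pos x : 0 <= a x * cos (omega * x).
    have [xk|kx] := leP `|x| kap^-1; last by rewrite ca1// mul0r.
    rewrite mulr_ge0// ?cutoff_ge0//; apply/ltW/cos_gt0_pihalf.
    have h : `|omega * x| < 1.
      rewrite normrM; apply: (@le_lt_trans _ _ (`|omega| * kap^-1)).
        by rewrite ler_wpM2l.
      have kp : 0 < kap by lra.
      by rewrite ltr_pdivrMr// mul1r /kap ltrDr.
    have p2 := pi_ge2 R.
    by move: h; rewrite ltr_norml => /andP[h1 h2]; apply/andP; split; lra.
  have z := rint_eq0_ae irg pos h0.
  have cc : continuous (fun x => a x * cos (omega * x)).
    move=> x; apply: cvgM; first exact: smooth1_continuous.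
    exact: smooth1_continuous (smooth1_scale omega (@smooth1_cos_sin R).1) x.
  have := ae0_continuous cc z 0; rewrite /a !mulr0 cos0 mulr1.
  by have := @cutoff0_gt0 R; lra.
rewrite ibp => h.
have {}h : (c2 + - (0 +i* omega) * c1) * J = 0 by rewrite -h; ring.
move/eqP: h; rewrite mulf_eq0 (negbTE J0) orbF => /eqP <-.
rewrite /c1 cintZ// mulrA.
have -> : - (0 +i* omega) * - (0 +i* 1) = - omega%:C :> R[i].
  by apply: eq_complexP; rewrite /=; ring.
rewrite -cintZ// /c2 -cintD//; last exact: cintgZ.
by apply: eq_cint => x; rewrite /G2 addrAC.
Qed.

Lemma cutoff_scaled (kap : R) : 0 < kap -> kap <= 1 ->
  smooth1 (fun x : R => cutoff (kap * x)) /\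
  compactly_supported kap^-1 (fun x : R => cutoff (kap * x)).
Proof.
move=> k0 k1; split; first by apply: smooth1_scale; exact: smooth1_cutoff.
move=> x h; apply: cutoff_out; rewrite normrM gtr0_norm//.
by rewrite -ler_pdivrMl ?mulr1//; exact: ltW.
Qed.

(* The weak equation tested against cutoff (kap x) exp (-i x xi). *)
Lemma weak_profile_exp (kap xi : R) : 0 < kap -> kap <= 1 ->
  let b0 x := cutoff (kap * x) in
  (- xi ^+ 2 + v * xi - omega)%:C * ft (fun x => Q x * (b0 x)%:C) xi +
  (0 +i* (v - 2 * xi)) * ft (fun x => Q x * (derive1 b0 x)%:C) xi +
  ft (fun x => Q x * (derive1 (derive1 b0) x)%:C) xi +
  ft (fun x => N 0 x * Q x * (b0 x)%:C) xi = 0.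
Proof.
move=> k0 k1 b0; have [sb cb] := cutoff_scaled k0 k1.
rewrite -/b0 in sb cb.
have sb1 := smooth1_derive sb; have sb2 := smooth1_derive sb1.
have cb1 := compactly_supported_derive cb; have cb2 := compactly_supported_derive cb1.
have [sc ss] : smooth1 (fun x : R => cos (xi * x)) /\ smooth1 (fun x : R => sin (xi * x)).
  by split; apply: smooth1_scale; have [] := @smooth1_cos_sin R.
have dk (x : R) : is_derive x 1 (fun x : R => xi * x) xi.
  by apply: is_derive_eq; rewrite /GRing.scale/=; ring.
have db (x : R) := smooth1_is_derive x sb.
have db1 (x : R) := smooth1_is_derive x sb1.
have e1 : derive1 (fun x => b0 x * cos (xi * x)) =
    (fun x => derive1 b0 x * cos (xi * x) - xi * (b0 x * sin (xi * x))).
  by apply: derive1_eq => x; apply: is_derive_eq; rewrite /GRing.scale/=; ring.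
have e2 : derive1 (fun x => b0 x * sin (xi * x)) =
    (fun x => derive1 b0 x * sin (xi * x) + xi * (b0 x * cos (xi * x))).
  by apply: derive1_eq => x; apply: is_derive_eq; rewrite /GRing.scale/=; ring.
have e3 : derive1 (derive1 (fun x => b0 x * cos (xi * x))) =
    (fun x => derive1 (derive1 b0) x * cos (xi * x)
      - 2 * xi * (derive1 b0 x * sin (xi * x)) - xi ^+ 2 * (b0 x * cos (xi * x))).
  by rewrite e1; apply: derive1_eq => x; apply: is_derive_eq; rewrite /GRing.scale/=; ring.
have e4 : derive1 (derive1 (fun x => b0 x * sin (xi * x))) =
    (fun x => derive1 (derive1 b0) x * sin (xi * x)
      + 2 * xi * (derive1 b0 x * cos (xi * x)) - xi ^+ 2 * (b0 x * sin (xi * x))).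
  by rewrite e2; apply: derive1_eq => x; apply: is_derive_eq; rewrite /GRing.scale/=; ring.
have csup (h : R -> R) : compactly_supported kap^-1 (fun x => b0 x * h x).
  by move=> x hx; rewrite cb// mul0r.
have w1 := weak_profile (smooth1M sb sc) (csup _).
have w2 := weak_profile (smooth1M sb ss) (csup _).
rewrite e3 e1 in w1; rewrite e4 e2 in w2.
have i0 := cintg_ft xi (sqintg_smooth_cintg sQ sb cb).
have i1 := cintg_ft xi (sqintg_smooth_cintg sQ sb1 cb1).
have i2 := cintg_ft xi (sqintg_smooth_cintg sQ sb2 cb2).
have i3 := cintg_ft xi (cintg_smooth cintg_NQ sb cb).
have ig (h : R -> R) : smooth1 h ->
  cintg (fun x => Q x * (derive1 (derive1 (fun x => b0 x * h x)) x)%:C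
    + (0 +i* v) * (Q x * (derive1 (fun x => b0 x * h x) x)%:C)
    + - omega%:C * (Q x * (b0 x * h x)%:C) + N 0 x * Q x * (b0 x * h x)%:C).
  move=> sh; have s0 := smooth1M sb sh; have c0 := csup h.
  have s1 := smooth1_derive s0; have c1 := compactly_supported_derive c0.
  have s2 := smooth1_derive s1; have c2 := compactly_supported_derive c1.
  apply: cintgD; last exact: cintg_smooth cintg_NQ s0 c0.
  apply: cintgD; last by apply: cintgZ; exact: sqintg_smooth_cintg sQ s0 c0.
  apply: cintgD; last by apply: cintgZ; exact: sqintg_smooth_cintg sQ s1 c1.
  exact: sqintg_smooth_cintg sQ s2 c2.
have ig1 := ig _ sc; have ig2 := ig _ ss.
rewrite e3 e1 in ig1; rewrite e4 e2 in ig2.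
rewrite /ft -(cintZ _ i0) -(cintZ _ i1) -cintD; [|exact: cintgZ|exact: cintgZ].
rewrite -cintD; [|by apply: cintgD; exact: cintgZ|exact: i2].
rewrite -cintD; [|by apply: cintgD => //; apply: cintgD; exact: cintgZ|exact: i3].
(* Test functions are real, so the exponential is assembled as the cosine test minus [i] times the
   sine test. *)
have : cint (fun x => Q x * (derive1 (derive1 b0) x * cos (xi * x)
      - 2 * xi * (derive1 b0 x * sin (xi * x)) - xi ^+ 2 * (b0 x * cos (xi * x)))%:C
    + (0 +i* v) * (Q x * (derive1 b0 x * cos (xi * x) - xi * (b0 x * sin (xi * x)))%:C)
    + - omega%:C * (Q x * (b0 x * cos (xi * x))%:C) + N 0 x * Q x * (b0 x * cos (xi * x))%:C)
   - (0 +i* 1) * cint (fun x => Q x * (derive1 (derive1 b0) x * sin (xi * x)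
      + 2 * xi * (derive1 b0 x * cos (xi * x)) - xi ^+ 2 * (b0 x * sin (xi * x)))%:C
    + (0 +i* v) * (Q x * (derive1 b0 x * sin (xi * x) + xi * (b0 x * cos (xi * x)))%:C)
    + - omega%:C * (Q x * (b0 x * sin (xi * x))%:C) + N 0 x * Q x * (b0 x * sin (xi * x))%:C) = 0.
  by rewrite w1 w2 mulr0 subrr.
rewrite -(cintZ _ ig2) -cintB//; last exact: cintgZ.
move=> <-; apply: eq_cint => x; rewrite [x * xi]mulrC /expi cosN sinN.
move: (Q x) (N 0 x) (b0 x) (derive1 b0 x) (derive1 (derive1 b0) x) (cos _) (sin _).
move=> [q1 q2] [n1 n2] B0 B1 B2 c s.
by apply: eq_complexP => /=; ring.
Qed.

(** One integration by parts on [[a, b]] bounds [|x|] times the transform; the jumps at the end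
    points forbid more. The bound is square integrable, so it can be paired with [L^2] functions. *)
Lemma ft_itv_decay (p p' : R -> R[i]) (a b : R) : a <= b -> cder p p' -> ccont p' ->
  exists C : R, 0 <= C /\ forall x,
    cabs (ft (fun xi => (\1_`[a, b] xi)%:C * p xi) x) <= C * (1 + `|x|)^-1.
Proof.
move=> ab dp cp'.
have cp := cder_cont dp.
have i0 := cintg_itv a b cp; have i1 := cintg_itv a b cp'.
pose C1 := rint (fun xi => cabs ((\1_`[a, b] xi)%:C * p xi)).
pose C2 := cabs (p b) + cabs (p a) + rint (fun xi => cabs ((\1_`[a, b] xi)%:C * p' xi)).
have C10 : 0 <= C1 by apply: rint_ge0 => x; exact: cabs_ge0.
have C20 : 0 <= C2.
  rewrite addr_ge0 ?addr_ge0 ?cabs_ge0//.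
  by apply: rint_ge0 => x; exact: cabs_ge0.
exists (C1 + C2); split => [|x]; first exact: addr_ge0.
rewrite ler_pdivlMr ?ltr_wpDr// mulrDr mulr1; apply: lerD; first exact: ft_le.
have dk (xi : R) : is_derive xi 1 (fun xi : R => - (xi * x)) (- x).
  by apply: is_derive_eq; rewrite /GRing.scale/=; ring.
have dE := cder_expi dk.
have dP := cderM dp dE.
have cP : ccont (fun xi => p' xi * expi (- (xi * x)) +
    p xi * ((0 +i* - x) * expi (- (xi * x)))).
  apply: ccontD; apply: ccontM => //; first exact: cder_cont dE.
  by apply: ccontM; [exact: ccont_cst|exact: cder_cont dE].
have := cint_FTC ab cP dP.
have i2 := cintg_ft x i1; have i3 := cintg_ft x i0.
have -> : cint (fun xi => (\1_`[a, b] xi)%:C * (p' xi * expi (- (xi * x)) +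
    p xi * ((0 +i* - x) * expi (- (xi * x))))) =
    cint (fun xi => (\1_`[a, b] xi)%:C * p' xi * expi (- (xi * x))) +
    (0 +i* - x) * ft (fun xi => (\1_`[a, b] xi)%:C * p xi) x.
  rewrite /ft -cintZ// -cintD//; last exact: cintgZ.
  by apply: eq_cint => xi; ring.
move=> h.
have -> : cabs (ft (fun xi => (\1_`[a, b] xi)%:C * p xi) x) * `|x| =
    cabs ((0 +i* - x) * ft (fun xi => (\1_`[a, b] xi)%:C * p xi) x).
  rewrite cabsM mulrC; congr (_ * _).
  by rewrite cabsE /= expr0n add0r sqrrN sqrtr_sqr.
have {}h : (0 +i* - x) * ft (fun xi => (\1_`[a, b] xi)%:C * p xi) x =
  p b * expi (- (b * x)) - p a * expi (- (a * x)) -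
  cint (fun xi => (\1_`[a, b] xi)%:C * p' xi * expi (- (xi * x))).
  by rewrite -h addrC addKr.
rewrite h; apply: le_trans (cabsD _ _) _; rewrite cabsN; apply: lerD.
  by apply: le_trans (cabsD _ _) _; rewrite cabsN !cabs_mul_expi.
exact: (ft_le x i1).
Qed.

End Wave.

End WeakEquation.

(** * The profile equation on the Fourier side *)

Section ProfileEquation.
Context {R : realType}.
Local Notation mu := (@lebesgue_measure R).
Local Notation cabs := (@Normc.normc R).
Implicit Types (f g k : R -> R[i]).

Lemma derive1_scale (b : R -> R) (k : R) : smooth1 b ->
  derive1 (fun x : R => b (k * x)) = (fun x => k * derive1 b (k * x)).
Proof.
move=> sb; apply: derive1_eq => x.
have dk (y : R) : is_derive y 1 (fun y : R => k * y) k.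
  by apply: is_derive_eq; rewrite /GRing.scale/=; ring.
have db := smooth1_is_derive (k * x) sb.
by have := is_derive1_comp db (dk x); rewrite /GRing.scale/= mulrC.
Qed.

(** Dominated convergence, as [b (x / (n + 1))] tends to [b 0] pointwise: dilated cutoffs exhaust
    the line. *)
Lemma cvg_dilation g (b : R -> R) (M : R) : cintg g -> continuous b ->
  (forall x, `|b x| <= M) ->
  ccvg (fun n : nat => cint (fun x => (b ((n.+1%:R)^-1 * x))%:C * g x))
    ((b 0)%:C * cint g).
Proof.
move=> ig cb bM; rewrite -(cintZ _ ig).
have M0 : 0 <= M by apply: le_trans (bM 0).
have mb := continuous_measurable_fun cb.
apply: (cint_dct (g := fun x => M * cabs (g x)) _ _ _ _ _).2.
- move=> n; apply: cmeasM ig.1; apply: cmeasR.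
  by apply: (measurableT_comp mb); exact: measurable_mull.
- by apply: cmeasM ig.1; exact: cmeas_cst.
- exact: rintgZ ig.2.
- by move=> n x; rewrite cabsM cabsR ler_wpM2r ?cabs_ge0.
- move=> x; apply: ccvgM; last exact: ccvg_cst.
  apply: ccvgR.
  have h : ((n.+1%:R)^-1 * x : R) @[n --> \oo] --> (0 : R).
    by rewrite -[X in _ --> X](mul0r x); apply: cvgMl; exact: cvg_harmonic.
  exact: (cvg_comp (fun n : nat => (n.+1%:R)^-1 * x) b h (cb 0)).
Qed.

Lemma sqintg_mul_ft_itv f (p p' : R -> R[i]) (a b : R) : a <= b -> sqintg f ->
  cder p p' -> ccont p' ->
  cintg (fun x => f x * ft (fun xi => (\1_`[a, b] xi)%:C * p xi) x).
Proof.
move=> ab sf dp cp'; have [C [C0 hC]] := ft_itv_decay ab dp cp'.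
have mk : cmeasurable (ft (fun xi => (\1_`[a, b] xi)%:C * p xi)).
  by apply: cmeas_ft; apply: cintg_itv; exact: cder_cont dp.
apply: sqintg_mul => //; split=> //.
apply: (rintg_le (g := fun x => C ^+ 2 * cauchy_weight x)).
- exact: meas_normsq.
- exact: rintgZ rintg_cauchy_weight.
move=> x; rewrite ger0_norm ?normsq_ge0// -cabs_normsq.
apply: (@le_trans _ _ ((C * (1 + `|x|)^-1) ^+ 2)).
  by rewrite lerXn2r ?nnegrE ?cabs_ge0// mulr_ge0// invr_ge0 addr_ge0.
rewrite exprMn ler_wpM2l ?sqr_ge0// exprVn /cauchy_weight.
have x0 := normr_ge0 x.
have h : 0 < 1 + x ^+ 2 by rewrite ltr_pwDl ?sqr_ge0.
have h' : 0 < (1 + `|x|) ^+ 2 by rewrite exprn_gt0// ltr_pwDl.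
rewrite lef_pV2 ?posrE//.
by rewrite -real_normK ?num_real//; nra.
Qed.

Lemma sqintg_itv p (a b : R) : ccont p -> sqintg (fun x => (\1_`[a, b] x)%:C * p x).
Proof.
move=> [cr ci]; split; first exact: (cintg_itv a b (conj cr ci)).1.
have h : continuous (fun x => normsq (p x)).
  move=> x; apply: cvgD.
    by under eq_cvg do rewrite expr2; rewrite expr2; apply: cvgM; exact: cr.
  by under eq_cvg do rewrite expr2; rewrite expr2; apply: cvgM; exact: ci.
have := rintg_itv a b h.
rewrite (_ : (fun x => _) = (fun x => normsq ((\1_`[a, b] x)%:C * p x)))//.
apply/funext => x; rewrite normsqM; congr (_ * _).
by rewrite -cabs_normsq cabsR real_normK ?num_real// indicE; case: (_ \in _); rewrite ?expr1n ?expr0n.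
Qed.

Variables (omega v : R) (Q P : R -> R[i]).
Hypothesis sQ : sqintg Q.
Hypothesis iP : cintg P.
Hypothesis weak : forall kap xi : R, 0 < kap -> kap <= 1 ->
  let b0 x := cutoff (kap * x) in
  (- xi ^+ 2 + v * xi - omega)%:C * ft (fun x => Q x * (b0 x)%:C) xi +
  (0 +i* (v - 2 * xi)) * ft (fun x => Q x * (derive1 b0 x)%:C) xi +
  ft (fun x => Q x * (derive1 (derive1 b0) x)%:C) xi +
  ft (fun x => P x * (b0 x)%:C) xi = 0.

(** The limit [kap -> 0] is not taken at a fixed [xi], since [Q] is only square integrable. The
    equation is first integrated in [xi] over [[a, b]]; duality then moves the transforms onto
    truncated polynomials, whose transforms decay enough for domination. *)
Lemma profile_fourier Qh : is_fourier Q Qh ->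
  {ae mu, forall xi, (- xi ^+ 2 + v * xi - omega)%:C * Qh xi + ft P xi = 0}.
Proof.
move=> hQ; have [_ /L2P sQh _] := hQ.
pose p0 (xi : R) : R[i] := (- xi ^+ 2 + v * xi - omega)%:C.
pose p1 (xi : R) : R[i] := (0 +i* 1) * (v - 2 * xi)%:C.
have dp0 : cder p0 (fun xi => (- (2 * xi) + v)%:C).
  by apply: cder_real => x; apply: is_derive_eq; rewrite /GRing.scale/=; ring.
have dp1 : cder p1 (fun xi => (0 +i* 1) * (- 2)%:C).
  apply: cderZ; apply: cder_real => x.
  by apply: is_derive_eq; rewrite /GRing.scale/=; ring.
have dp2 := @cder_cst R 1.
have cp0' : ccont (fun xi : R => (- (2 * xi) + v)%:C).
  apply: ccontR; apply: (is_derive_continuous (f := fun=> - 2)) => x.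
  by apply: is_derive_eq; rewrite /GRing.scale/=; ring.
have cp1' := @ccont_cst R ((0 +i* 1) * (- 2)%:C).
have cp2' := @ccont_cst R 0.
have cp0 := cder_cont dp0.
have cp1 := cder_cont dp1.
have cp2 := cder_cont dp2.
have mft := cmeas_ft iP.
have ih a b := sqintg_mul sQh (sqintg_itv a b cp0).
have iw a b : cintg (fun xi => ft P xi * ((\1_`[a, b] xi)%:C * 1)).
  by have [] := ft_fubini iP (cintg_itv a b cp2).
have eE a b (xi : R) : (\1_`[a, b] xi)%:C * (p0 xi * Qh xi + ft P xi) =
    Qh xi * ((\1_`[a, b] xi)%:C * p0 xi) + ft P xi * ((\1_`[a, b] xi)%:C * 1).
  by rewrite mulr1 mulrDr mulrCA [_%:C * Qh _]mulrC mulrCA mulrC; ring.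
apply: interval_cintegrals_ae0.
- apply: cmeasD mft; apply: cmeasM sQh.1; exact: ccont_meas.
- by move=> a b; rewrite (funext (eE a b)); exact: cintgD.
move=> a b ab; rewrite (eq_cint (eE a b)) cintD//.
pose K0 := fun xi : R => (\1_`[a, b] xi)%:C * p0 xi.
pose K1 := fun xi : R => (\1_`[a, b] xi)%:C * p1 xi.
pose K2 := fun xi : R => (\1_`[a, b] xi)%:C * (1 : R[i]).
have iK0 : cintg K0 := cintg_itv a b cp0.
have iK1 : cintg K1 := cintg_itv a b cp1.
have iK2 : cintg K2 := cintg_itv a b cp2.
have iQ0 : cintg (fun x => Q x * ft K0 x) := sqintg_mul_ft_itv ab sQ dp0 cp0'.
have iQ1 : cintg (fun x => Q x * ft K1 x) := sqintg_mul_ft_itv ab sQ dp1 cp1'.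
have iQ2 : cintg (fun x => Q x * ft K2 x) := sqintg_mul_ft_itv ab sQ dp2 cp2'.
have [iP2 _ eP2] := ft_fubini iP iK2.
rewrite -(is_fourier_parseval hQ iK0 (sqintg_itv a b cp0) iQ0) -eP2.
pose kap (n : nat) : R := (n.+1%:R)^-1.
have sc := @smooth1_cutoff R.
have sc1 := smooth1_derive sc; have sc2 := smooth1_derive sc1.
have cc : compactly_supported 1 (@cutoff R) by move=> x x1; apply: cutoff_out; exact: ltW.
have cc1 := compactly_supported_derive cc; have cc2 := compactly_supported_derive cc1.
have [M0 [_ bM0]] := smooth_bounded sc cc.
have [M1 [_ bM1]] := smooth_bounded sc1 cc1.
have [M2 [_ bM2]] := smooth_bounded sc2 cc2.
have L0 := cvg_dilation iQ0 (smooth1_continuous sc) bM0.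
have L1 := cvg_dilation iQ1 (smooth1_continuous sc1) bM1.
have L2 := cvg_dilation iQ2 (smooth1_continuous sc2) bM2.
have L3 := cvg_dilation iP2 (smooth1_continuous sc) bM0.
have Lk : ccvg (fun n => (kap n)%:C) (0 : R[i]).
  by apply: (@ccvgR _ _ 0); exact: cvg_harmonic.
(* Each derivative of the cutoff brings a factor [kap n], so the two middle terms tend to 0 and only
   the value [cutoff 0] survives in the others. *)
have L := ccvgD (ccvgD (ccvgD L0 (ccvgM Lk L1)) (ccvgM (ccvgM Lk Lk) L2)) L3.
have c0 : (cutoff 0)%:C != 0 :> R[i].
  by apply/eqP => /(congr1 (@complex.Re R))/= h; have := @cutoff0_gt0 R; rewrite h ltxx.
suff e0 : (cutoff 0)%:C * cint (fun x => Q x * ft K0 x) +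
    0 * ((derive1 cutoff 0)%:C * cint (fun x => Q x * ft K1 x)) +
    0 * 0 * ((derive1 (derive1 cutoff) 0)%:C * cint (fun x => Q x * ft K2 x)) +
    (cutoff 0)%:C * cint (fun x => P x * ft K2 x) = 0.
  apply/eqP; move/eqP: e0; rewrite !mul0r !addr0 -mulrDr mulf_eq0 (negbTE c0)//.
apply: (ccvg_uniq L); apply: eq_ccvg (ccvg_cst 0) => n.
have k0 : 0 < kap n := invn_gt0 n.
have k1 : kap n <= 1 := invn_le1 n.
have [sb cb] := cutoff_scaled k0 k1.
pose b0 (x : R) := cutoff (kap n * x).
rewrite -/b0 in sb cb.
have sb1 := smooth1_derive sb; have sb2 := smooth1_derive sb1.
have cb1 := compactly_supported_derive cb; have cb2 := compactly_supported_derive cb1.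
have eb1 : derive1 b0 = (fun x => kap n * derive1 cutoff (kap n * x)).
  by apply: derive1_scale.
have eb2 : derive1 (derive1 b0) =
    (fun x => kap n * (kap n * derive1 (derive1 cutoff) (kap n * x))).
  rewrite eb1; apply: derive1_eq => x.
  have d := smooth1_is_derive x (smooth1_scale (kap n) sc1).
  rewrite (derive1_scale (kap n) sc1) in d.
  by apply: is_derive_eq; rewrite /GRing.scale/=.
have [f0 g0 h0] := ft_fubini (sqintg_smooth_cintg sQ sb cb) iK0.
have [f1 g1 h1] := ft_fubini (sqintg_smooth_cintg sQ sb1 cb1) iK1.
have [f2 g2 h2] := ft_fubini (sqintg_smooth_cintg sQ sb2 cb2) iK2.
have [f3 g3 h3] := ft_fubini (cintg_smooth iP sb cb) iK2.
have <- : cint (fun x => Q x * (b0 x)%:C * ft K0 x) =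
    cint (fun x => (cutoff ((n.+1%:R)^-1 * x))%:C * (Q x * ft K0 x)).
  by apply: eq_cint => x; rewrite mulrAC mulrC.
have <- : cint (fun x => P x * (b0 x)%:C * ft K2 x) =
    cint (fun x => (cutoff ((n.+1%:R)^-1 * x))%:C * (P x * ft K2 x)).
  by apply: eq_cint => x; rewrite mulrAC mulrC.
have <- : cint (fun x => Q x * (derive1 b0 x)%:C * ft K1 x) =
    (kap n)%:C * cint (fun x => (derive1 cutoff ((n.+1%:R)^-1 * x))%:C * (Q x * ft K1 x)).
  rewrite -cintZ.
    by apply: eq_cint => x; rewrite eb1 (realCM (kap n)) mulrAC mulrC -mulrA.
  apply: (cintg_bdM (M := M1)) => //; last by move=> x; rewrite cabsR.
  by apply: cmeasR; exact: (continuous_measurable_fun (smooth1_continuous (smooth1_scale (kap n) sc1))).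
have <- : cint (fun x => Q x * (derive1 (derive1 b0) x)%:C * ft K2 x) =
    (kap n)%:C * (kap n)%:C * cint (fun x => (derive1 (derive1 cutoff) ((n.+1%:R)^-1 * x))%:C * (Q x * ft K2 x)).
  rewrite -cintZ.
    apply: eq_cint => x; rewrite eb2 (realCM (kap n) (kap n * _)) (realCM (kap n)).
    by rewrite mulrAC mulrC -!mulrA.
  apply: (cintg_bdM (M := M2)) => //; last by move=> x; rewrite cabsR.
  by apply: cmeasR; exact: (continuous_measurable_fun (smooth1_continuous (smooth1_scale (kap n) sc2))).
rewrite h0 h1 h2 h3 -(cintD g0 g1).
rewrite -(cintD (cintgD g0 g1) g2).
rewrite -(cintD (cintgD (cintgD g0 g1) g2) g3) -[LHS](@cint0 R).
apply: eq_cint => xi.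
have w := weak xi k0 k1; rewrite /= -/b0 in w.
have -> : K0 xi = (\1_`[a, b] xi)%:C * p0 xi by [].
have -> : K1 xi = (\1_`[a, b] xi)%:C * (0 +i* (v - 2 * xi)).
  by rewrite /K1 /p1; congr (_ * _); apply: eq_complexP; rewrite /=; ring.
rewrite /K2 -[LHS](mulr0 ((\1_`[a, b] xi)%:C)) -w /p0.
move: (ft (fun x => Q x * (b0 x)%:C) xi) (ft (fun x => Q x * (derive1 b0 x)%:C) xi).
move: (ft (fun x => Q x * (derive1 (derive1 b0) x)%:C) xi) (ft (fun x => P x * (b0 x)%:C) xi).
move: ((\1_`[a, b] xi)%:C) ((- xi ^+ 2 + v * xi - omega)%:C) => e q0.
by move: (0 +i* _) => q1 z1 z2 z3 z4; ring.
Qed.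
End ProfileEquation.

(** * Integrals with a parameter, inverse transforms and convolutions *)

Section ParametricIntegrals.
Context {R : realType}.
Local Notation mu := (@lebesgue_measure R).
Local Notation cabs := (@Normc.normc R).
Implicit Types (f g k : R -> R[i]).

Lemma is_derive_rint (f df : R -> R -> R) (G : R -> R) (a : R) :
  (forall x, rintg (f x)) ->
  (forall x y : R, is_derive x 1 (f^~ y) (df x y)) ->
  rintg G -> (forall x y, `|df x y| <= G y) ->
  is_derive a 1 (fun x => rint (f x)) (rint (df a)).
Proof.
move=> hf dF iG hG.
have aI : `]a - 1, a + 1[%classic a by rewrite /= in_itv/=; apply/andP; split; lra.
have dE x y : partial1of2 f x y = df x y by rewrite partial1of2E; exact: derive_val.
have G0 y : 0 <= G y by apply: le_trans (hG a y).
have h1 (x : R) : `]a - 1, a + 1[%classic x -> mu.-integrable setT (EFin \o f x).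
  by move=> _; exact: hf.
have h2 (x y : R) : `]a - 1, a + 1[%classic x -> setT y -> derivable (f^~ y) x 1.
  by move=> _ _; exact: ex_derive.
have h3 (x y : R) : `]a - 1, a + 1[%classic x -> setT y -> `|partial1of2 f x y| <= G y.
  by move=> _ _; rewrite dE.
have d1 := derivable_under_integral measurableT aI h1 h2 G0 iG h3.
have d2 := differentiation_under_integral measurableT aI h1 h2 G0 iG h3.
apply: DeriveDef; first exact: d1.
rewrite -derive1E d2; congr (rint _); apply/funext => y; exact: dE.
Qed.

Lemma continuous_rint (f : R -> R -> R) (G : R -> R) :
  (forall x, rintg (f x)) -> (forall y, continuous (f^~ y)) -> rintg G ->
  (forall x y, `|f x y| <= G y) -> continuous (fun x => rint (f x)).
Proof.
move=> hf cf iG hG x.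
apply: (@continuity_under_integral _ _ _ mu f setT measurableT (x - 1) (x + 1)).
- by move=> z _; exact: hf.
- by apply: nearW => y _ z _; exact: cf.
- exact: iG.
- by move=> z _; apply: nearW => y _; exact: hG.
- by rewrite inE/= in_itv/=; apply/andP; split; lra.
Qed.

Lemma continuous_cint (f : R -> R -> R[i]) (G : R -> R) :
  (forall x, cintg (f x)) -> (forall y, ccont (f^~ y)) -> rintg G ->
  (forall x y, cabs (f x y) <= G y) -> ccont (fun x => cint (f x)).
Proof.
move=> hf cf iG hG; split.
- apply: (@continuous_rint (fun x y => complex.Re (f x y)) G) => //.
  + by move=> x; exact: cintg_Re.
  + by move=> y; exact: (cf y).1.
  + by move=> x y; apply: le_trans (hG x y); exact: Re_le_cabs.
- apply: (@continuous_rint (fun x y => complex.Im (f x y)) G) => //.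
  + by move=> x; exact: cintg_Im.
  + by move=> y; exact: (cf y).2.
  + by move=> x y; apply: le_trans (hG x y); exact: Im_le_cabs.
Qed.

Lemma cder_cint (f df : R -> R -> R[i]) (G : R -> R) :
  (forall x, cintg (f x)) -> (forall y, cder (f^~ y) (df^~ y)) -> rintg G ->
  (forall x y, cabs (df x y) <= G y) ->
  cder (fun x => cint (f x)) (fun x => cint (df x)).
Proof.
move=> hf dF iG hG; split=> x.
- apply: (@is_derive_rint (fun x y => complex.Re (f x y))
    (fun x y => complex.Re (df x y)) G) => //.
  + by move=> z; exact: cintg_Re.
  + by move=> z y; exact: (dF y).1.
  + by move=> z y; apply: le_trans (hG z y); exact: Re_le_cabs.
- apply: (@is_derive_rint (fun x y => complex.Im (f x y))
    (fun x y => complex.Im (df x y)) G) => //.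
  + by move=> z; exact: cintg_Im.
  + by move=> z y; exact: (dF y).2.
  + by move=> z y; apply: le_trans (hG z y); exact: Im_le_cabs.
Qed.

Lemma cder_expi_linear (s : R) :
  cder (fun x => expi (x * s)) (fun x => (0 +i* s) * expi (x * s)).
Proof.
apply: (cder_expi (h' := fun=> s)) => x.
by apply: is_derive_eq; rewrite /GRing.scale/=; ring.
Qed.

Lemma ccont_ift g : cintg g -> ccont (ift g).
Proof.
move=> ig.
apply: (@continuous_cint (fun x xi => g xi * expi (x * xi)) (fun y => cabs (g y))).
- by move=> x; exact: cintg_ift.
- by move=> y; apply: ccontM; [exact: ccont_cst|exact: cder_cont (cder_expi_linear y)].
- exact: ig.2.
- by move=> x y; rewrite cabs_mul_expi.
Qed.

Definition mulX g (xi : R) : R[i] := xi%:C * g xi.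

Lemma cder_ift g : cintg g -> cintg (mulX g) ->
  cder (ift g) (fun x => (0 +i* 1) * ift (mulX g) x).
Proof.
move=> ig ig1.
apply: (eq_cder (f := fun x => cint (fun xi => g xi * ((0 +i* xi) * expi (x * xi))))).
  move=> x; rewrite /ift -cintZ; last exact: cintg_ift.
  apply: eq_cint => xi; rewrite /mulX !mulrA; congr (_ * _).
  by rewrite mulrC; congr (_ * _); apply: eq_complexP; rewrite /=; ring.
apply: (@cder_cint (fun x xi => g xi * expi (x * xi)) _ (fun y => cabs (mulX g y))).
- by move=> x; exact: cintg_ift.
- by move=> y; apply: cderZ; exact: cder_expi_linear.
- exact: ig1.2.
- move=> x y; rewrite mulrA cabs_mul_expi /mulX cabsM mulrC cabsM ler_wpM2r ?cabs_ge0//.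
  by rewrite cabsR cabsE /= expr0n add0r sqrtr_sqr.
Qed.

Definition convol f g (z : R) : R[i] := cint (fun xi => f xi * g (z - xi)).

Lemma cmeas2_convol f g : cmeasurable f -> cmeasurable g ->
  cmeas2 (fun xi z => f xi * g (z - xi)).
Proof.
move=> mf mg; apply: cmeas2M; first exact: cmeas2_fst.
apply: (cmeas2_comp (h := fun p : R * R => p.2 - p.1)) => //.
by apply: measurable_funB; [exact: measurable_snd|exact: measurable_fst].
Qed.

Lemma cintg_convol f g : cintg f -> cintg g -> cintg (convol f g).
Proof.
move=> hf hg.
have iz xi : cintg (fun z => f xi * g (z - xi)).
  by apply: cintgZ; exact: (cintg_shift (- xi) hg).
have [] // := cfubini_le (h := fun xi => rint (fun y => cabs (g y)) * cabs (f xi))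
  (cmeas2_convol hf.1 hg.1) iz (rintgZ _ hf.2).
move=> xi; under [X in rint X]funext do rewrite cabsM.
rewrite rintZ; last exact: (rintg_shift (- xi) hg.2).
by rewrite (rint_shift (- xi) hg.2) mulrC.
Qed.

Lemma cintg_convol_section f g z : sqintg f -> sqintg g ->
  cintg (fun xi => f xi * g (z - xi)).
Proof.
move=> sf sg; apply: sqintg_mul => //.
have := sqintg_opp (sqintg_shift z sg).
rewrite (_ : (fun x => _) = (fun xi => g (z - xi)))//.
by apply/funext => x; rewrite addrC.
Qed.

(** Leibniz rule on the Fourier side: [z = xi + (z - xi)] under the integral. *)
Lemma mulX_convol f g : sqintg f -> sqintg g -> sqintg (mulX f) -> sqintg (mulX g) ->
  forall z, mulX (convol f g) z = convol (mulX f) g z + convol f (mulX g) z.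
Proof.
move=> sf sg sf1 sg1 z; rewrite /convol -cintD; [|exact: (cintg_convol_section z sf1 sg)|exact: (cintg_convol_section z sf sg1)].
rewrite /mulX -cintZ; last exact: (cintg_convol_section z sf sg).
apply: eq_cint => xi; have -> : (z - xi)%:C = z%:C - xi%:C :> R[i] by exact: rmorphB.
ring.
Qed.

(** By Young the convolution lies in [L^2], as does the weight. The proof gets the product in [L^1]
    directly from [w |f| |g| <= (|f|^2 + w^2) |g| / 2] and Tonelli. It serves the first bootstrap
    step, where [N^] is known only in [L^2]. *)
Lemma cintg_weight_convol f g : sqintg f -> cintg g -> sqintg g ->
  cintg (fun z => ((1 + `|z|)^-1)%:C * convol f g z).
Proof.
move=> sf ig sg.
pose w (z : R) := (1 + `|z|)^-1.
have w0 z : 0 < 1 + `|z| by rewrite ltr_pwDl.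
have mw : measurable_fun setT w.
  apply: continuous_measurable_fun => x; apply: cvgV; first by rewrite gt_eqF.
  by apply: cvgD; [exact: cvg_cst|exact: norm_continuous].
have wle z : `|w z| <= 1.
  by rewrite ger0_norm ?invr_ge0 ?(ltW (w0 z))// invf_le1 ?lerDl.
have ws z : w z ^+ 2 <= cauchy_weight z.
  have h : 0 < 1 + z ^+ 2 by rewrite ltr_pwDl ?sqr_ge0.
  rewrite /w exprVn /cauchy_weight lef_pV2 ?posrE ?exprn_gt0//.
  by have := normr_ge0 z; rewrite -(real_normK (num_real z)); nra.
have izg xi : rintg (fun z => cabs (g (z - xi))) := rintg_shift (- xi) ig.2.
have iz xi : cintg (fun z => (w z)%:C * (f xi * g (z - xi))).
  apply: (cintg_bdM (M := 1)); [exact: cmeasR|by move=> z; rewrite cabsR|].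
  by apply: cintgZ; exact: (cintg_shift (- xi) ig).
have iw xi : rintg (fun z => cauchy_weight z * cabs (g (z - xi))).
  apply: rintg_le (izg xi) _.
    apply: measurable_funM; last exact: rintg_meas.
    exact: rintg_meas rintg_cauchy_weight.
  move=> z; have := cauchy_weight_gt0 z; have := cauchy_weight_le1 z => h1 h2.
  by rewrite normrM (ger0_norm (ltW h2)) (ger0_norm (cabs_ge0 _)) ler_piMl ?cabs_ge0.
pose h xi := 2^-1 * (rint (fun y => cabs (g y)) * normsq (f xi) +
                     rint (fun z => cauchy_weight z * cabs (g (z - xi)))).
have ih : rintg h.
  apply/rintgZ/rintgD; first exact: rintgZ sf.2.
  have igx z : rintg (fun xi => cabs (g (z - xi))).
    have := rintg_opp (rintg_shift z ig.2).
    rewrite (_ : (fun x => _) = (fun xi => cabs (g (z - xi))))//.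
    by apply/funext => x; rewrite addrC.
  have igE z : rint (fun xi => cabs (g (z - xi))) = rint (fun y => cabs (g y)).
    rewrite -(rint_shift z ig.2) -(rint_opp (rintg_shift z ig.2)).
    by congr rint; apply/funext => x; rewrite addrC.
  have mg : cmeasurable (fun s => (cabs (g s))%:C) := cmeasR (rintg_meas ig.2).
  have [|z||z|_ i2 _] := cfubini_le (h := fun z => rint (fun y => cabs (g y)) * cauchy_weight z)
    (f := fun z xi => (cauchy_weight z)%:C * (cabs (g (z - xi)))%:C).
  - apply: cmeas2M.
      by apply: cmeas2_fst; apply: cmeasR; exact: rintg_meas rintg_cauchy_weight.
    apply: (cmeas2_comp (h := fun p : R * R => p.1 - p.2) mg).
    by apply: measurable_funB; [exact: measurable_fst|exact: measurable_snd].
  - by apply: cintgZ; exact: cintgR.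
  - exact: rintgZ rintg_cauchy_weight.
  - have c0 := ltW (cauchy_weight_gt0 z).
    rewrite -(igE z) mulrC -(rintZ _ (igx z)); apply: rint_le.
    + by apply: (cintgZ _ (cintgR (igx z))).2.
    + exact: rintgZ.
    + by move=> x; rewrite cabsM !cabsR ger0_norm// ger0_norm ?cabs_ge0.
  have := cintg_Re i2; rewrite (_ : (fun x => _) =
    (fun xi => rint (fun z => cauchy_weight z * cabs (g (z - xi)))))//.
  apply/funext => xi.
  rewrite -[RHS]/(complex.Re (rint (fun z => cauchy_weight z * cabs (g (z - xi))))%:C).
  by rewrite -cintR; congr complex.Re; apply: eq_cint => z; rewrite (realCM (cauchy_weight z)).
have [|xi|_ i2 _] := cfubini_le (f := fun xi z => (w z)%:C * (f xi * g (z - xi))) (h := h) _ iz ih.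
- apply: cmeas2M; last exact: cmeas2_convol sf.1 ig.1.
  by apply: cmeas2_snd; exact: cmeasR.
- have e1 := rintZ (normsq (f xi)) (izg xi).
  rewrite /h [_ * normsq _]mulrC -(rint_shift (- xi) ig.2) -e1 -(rintD (rintgZ _ (izg xi)) (iw xi)).
  rewrite -(rintZ _ (rintgD (rintgZ _ (izg xi)) (iw xi))).
  apply: rint_le; first exact: (iz xi).2.
    exact: rintgZ (rintgD (rintgZ _ (izg xi)) (iw xi)).
  move=> z; rewrite !cabsM cabsR -cabs_normsq.
  have c0 := cabs_ge0 (g (z - xi)).
  apply: (@le_trans _ _ (2^-1 * (cabs (f xi) ^+ 2 + `|w z| ^+ 2) * cabs (g (z - xi)))).
    by rewrite mulrA ler_wpM2r// mulrC; exact: mul_le_sqr.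
  rewrite -mulrA ler_wpM2l ?invr_ge0// mulrDl lerD2l ler_wpM2r//.
  by rewrite real_normK ?num_real.
- move: i2; rewrite (_ : (fun x => _) = (fun z => (w z)%:C * convol f g z))//.
  apply/funext => z; by rewrite /convol (cintZ _ (cintg_convol_section z sf sg)).
Qed.

Lemma cint_reflect f z : cintg f ->
  cintg (fun x => f (z - x)) /\ cint (fun x => f (z - x)) = cint f.
Proof.
move=> hf; rewrite (_ : (fun x => f (z - x)) = (fun x => f (- x + z))).
  split; first exact: (cintg_opp (cintg_shift z hf)).
  by rewrite (cint_opp (cintg_shift z hf)) cint_shift.
by apply/funext => x; rewrite addrC.
Qed.

Lemma sqintg_reflect f z : sqintg f -> sqintg (fun x => f (z - x)).
Proof.
move=> sf; rewrite (_ : (fun x => f (z - x)) = (fun x => f (- x + z))).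
  exact: (sqintg_opp (sqintg_shift z sf)).
by apply/funext => x; rewrite addrC.
Qed.

Lemma cintg_le_ae f (h : R -> R) : cmeasurable f -> rintg h ->
  {ae mu, forall x, cabs (f x) <= h x} -> cintg f.
Proof.
move=> mf ih fh; split=> //; have mcf := meas_cabs mf.
apply/(rintg_ge0P mcf (fun x => cabs_ge0 _)).
have ih' := rintg_abs ih.
apply: (@le_lt_trans _ _ (\int[mu]_x (`|h x|)%:E)%E); last first.
  by apply/(rintg_ge0P (rintg_meas ih') (fun x => normr_ge0 _)).
apply: ae_ge0_le_integral => //.
- by move=> x _; rewrite lee_fin cabs_ge0.
- exact/measurable_EFinP.
- by apply/measurable_EFinP; exact: rintg_meas.
- by apply: ae_mono fh => x fx _; rewrite lee_fin; apply: le_trans fx (ler_norm _).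
Qed.

Definition invft g (x : R) : R[i] := (2 * pi)^-1%:C * ift g x.

Lemma cmeas_invft g : cintg g -> cmeasurable (invft g).
Proof. by move=> ig; apply: cmeasM (cmeas_ift ig); exact: cmeas_cst. Qed.

(** The kernel [g (z - xi) / (2 pi)] has transform [invft g x e^(-i x z)]; duality with [f] then
    reads as a convolution. Only one of the two factors needs an integrable transform. *)
Lemma ft_mul_invft f fh g z : is_fourier f fh -> cintg g -> sqintg g ->
  cintg (fun x => f x * invft g x) ->
  ft (fun x => f x * invft g x) z = (2 * pi)^-1%:C * convol fh g z.
Proof.
move=> hf ig sg ifg; have [_ /L2P sfh _] := hf.
pose k xi := (2 * pi)^-1%:C * g (z - xi).
have [igz _] := cint_reflect z ig.
have ik : cintg k by exact: cintgZ.
have sk : sqintg k.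
  apply: (sqintg_bdM (f := fun=> (2 * pi)^-1%:C) (M := cabs (2 * pi)^-1%:C)).
  - exact: cmeas_cst.
  - by [].
  - exact: sqintg_reflect.
have ek x : f x * ft k x = f x * invft g x * expi (- (x * z)).
  rewrite -mulrA; congr (_ * _); rewrite /invft /ft /k.
  under eq_cint do rewrite -mulrA.
  rewrite cintZ; last exact: (cintg_ft x igz).
  rewrite -mulrA; congr (_ * _); rewrite /ift.
  rewrite -cintZr; last exact: cintg_ift.
  have iH : cintg (fun xi => g xi * expi (x * xi) * expi (- (x * z))).
    under eq_fun do rewrite mulrC.
    exact: cintgZ (cintg_ift x ig).
  rewrite -(cint_reflect z iH).2; apply: eq_cint => xi.
  by rewrite -mulrA -expiD; congr (_ * expi _); ring.
have := is_fourier_parseval hf ik sk.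
rewrite (funext ek) => /(_ (cintg_ft z ifg)) e; rewrite [LHS]e.
rewrite /convol -cintZ; last exact: (cintg_convol_section z sfh sg).
by apply: eq_cint => xi; rewrite /k mulrCA.
Qed.

End ParametricIntegrals.

(** * Gain of integrability for the transforms *)

Section Bootstrap.
Context {R : realType}.
Local Notation mu := (@lebesgue_measure R).
Local Notation cabs := (@Normc.normc R).
Variables (omega v : R) (Q Qh N Nh : R -> R[i]).
Hypothesis hQ : is_fourier Q Qh.
Hypothesis wQ : rintg (fun xi => (1 + xi ^+ 2) * normsq (Qh xi)).
Hypothesis hN : is_fourier N Nh.
Hypothesis eN : {ae mu, forall xi, Nh xi = (xi + `|xi|)%:C * ft (density Q) xi}.
Hypothesis prof : {ae mu, forall xi,
  (- xi ^+ 2 + v * xi - omega)%:C * Qh xi + ft (fun x => N x * Q x) xi = 0}.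

(** The usual Sobolev argument: [2 |Q^| <= (1 + xi^2)^(-1) + (1 + xi^2) |Q^|^2]. *)
Lemma profile_ft_cintg : cintg Qh.
Proof.
have [_ /L2P sQ _] := hQ.
apply: (cintg_le (h := fun xi => 2^-1 * (cauchy_weight xi + (1 + xi ^+ 2) * normsq (Qh xi)))).
- exact: sQ.1.
- exact: rintgZ (rintgD rintg_cauchy_weight wQ).
move=> xi; rewrite /cauchy_weight -cabs_normsq.
have h : 0 < 1 + xi ^+ 2 by rewrite ltr_pwDl ?sqr_ge0.
set a := 1 + xi ^+ 2 in h *; set c := cabs _.
have -> : a^-1 + a * c ^+ 2 = a^-1 * (1 + (a * c) ^+ 2).
  by rewrite exprMn mulrDr mulr1 expr2; congr (_ + _); field; rewrite gt_eqF.
have {1}-> : c = a^-1 * (1 * (a * c)) by field; rewrite gt_eqF.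
rewrite [leRHS]mulrCA ler_wpM2l ?invr_ge0 ?(ltW h)//.
by have := mul_le_sqr 1 (a * c); rewrite expr1n.
Qed.

Lemma profile_ft_sqintg : sqintg Qh.
Proof. by have [_ /L2P sQ _] := hQ. Qed.

Lemma profile_ft_mulX_sqintg : sqintg (mulX Qh).
Proof.
have sq := profile_ft_sqintg; split.
  by apply: cmeasM sq.1; apply: cmeasR; exact: measurable_id.
apply: rintg_le wQ _.
  by apply: meas_normsq; apply: cmeasM sq.1; apply: cmeasR; exact: measurable_id.
move=> xi; rewrite ger0_norm ?normsq_ge0// /mulX normsqM ler_wpM2r ?normsq_ge0//.
by rewrite /normsq /= expr0n addr0 lerDr.
Qed.

Lemma profile_invft : {ae mu, forall x, Q x = invft Qh x}.
Proof. exact: fourier_inversion hQ profile_ft_cintg. Qed.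

(** The operation on transforms that corresponds to complex conjugation of the function. *)
Definition conj_reflect (g : R -> R[i]) (xi : R) : R[i] := (g (- xi))^*.

Lemma invft_conj_reflect g x : cintg g -> invft (conj_reflect g) x = (invft g x)^*.
Proof.
move=> ig; rewrite /invft rmorphM /= oppr0; congr (_ * _).
rewrite /ift -cintJ; last exact: cintg_ift.
rewrite -[RHS](cint_opp (cintgJ (cintg_ift x ig))).
by apply: eq_cint => xi; rewrite /conj_reflect (rmorphM (@conjc R)) mulrN expiN; congr (_ * _); exact/esym/conjcK.
Qed.

Lemma cintg_conj_reflect g : cintg g -> cintg (conj_reflect g).
Proof. by move=> ig; exact: cintgJ (cintg_opp ig). Qed.

Lemma sqintg_conj_reflect g : sqintg g -> sqintg (conj_reflect g).
Proof. by move=> ig; exact: sqintgJ (sqintg_opp ig). Qed.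

Lemma profile_sqintg : sqintg Q.
Proof. by have [/L2P sQ _ _] := hQ. Qed.

Lemma ft_density z : ft (density Q) z = (2 * pi)^-1%:C * convol Qh (conj_reflect Qh) z.
Proof.
have ig := profile_ft_cintg; have sg := profile_ft_sqintg.
have sQ := profile_sqintg.
have icr := cintg_conj_reflect ig.
have e : {ae mu, forall x, density Q x = Q x * invft (conj_reflect Qh) x}.
  by apply: ae_mono profile_invft => x e; rewrite /density invft_conj_reflect// -e mul_conj.
have mQ : cmeasurable (fun x => Q x * invft (conj_reflect Qh) x).
  by apply: cmeasM sQ.1 _; exact: cmeas_invft.
have iQ := cintg_ae (cintg_density sQ).1 mQ e (cintg_density sQ).
rewrite -(ft_mul_invft z hQ icr (sqintg_conj_reflect sg) iQ).
apply: cint_ae; [exact: (cintg_ft z (cintg_density sQ)).1|exact: (cintg_ft z iQ).1|].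
by apply: ae_mono e => x ->.
Qed.

Lemma ft_NQ z : ft (fun x => N x * Q x) z = (2 * pi)^-1%:C * convol Nh Qh z.
Proof.
have ig := profile_ft_cintg; have sg := profile_ft_sqintg.
have sQ := profile_sqintg.
have [/L2P sN _ _] := hN.
have iNQ := sqintg_mul sN sQ.
have mQ : cmeasurable (fun x => N x * invft Qh x).
  by apply: cmeasM sN.1 _; exact: cmeas_invft.
have e : {ae mu, forall x, N x * Q x = N x * invft Qh x}.
  by apply: ae_mono profile_invft => x ->.
have iQ := cintg_ae iNQ.1 mQ e iNQ.
rewrite -(ft_mul_invft z hN ig sg iQ).
apply: cint_ae; [exact: (cintg_ft z iNQ).1|exact: (cintg_ft z iQ).1|].
by apply: ae_mono e => x ->.
Qed.

(** [xi^2 <= 2 |xi^2 - v xi + omega| + v^2 + 2 |omega|], by completing the square [(xi - v)^2];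
    possible zeros of the symbol are thus harmless. *)
Lemma profile_ft_decay : {ae mu, forall xi,
  xi ^+ 2 * cabs (Qh xi) <=
  2 * cabs (ft (fun x => N x * Q x) xi) + (v ^+ 2 + 2 * `|omega|) * cabs (Qh xi)}.
Proof.
apply: ae_mono prof => xi /eqP; rewrite addr_eq0 => /eqP h.
have := congr1 cabs h; rewrite cabsM cabsN cabsR => <-.
have q0 := cabs_ge0 (Qh xi).
rewrite mulrA -mulrDl ler_wpM2r//.
have h1 : xi ^+ 2 - v * xi + omega <= `|- xi ^+ 2 + v * xi - omega|.
  by rewrite -normrN; apply: le_trans (ler_norm _); rewrite opprD opprK; lra.
have := ler_norm (- omega); rewrite normrN.
have := sqr_ge0 (xi - v); nra.
Qed.

(** At this stage [(N Q)^] is integrable only after division by [1 + |xi|]. The symbol gains two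
    powers of [xi] and the weight spends one, so one power is won. *)
Lemma profile_ft_mulX_cintg : cintg (mulX Qh).
Proof.
have ig := profile_ft_cintg; have sg := profile_ft_sqintg.
have [_ /L2P sNh _] := hN.
have iw := cintgZ (2 * pi)^-1%:C (cintg_weight_convol sNh ig sg).
pose K := v ^+ 2 + 2 * `|omega|.
have K0 : 0 <= K by rewrite addr_ge0 ?sqr_ge0// mulr_ge0.
apply: (cintg_le_ae (h := fun xi => (1 + 2 * K) * cabs (Qh xi) +
   4 * cabs ((2 * pi)^-1%:C * (((1 + `|xi|)^-1)%:C * convol Nh Qh xi)))).
- exact: profile_ft_mulX_sqintg.1.
- by apply: rintgD; [exact: rintgZ ig.2|exact: rintgZ iw.2].
apply: ae_mono profile_ft_decay => xi; rewrite -/K ft_NQ /mulX => h.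
have w0 : 0 < 1 + `|xi| by rewrite ltr_pwDl.
have := cabs_ge0 ((2 * pi)^-1%:C * convol Nh Qh xi).
have -> : cabs ((2 * pi)^-1%:C * (((1 + `|xi|)^-1)%:C * convol Nh Qh xi)) =
    (1 + `|xi|)^-1 * cabs ((2 * pi)^-1%:C * convol Nh Qh xi).
  have w1 : 0 <= (1 + `|xi|)^-1 by rewrite invr_ge0 ltW.
  have -> : (2 * pi)^-1%:C * (((1 + `|xi|)^-1)%:C * convol Nh Qh xi) =
    ((1 + `|xi|)^-1)%:C * ((2 * pi)^-1%:C * convol Nh Qh xi) by exact: mulrCA.
  by rewrite (cabsM (((1 + `|xi|)^-1)%:C)) (cabsR ((1 + `|xi|)^-1)) (ger0_norm w1).
rewrite (cabsM xi%:C) cabsR; move: h; set m := cabs (_ * convol _ _ _); set q := cabs (Qh xi).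
have q0 : 0 <= q := cabs_ge0 _.
have := normr_ge0 xi; rewrite -(real_normK (num_real xi)); set x := `|xi| => x0 h m0.
have -> : (1 + 2 * K) * q + 4 * ((1 + x)^-1 * m) = ((1 + 2 * K) * q * (1 + x) + 4 * m) / (1 + x).
  by field; rewrite gt_eqF.
rewrite ler_pdivlMr//.
have a1 : x ^+ 2 * q <= 2 * m + K * q by [].
have a2 : 0 <= K * q by rewrite mulr_ge0.
have a3 : 0 <= K * q * x by rewrite mulr_ge0.
have a4 : 0 <= q * x by rewrite mulr_ge0.
nra.
Qed.

Lemma mulX_conj_reflect xi : mulX (conj_reflect Qh) xi = - conj_reflect (mulX Qh) xi.
Proof.
rewrite /mulX /conj_reflect; case: (Qh (- xi)) => a b.
by apply: eq_complexP; rewrite /=; ring.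
Qed.

(** The transform of [|Q|^2] is a convolution of [Q^] with its reflected conjugate, so the Leibniz
    rule passes the gained power on to it. *)
Lemma density_ft_cintg : cintg (ft (density Q)) /\ cintg (mulX (ft (density Q))).
Proof.
have ig := profile_ft_cintg; have sg := profile_ft_sqintg.
have ig1 := profile_ft_mulX_cintg; have sg1 := profile_ft_mulX_sqintg.
have e1 : mulX (conj_reflect Qh) = (fun xi => - conj_reflect (mulX Qh) xi).
  by apply/funext => xi; exact: mulX_conj_reflect.
have icr := cintg_conj_reflect ig; have scr := sqintg_conj_reflect sg.
have icr1 : cintg (mulX (conj_reflect Qh)).
  by rewrite e1; apply: cintgN; exact: cintg_conj_reflect.
have scr1 : sqintg (mulX (conj_reflect Qh)).
  by rewrite e1; apply: sqintgN; exact: sqintg_conj_reflect.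
rewrite (funext ft_density); split; first by apply: cintgZ; exact: cintg_convol.
rewrite (_ : mulX _ = fun z => (2 * pi)^-1%:C *
    (convol (mulX Qh) (conj_reflect Qh) z + convol Qh (mulX (conj_reflect Qh)) z)).
  by apply/cintgZ/cintgD; exact: cintg_convol.
by apply/funext => z; rewrite -mulX_convol// /mulX mulrCA.
Qed.

Lemma nonlocal_ft_cintg : cintg Nh.
Proof.
have [_ /L2P sNh _] := hN; have [_ ir1] := density_ft_cintg.
apply: (cintg_le_ae (h := fun xi => 2 * cabs (mulX (ft (density Q)) xi))).
- exact: sNh.1.
- exact: rintgZ ir1.2.
apply: ae_mono eN => xi ->; rewrite /mulX !cabsM !cabsR mulrA ler_wpM2r ?cabs_ge0//.
by apply: le_trans (ler_normD _ _) _; rewrite normr_id; lra.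
Qed.

(** Now that [N^] is integrable, so is [(N Q)^] as a convolution, and the full two powers of the
    symbol are available. *)
Lemma profile_ft_mulXX_cintg : cintg (mulX (mulX Qh)).
Proof.
have ig := profile_ft_cintg.
have im : cintg (ft (fun x => N x * Q x)).
  by rewrite (funext ft_NQ); apply: cintgZ; apply: cintg_convol => //; exact: nonlocal_ft_cintg.
apply: (cintg_le_ae (h := fun xi => 2 * cabs (ft (fun x => N x * Q x) xi) +
   (v ^+ 2 + 2 * `|omega|) * cabs (Qh xi))).
- apply: cmeasM profile_ft_mulX_sqintg.1; apply: cmeasR; exact: measurable_id.
- by apply: rintgD; [exact: rintgZ im.2|exact: rintgZ ig.2].
apply: ae_mono profile_ft_decay => xi.
by rewrite /mulX !cabsM !cabsR mulrA -expr2 real_normK ?num_real.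
Qed.

End Bootstrap.

(** * Products as convolutions; the cubic identity for positive spectra *)

Section ConvolutionInversion.
Context {R : realType}.
Local Notation mu := (@lebesgue_measure R).
Local Notation cabs := (@Normc.normc R).
Implicit Types (f g k : R -> R[i]).

Lemma ift_convol f g x : cintg f -> cintg g -> sqintg f -> sqintg g ->
  ift (convol f g) x = ift f x * ift g x.
Proof.
move=> hf hg sf sg.
have iz xi : cintg (fun z => g (z - xi)) := cintg_shift (- xi) hg.
have iE xi : cintg (fun z => f xi * (g (z - xi) * expi (x * z))).
  by apply: cintgZ; apply: cintg_expi (iz xi); exact: measurable_mull.
have [||_ _ e] := cfubini_le (f := fun xi z => f xi * (g (z - xi) * expi (x * z)))
  (h := fun xi => rint (fun y => cabs (g y)) * cabs (f xi)) _ iE (rintgZ _ hf.2).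
- rewrite (_ : (fun xi z => _) = (fun xi z => f xi * g (z - xi) * expi (x * z))); last first.
    by apply/funext => xi; apply/funext => z; rewrite mulrA.
  apply: cmeas2M; first exact: cmeas2_convol hf.1 hg.1.
  by apply: (cmeas2_snd (f := fun z => expi (x * z))); apply: cmeas_expi; exact: measurable_mull.
- move=> xi; under [X in rint X]funext do rewrite cabsM cabs_mul_expi.
  by rewrite (rintZ _ (iz xi).2) (rint_shift (- xi) hg.2) mulrC.
rewrite {2}/ift -cintZr; last exact: cintg_ift.
transitivity (cint (fun z => cint (fun xi => f xi * (g (z - xi) * expi (x * z))))).
  apply: eq_cint => z; rewrite /convol -cintZr; last exact: (cintg_convol_section z sf sg).
  by apply: eq_cint => xi; rewrite mulrA.
rewrite -e; apply: eq_cint => xi.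
rewrite (cintZ (f xi)); last by apply: cintg_expi (iz xi); exact: measurable_mull.
rewrite -mulrA; congr (_ * _).
have iH := cintgZ (expi (x * xi)) (cintg_ift x hg).
rewrite /ift -(cintZ _ (cintg_ift x hg)) -[RHS](cint_shift (- xi) iH).
by apply: eq_cint => z; rewrite mulrCA -expiD; congr (_ * expi _); ring.
Qed.

Lemma invft_convol f g x : cintg f -> cintg g -> sqintg f -> sqintg g ->
  invft (fun z => (2 * pi)^-1%:C * convol f g z) x = invft f x * invft g x.
Proof.
move=> hf hg sf sg; rewrite /invft; set c := _%:C.
have -> : ift (fun z => c * convol f g z) x = c * (ift f x * ift g x).
  rewrite -(ift_convol x hf hg sf sg) /ift -cintZ; last by apply: cintg_ift; exact: cintg_convol.
  by apply: eq_cint => z; rewrite mulrA.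
by rewrite mulrACA mulrA.
Qed.

Lemma invftD f g x : cintg f -> cintg g ->
  invft (fun z => f z + g z) x = invft f x + invft g x.
Proof.
move=> hf hg; rewrite /invft -mulrDr; congr (_ * _).
rewrite /ift -cintD; [|exact: cintg_ift|exact: cintg_ift].
by apply: eq_cint => z; rewrite mulrDl.
Qed.

Lemma invftZ z f x : cintg f -> invft (fun xi => z * f xi) x = z * invft f x.
Proof.
move=> hf; rewrite /invft mulrCA; congr (_ * _).
rewrite /ift -cintZ; last exact: cintg_ift.
by apply: eq_cint => y; rewrite mulrA.
Qed.

Lemma invft_ae f g x : cintg f -> cintg g -> {ae mu, forall xi, f xi = g xi} ->
  invft f x = invft g x.
Proof.
move=> hf hg e; rewrite /invft; congr (_ * _); apply: cint_ae.
- exact: (cintg_ift x hf).1.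
- exact: (cintg_ift x hg).1.
by apply: ae_mono e => xi ->.
Qed.

Lemma invft_bounded f : cintg f ->
  exists M : R, 0 <= M /\ forall x, cabs (invft f x) <= M.
Proof.
move=> hf; exists (cabs (2 * pi)^-1%:C * rint (fun x => cabs (f x))); split.
  by rewrite mulr_ge0 ?cabs_ge0//; apply: rint_ge0 => x; exact: cabs_ge0.
by move=> x; rewrite /invft cabsM ler_wpM2l ?cabs_ge0//; exact: ift_le.
Qed.

Lemma ccont_invft f : cintg f -> ccont (invft f).
Proof. by move=> hf; apply: ccontM (ccont_ift hf); exact: ccont_cst. Qed.

Lemma cder_invft f : cintg f -> cintg (mulX f) ->
  cder (invft f) (fun x => (0 +i* 1) * invft (mulX f) x).
Proof.
move=> hf hf1; have := cderZ (2 * pi)^-1%:C (cder_ift hf hf1).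
by apply: eq_cder => x; rewrite /invft mulrCA.
Qed.

(** Windowed transforms are integrals, so they agree everywhere once the functions agree almost
    everywhere. This permits replacing [N] and its transform by regular representatives. *)
Lemma is_fourier_ae f g fh gh : is_fourier f fh -> cmeasurable g -> cmeasurable gh ->
  {ae mu, forall x, f x = g x} -> {ae mu, forall x, fh x = gh x} -> is_fourier g gh.
Proof.
move=> [/L2P sf /L2P sfh h] mg mgh e eh.
have sg := sqintg_ae mg e sf.
split; [exact/L2P|exact/L2P/(sqintg_ae mgh eh)|].
apply: cvg_trans h; apply: near_eq_cvg; apply: nearW => n.
have ewin xi : fourier_window f n xi = fourier_window g n xi.
  have i1 := cintg_window (- n%:R) n%:R sf; have i2 := cintg_window (- n%:R) n%:R sg.
  rewrite !fourier_windowE; apply: cint_ae.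
  - exact: (cintg_ft xi i1).1.
  - exact: (cintg_ft xi i2).1.
  by apply: ae_mono e => x ->.
have i1 := cintg_window (- n%:R) n%:R sf.
have mw : cmeasurable (fourier_window f n).
  by rewrite (_ : fourier_window f n = ft (fun x => (\1_`[- n%:R, n%:R] x)%:C * f x)) ?(funext (fourier_windowE f n))//; exact: cmeas_ft.
rewrite /mass; apply: ae_eq_integral => //.
- by apply/measurable_EFinP; exact: (meas_normsq (cmeasD mw (cmeasN sfh.1))).
- rewrite (funext ewin) in mw.
  by apply/measurable_EFinP; exact: (meas_normsq (cmeasD mw (cmeasN mgh))).
by apply: ae_mono eh => xi ehx _; rewrite -ewin ehx.
Qed.

(* Both sides equal [(2 pi)^-2 * 2 Re L], where
   [L = \iint g(s)^* g(t) g(s - t)] and the spectrum of F is positive. *)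
Lemma hardy_cubic (rho : R -> R) g :
  rintg rho -> cintg g -> (forall s : R, s < 0 -> g s = 0) ->
  (exists B : R, forall s, cabs (g s) <= B) ->
  {ae mu, forall s, ft (fun x => (rho x)%:C) (- s) = (g s)^*%C + g (- s)} ->
  2 * rint (fun x => rho x * complex.Re (invft g x * invft g x)) =
  rint (fun x => rho x * normsq (invft g x)).
Proof.
move=> irho ig g0 [B gB] er.
have sg : sqintg g := sqintg_bd ig gB.
have ir : cintg (fun x => (rho x)%:C) := cintgR irho.
have icr := cintg_conj_reflect ig; have scr := sqintg_conj_reflect sg.
pose c : R[i] := (2 * pi)^-1%:C.
(* Duality followed by a reflection; it turns integrals against [rho] into integrals against its
   transform at [- s]. *)
have key k : cintg k ->
   cintg (fun x => (rho x)%:C * invft k x) /\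
   cint (fun x => (rho x)%:C * invft k x) =
   c * cint (fun s => ft (fun x => (rho x)%:C) (- s) * k s).
  move=> ik; have ik' := cintg_opp ik.
  have [h1 h2 h3] := ft_fubini ir ik'.
  have e1 x : (rho x)%:C * invft k x = c * ((rho x)%:C * ft (fun s => k (- s)) x).
    rewrite /invft mulrCA; congr (_ * (_ * _)).
    rewrite /ift /ft -[LHS](cint_opp (cintg_ift x ik)).
    by apply: eq_cint => s; rewrite mulrN mulrC [x * s]mulrC mulrC.
  rewrite (funext e1); split; first exact: cintgZ.
  have e2 : cint (fun s => ft (fun x => (rho x)%:C) s * k (- s)) =
      cint (fun s => ft (fun x => (rho x)%:C) (- s) * k s).
    by rewrite -[LHS](cint_opp h2); apply: eq_cint => s; rewrite opprK.
  by rewrite (cintZ c h1) h3 e2.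
have gg0 (s : R) : s < 0 -> convol g g s = 0.
  move=> s0; rewrite -[RHS]cint0; apply: eq_cint => t.
  have [t0|t0] := ltP t 0; first by rewrite g0 ?mul0r.
  by rewrite (g0 (s - t)) ?mulr0//; lra.
have B0 : 0 <= B by apply: le_trans (gB 0); exact: cabs_ge0.
have ml (h : R * R -> R) : measurable_fun setT h -> cmeas2 (fun x y => g (h (x, y))).
  by move=> mh; exact: (cmeas2_comp (h := h) ig.1 mh).
have m1 := ml (fun p => p.1) (measurable_fst).
have m2 := ml (fun p => p.2) (measurable_snd).
have m12 := ml (fun p => p.1 - p.2) (measurable_funB measurable_fst measurable_snd).
have m21 := ml (fun p => p.2 - p.1) (measurable_funB measurable_snd measurable_fst).
have m3 := ml (fun p => - p.1) (measurable_funN measurable_fst).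
(* Triple products in [s], [t] and [s - t]: two factors are integrable in separate variables and the
   third is bounded by [B]. *)
have fub (f1 f2 f3 : R -> R -> R[i]) (a b : R -> R) : cmeas2 f1 -> cmeas2 f2 -> cmeas2 f3 ->
   rintg a -> rintg b -> (forall s, 0 <= a s) -> (forall s, 0 <= b s) ->
   (forall s t, cabs (f1 s t) <= a s) -> (forall s t, cabs (f2 s t) <= b t) ->
   (forall s t, cabs (f3 s t) <= B) ->
   cint (fun s => cint (fun t => f1 s t * (f2 s t * f3 s t))) =
   cint (fun t => cint (fun s => f1 s t * (f2 s t * f3 s t))).
  move=> n1 n2 n3 ia ib a0 b0 h1 h2 h3.
  have [|_ _ //] := cfubini_prod (a := a) (b := fun t => B * b t)
    (cmeas2M n1 (cmeas2M n2 n3)) ia (rintgZ B ib) a0 (fun t => mulr_ge0 B0 (b0 t)).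
  move=> s t; rewrite !cabsM; apply: ler_pM; rewrite ?mulr_ge0 ?cabs_ge0 ?h1//.
  by rewrite mulrC; apply: ler_pM; rewrite ?cabs_ge0.
pose a s := cabs (g s).
have a0 s : 0 <= a s := cabs_ge0 _.
have aN0 s : 0 <= a (- s) := cabs_ge0 _.
have ia : rintg a := ig.2.
have iaN : rintg (fun s => a (- s)) := rintg_opp ig.2.
pose L := cint (fun s => (g s)^* * convol g g s).
have LE : L = cint (fun s => cint (fun t => (g s)^* * (g t * g (s - t)))).
  by apply: eq_cint => s; rewrite -cintZ//; exact: (cintg_convol_section s sg sg).
have FL : L = cint (fun t => cint (fun s => (g s)^* * (g t * g (s - t)))).
  rewrite LE; apply: (fub (fun s _ => (g s)^*) (fun _ t => g t) (fun s t => g (s - t))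
    _ _ (cmeas2J m1) m2 m12 ia ia a0 a0) => s t //.
  by rewrite cabsJ.
have A1 : cint (fun s => (g s)^* * convol g (conj_reflect g) s) = L^*.
  transitivity (cint (fun s => cint (fun t => g t * ((g s)^* * (g (t - s))^*)))).
    apply: eq_cint => s; rewrite -cintZ; last exact: (cintg_convol_section s sg scr).
    by apply: eq_cint => t; rewrite /conj_reflect opprB mulrCA.
  rewrite -(fub (fun s _ => g s) (fun _ t => (g t)^*) (fun s t => (g (s - t))^*)
    _ _ m1 (cmeas2J m2) (cmeas2J m12) ia ia a0 a0) => [|//|s t|s t].
  - rewrite LE -cintJ; last first.
      have [|h _ _] := cfubini_prod (f := fun s t => (g s)^* * (g t * g (s - t)))
        (a := a) (b := fun t => B * a t)
        (cmeas2M (cmeas2J m1) (cmeas2M m2 m12)) ia (rintgZ B ia) a0 (fun t => mulr_ge0 B0 (a0 t)).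
        move=> s t; by rewrite !cabsM cabsJ ler_wpM2l ?cabs_ge0// [leLHS]mulrC ler_wpM2r ?cabs_ge0.
      exact: h.
    apply: eq_cint => s; rewrite -cintJ; last first.
      by apply: cintgZ; exact: (cintg_convol_section s sg sg).
    by apply: eq_cint => t; rewrite !(rmorphM (@conjc R)); congr (_ * _); exact/esym/conjcK.
  - by rewrite cabsJ.
  - by rewrite cabsJ; exact: gB.
(* Exchange the integrals and substitute [s -> t - s]: the integrand becomes that of [L]. *)
have A2 : cint (fun s => g (- s) * convol g (conj_reflect g) s) = L.
  transitivity (cint (fun s => cint (fun t => g (- s) * (g t * (g (t - s))^*)))).
    apply: eq_cint => s; rewrite -cintZ; last exact: (cintg_convol_section s sg scr).
    by apply: eq_cint => t; rewrite /conj_reflect opprB.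
  rewrite (fub (fun s _ => g (- s)) (fun _ t => g t) (fun s t => (g (t - s))^*)
    _ _ m3 m2 (cmeas2J m21) iaN ia aN0 a0) => [|//|//|s t].
  - rewrite FL; apply: eq_cint => t.
    have iH : cintg (fun s => (g s)^* * (g t * g (s - t))).
      under eq_fun do rewrite mulrCA.
      apply/cintgZ/sqintg_mul; first exact: sqintgJ.
      exact: sqintg_shift.
    rewrite -[RHS](cint_reflect t iH).2; apply: eq_cint => s.
    have -> : t - s - t = - s by ring.
    by rewrite [RHS]mulrC mulrA; congr (_ * _); rewrite mulrC.
  - by rewrite cabsJ; exact: gB.
have icc := cintgZ c (cintg_convol ig ig).
have icr' := cintgZ c (cintg_convol ig icr).
have [k1 E1] := key _ icc; have [k2 E2] := key _ icr'.
have Q1 x : invft g x * invft g x = invft (fun z => c * convol g g z) x.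
  by rewrite (invft_convol x ig ig sg sg).
have Q2 x : (normsq (invft g x))%:C = invft (fun z => c * convol g (conj_reflect g) z) x.
  by rewrite (invft_convol x ig icr sg scr) (invft_conj_reflect x ig) mul_conj.
have mr : cmeasurable (fun s => ft (fun x => (rho x)%:C) (- s)).
  apply: cmeas_comp (cmeas_ft ir) _.
  by apply: measurable_funN; exact: measurable_id.
have mcg : cmeasurable (fun s => (g s)^*) := cmeasJ ig.1.
have mgN : cmeasurable (fun s => g (- s)) := (cintg_opp ig).1.
have bdr h (M : R) : cmeasurable h -> (forall x, cabs (h x) <= M) ->
    forall h', cintg h' -> cintg (fun s => h s * h' s).
  by move=> mh hM h' ih'; exact: cintg_bdM hM ih'.
have j1 : cintg (fun s => (g s)^* * convol g g s).
  have jB s : cabs (g s)^* <= B by rewrite cabsJ; exact: gB.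
  exact: (bdr _ B mcg jB _ (cintg_convol ig ig)).
have j2 : cintg (fun s => (g s)^* * convol g (conj_reflect g) s).
  have jB s : cabs (g s)^* <= B by rewrite cabsJ; exact: gB.
  exact: (bdr _ B mcg jB _ (cintg_convol ig icr)).
have j3 : cintg (fun s => g (- s) * convol g (conj_reflect g) s).
  exact: (bdr _ B mgN (fun s => gB (- s)) _ (cintg_convol ig icr)).
(* As [g] convolved with itself lives on [s >= 0], where [g (- s)] vanishes except at 0, only the
   conjugate half of the transform of [rho] contributes. *)
have E1' : cint (fun x => (rho x)%:C * (invft g x * invft g x)) = c * (c * L).
  rewrite (eq_cint (fun x => congr1 (fun z => (rho x)%:C * z) (Q1 x))) E1.
  rewrite /L -(cintZ c j1); congr (c * _); apply: cint_ae.
  - by apply: cmeasM mr icc.1.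
  - by apply: cmeasM (cmeas_cst c) j1.1.
  apply: ae_mono2 er (ae_neq 0) => s -> sn; have [s0|s0] := ltP s 0.
    by rewrite (gg0 s s0) !mulr0.
  have e : g (- s) = 0 by apply: g0; rewrite oppr_lt0 lt_neqAle eq_sym sn.
  by rewrite e addr0; exact: mulrCA.
(* Here both halves contribute, giving [L] and its conjugate; this is the source of the factor 2. *)
have E2' : cint (fun x => (rho x * normsq (invft g x))%:C) = c * (c * (L^*%C + L)).
  rewrite (eq_cint (fun x => realCM (rho x) _)).
  rewrite (eq_cint (fun x => congr1 (fun z => (rho x)%:C * z) (Q2 x))) E2.
  have -> : L^*%C + L = cint (fun s => (g s)^*%C * convol g (conj_reflect g) s +
      g (- s) * convol g (conj_reflect g) s) by rewrite (cintD j2 j3) A1 A2.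
  rewrite -(cintZ c (cintgD j2 j3)); congr (c * _); apply: cint_ae.
  - by apply: cmeasM mr icr'.1.
  - by apply: cmeasM (cmeas_cst c) (cintgD j2 j3).1.
  by apply: ae_mono er => s ->; rewrite mulrCA mulrDl.
have eR (p : R) (z : R[i]) : complex.Re (p%:C * z) = p * complex.Re z.
  by case: z => z1 z2; rewrite /= mul0r subr0.
have h1 : rint (fun x => rho x * complex.Re (invft g x * invft g x)) =
    complex.Re (c * (c * L)).
  rewrite -E1' cintE; congr (rint _); apply/funext => x; exact/esym/eR.
have h2 : rint (fun x => rho x * normsq (invft g x)) = complex.Re (c * (c * (L^*%C + L))).
  by rewrite -E2' cintR.
by rewrite h1 h2 !(eR (2 * pi)^-1) cReD cReJ; ring.
Qed.
End ConvolutionInversion.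

(** * The regular representative of the wave *)

Section Regularity.
Context {R : realType}.
Local Notation mu := (@lebesgue_measure R).
Local Notation cabs := (@Normc.normc R).

(* [F] is the projection of [|Q0|^2] onto the nonnegative frequencies; as [N0]
   is twice [D F], it has [F' = i N0 / 2].  The last field expresses that
   [N0 ^ 2] has positive spectrum, of size [O (h ^ 3)] at frequency [h]. *)
Record regular_wave (omega v : R) (Q0 Q1 N0 F : R -> R[i]) : Prop := RegularWave {
  wave_der : cder Q0 Q1;
  wave_ode : cder Q1 (fun x => (0 +i* v) * Q1 x + omega%:C * Q0 x - N0 x * Q0 x);
  wave_ccont : ccont N0;
  wave_F : cder F (fun x => (0 +i* 2^-1) * N0 x);
  wave_ReF : forall x, F x + (F x)^*%C = (normsq (Q0 x))%:C;
  wave_bounded : exists M : R, forall x,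
    [/\ cabs (Q0 x) <= M, cabs (Q1 x) <= M, cabs (F x) <= M & cabs (N0 x) <= M];
  wave_Q_sqintg : sqintg Q0;
  wave_N_sqintg0 : sqintg N0;
  wave_cubic : 2 * rint (fun x => normsq (Q0 x) * complex.Re (F x * F x)) =
    rint (fun x => normsq (Q0 x) * normsq (F x));
  wave_ImNN : exists C : R, forall h : R, 0 < h ->
    `|rint (fun x => complex.Im (N0 x * N0 x) * sin (h * x))| <= C * h ^+ 3 }.

Lemma ft_realN (h : R -> R) s : rintg h ->
  ft (fun x => (h x)%:C) (- s) = (ft (fun x => (h x)%:C) s)^*.
Proof.
move=> ih; rewrite /ft -cintJ; last exact: (cintg_ft s (cintgR ih)).
apply: eq_cint => x; rewrite mulrN opprK expiN.
by case: (expi (x * s)) => a b; apply: eq_complexP; rewrite /=; ring.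
Qed.

Variables (omega v : R) (Q Qh N Nh : R -> R[i]).
Hypothesis hQ : is_fourier Q Qh.
Hypothesis wQ : rintg (fun xi => (1 + xi ^+ 2) * normsq (Qh xi)).
Hypothesis hN : is_fourier N Nh.
Hypothesis eN : {ae mu, forall xi, Nh xi = (xi + `|xi|)%:C * ft (density Q) xi}.
Hypothesis prof : {ae mu, forall xi,
  (- xi ^+ 2 + v * xi - omega)%:C * Qh xi + ft (fun x => N x * Q x) xi = 0}.

Let r := ft (density Q).
Let c : R[i] := (2 * pi)^-1%:C.
(** The given [Nh] is determined only almost everywhere; this representative vanishes at every
    [xi <= 0], as the convolution estimates require. *)
Let Nh' (xi : R) := (xi + `|xi|)%:C * r xi.
Let g (xi : R) := (half_line xi)%:C * r xi.
Let Q0 := invft Qh.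
Let N0 := invft Nh'.
Let F := invft g.

Let iq : cintg Qh := profile_ft_cintg hQ wQ.
Let sq : sqintg Qh := profile_ft_sqintg hQ.
Let iq1 : cintg (mulX Qh) := profile_ft_mulX_cintg hQ wQ hN prof.
Let iq2 : cintg (mulX (mulX Qh)) := profile_ft_mulXX_cintg hQ wQ hN eN prof.
Let ir : cintg r := (density_ft_cintg hQ wQ hN prof).1.
Let ir1 : cintg (mulX r) := (density_ft_cintg hQ wQ hN prof).2.
Let sQ : sqintg Q := profile_sqintg hQ.

Let cmeas_half : cmeasurable (fun xi : R => (half_line xi)%:C) :=
  cmeasR measurable_half_line.

Let half_le1 (xi : R) : cabs (half_line xi)%:C <= 1.
Proof.
rewrite cabsR; have [h|h] := leP 0 xi; first by rewrite half_line_ge0// normr1.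
by rewrite half_line_lt0// normr0.
Qed.

Let ig : cintg g := cintg_bdM cmeas_half half_le1 ir.

Let g1E xi : Nh' xi = 2%:C * mulX g xi.
Proof.
rewrite /Nh' /mulX /g !mulrA -!realCM; congr (_%:C * _).
have [h|h] := leP 0 xi; first by rewrite half_line_ge0// ger0_norm//; ring.
by rewrite half_line_lt0// ltr0_norm//; ring.
Qed.

Let ig1 : cintg (mulX g).
Proof.
have := cintg_bdM cmeas_half half_le1 ir1.
rewrite (_ : (fun x => _) = mulX g)//; apply/funext => x.
by rewrite /mulX /g mulrCA.
Qed.

Let iN : cintg Nh'.
Proof. by rewrite (funext g1E); exact: cintgZ. Qed.

Let eNh : {ae mu, forall xi, Nh xi = Nh' xi}. Proof. exact: eN. Qed.

Let sN : sqintg Nh'.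
Proof. by have [_ /L2P sNh _] := hN; exact: sqintg_ae iN.1 eNh sNh. Qed.

Let NE : {ae mu, forall x, N x = N0 x}.
Proof.
have iNh := nonlocal_ft_cintg hQ wQ hN eN prof.
apply: ae_mono (fourier_inversion hN iNh) => x ->.
exact: (invft_ae x iNh iN eNh).
Qed.

Let hN0 : is_fourier N0 Nh'.
Proof. exact: is_fourier_ae hN (cmeas_invft iN) iN.1 NE eNh. Qed.

Let QE : {ae mu, forall x, Q x = Q0 x}. Proof. exact: profile_invft hQ wQ. Qed.

Let sQ0 : sqintg Q0. Proof. exact: sqintg_ae (cmeas_invft iq) QE sQ. Qed.
Let sN0 : sqintg N0. Proof. by have [/L2P] := hN0. Qed.

Let rE z : r z = ft (density Q0) z.
Proof.
have i1 := cintg_ft z (cintg_density sQ); have i2 := cintg_ft z (cintg_density sQ0).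
apply: cint_ae; [exact: i1.1|exact: i2.1|].
by apply: ae_mono QE => x e; rewrite /density e.
Qed.

Let rN s : r (- s) = (r s)^*.
Proof. by rewrite !rE; exact: ft_realN sQ0.2. Qed.

(** The density is real, so its transform is Hermitian and its positive half determines it. At
    [s = 0] both halves would count [r 0]; that point is negligible. *)
Let gE (s : R) : s != 0 -> r s = g s + conj_reflect g s.
Proof.
rewrite neq_lt /g /conj_reflect => /orP[s0|s0].
- rewrite (half_line_lt0 s0) mul0r add0r rN half_line_ge0 ?oppr_ge0 ?ltW// mul1r.
  exact/esym/conjcK.
- rewrite (half_line_ge0 (ltW s0)) mul1r half_line_lt0 ?oppr_lt0// mul0r.
  by rewrite conjc0 addr0.
Qed.

(** Valid at every [x]: [r] is itself a convolution, whose inverse transform is a product of values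
    of the continuous [Q0]. *)
Let invft_r x : invft r x = (normsq (Q0 x))%:C.
Proof.
have e : r = (fun z => c * convol Qh (conj_reflect Qh) z).
  by apply/funext => z; exact: ft_density hQ wQ z.
rewrite e (invft_convol x iq (cintg_conj_reflect iq) sq (sqintg_conj_reflect sq)).
by rewrite (invft_conj_reflect x iq) mul_conj.
Qed.

Let r_bound : exists B : R, 0 <= B /\ forall xi, cabs (r xi) <= B.
Proof.
exists (rint (fun x => cabs (density Q x))); split.
  by apply: rint_ge0 => x; exact: cabs_ge0.
by move=> xi; exact: ft_le (cintg_density sQ).
Qed.

Let ode x : - invft (mulX (mulX Qh)) x + v%:C * invft (mulX Qh) x
  - omega%:C * invft Qh x + N0 x * Q0 x = 0.
Proof.
have im := cintgZ c (cintg_convol iN iq).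
rewrite -(invft_convol x iN iq sN sq) -/c.
have ez z : - invft z x = (-1) * invft z x by rewrite mulN1r.
rewrite ez -mulNr -(invftZ (-1) x iq2) -(invftZ v%:C x iq1) -(invftZ (- omega%:C) x iq).
have j2 := cintgZ (-1) iq2; have j1 := cintgZ v%:C iq1; have j0 := cintgZ (- omega%:C) iq.
rewrite -(invftD x j2 j1) -(invftD x (cintgD j2 j1) j0).
rewrite -(invftD x (cintgD (cintgD j2 j1) j0) im).
have j := cintgD (cintgD (cintgD j2 j1) j0) im.
have -> : 0 = invft (fun=> 0 : R[i]) x.
  rewrite /invft /ift; under eq_cint do rewrite mul0r.
  by rewrite cint0 mulr0.
apply: (invft_ae x j (@cintg0 R)).
apply: ae_mono prof => xi; rewrite (ft_NQ hQ wQ hN) => <-.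
have -> : convol Nh' Qh xi = convol Nh Qh xi.
  have [_ /L2P sNh _] := hN.
  apply: cint_ae.
  - exact: (cintg_convol_section xi sN sq).1.
  - exact: (cintg_convol_section xi sNh sq).1.
  by apply: ae_mono eNh => y ->.
congr (_ + _); rewrite /mulX.
by case: (Qh xi) => a b; apply: eq_complexP; rewrite /=; ring.
Qed.

Let NN_neg (h : R) : 0 <= h -> convol Nh' Nh' (- h) = 0.
Proof.
move=> h0; rewrite -[RHS]cint0; apply: eq_cint => t.
have neg (s : R) : s < 0 -> Nh' s = 0.
  by move=> s0; rewrite /Nh' ltr0_norm// subrr mul0r.
have [t0|t0] := ltP t 0; first by rewrite (neg t t0) mul0r.
have [e|e] := eqVneq (- h - t) 0; last first.
  by rewrite (neg (- h - t)) ?mulr0//; rewrite lt_neqAle e/=; lra.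
by rewrite e /Nh' normr0 addr0 mul0r mulr0.
Qed.

(** The integrand lives on [[0, h]], and there each factor is at most [2 B h]; the length of the
    interval supplies the third power. *)
Let NN_pos : exists C : R, forall h : R, 0 <= h -> cabs (convol Nh' Nh' h) <= C * h ^+ 3.
Proof.
have [B [B0 rB]] := r_bound.
exists (4 * B ^+ 2) => h h0.
have i := cintg_convol_section h sN sN.
apply: le_trans (cint_le i) _.
have b s : cabs (Nh' s) <= 2 * B * `|s|.
  rewrite /Nh' cabsM cabsR; apply: (@le_trans _ _ (`|s + `|s| | * B)).
    by apply: ler_wpM2l => //; exact: rB.
  rewrite [leRHS]mulrAC mulrC [leRHS]mulrC ler_wpM2l//.
  by apply: le_trans (ler_normD _ _) _; rewrite normr_id; lra.
have neg (s : R) : s <= 0 -> Nh' s = 0.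
  by move=> s0; rewrite /Nh' ler0_norm// subrr mul0r.
apply: (@le_trans _ _ (rint (fun xi => 4 * B ^+ 2 * h ^+ 2 * \1_`[0, h] xi))); last first.
  rewrite rintZ; last exact: rintg_indic.
  have -> : rint (\1_`[0, h] : R -> R) = h.
    have d (x : R) : is_derive x 1 (fun x : R => x) ((fun=> 1) x) by exact: is_derive_id.
    have c1 : continuous (fun _ : R => 1 : R) := (@ccont_cst R 1).1.
    have e := rint_FTC h0 c1 d; rewrite subr0 in e; rewrite -[RHS]e.
    by congr (rint _); apply/funext => x; rewrite mulr1.
  by rewrite le_eqVlt; apply/orP; left; apply/eqP; ring.
apply: rint_le; [exact: i.2|exact: rintgZ (@rintg_indic R 0 h)|move=> t].
rewrite indicE; have [t0|t0] := leP t 0.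
  rewrite (neg t t0) mul0r cabs0; apply: mulr_ge0 => //.
  by rewrite !mulr_ge0 ?sqr_ge0.
have [ht|ht] := leP h t.
  rewrite (neg (h - t)); last by lra.
  by rewrite mulr0 cabs0; apply: mulr_ge0 => //; rewrite !mulr_ge0 ?sqr_ge0.
rewrite mem_set; last by rewrite /= in_itv/= (ltW t0) (ltW ht).
rewrite mulr1 cabsM.
apply: (@le_trans _ _ (2 * B * h * (2 * B * h))); last by rewrite le_eqVlt; apply/orP; left; apply/eqP; ring.
have B2 : 0 <= 2 * B by lra.
apply: ler_pM; rewrite ?cabs_ge0//.
  by apply: le_trans (b t) _; rewrite ler_wpM2l// gtr0_norm// ltW.
by apply: le_trans (b (h - t)) _; rewrite ler_wpM2l// gtr0_norm; lra.
Qed.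

Lemma profile_regular : exists Q0 Q1 N0 F : R -> R[i],
  [/\ {ae mu, forall x, Q x = Q0 x}, Q0 = invft Qh, cintg Qh &
      regular_wave omega v Q0 Q1 N0 F].
Proof.
exists Q0, (fun x => (0 +i* 1) * invft (mulX Qh) x), N0, F.
split; [exact: QE|by []|exact: iq|split].
- exact: cder_invft iq iq1.
- have := cderZ (0 +i* 1) (cder_invft iq1 iq2); apply: eq_cder => x.
  have -> : invft (mulX (mulX Qh)) x = v%:C * invft (mulX Qh) x
    - omega%:C * invft Qh x + N0 x * Q0 x.
    by apply/eqP; rewrite eq_sym -subr_eq0 addrC !addrA; apply/eqP; exact: ode.
  rewrite -/Q0; move: (invft _ x) (Q0 x) (N0 x) => [a1 a2] [b1 b2] [d1 d2].
  by apply: eq_complexP; rewrite /=; ring.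
- exact: ccont_invft iN.
- have := cder_invft ig ig1; apply: eq_cder => x.
  rewrite /N0 (funext g1E) (invftZ 2%:C x ig1) mulrA; congr (_ * _).
  by apply: eq_complexP; rewrite /=; field.
- move=> x; rewrite -invft_r.
  rewrite -(invft_conj_reflect x ig).
  rewrite -(invftD x ig (cintg_conj_reflect ig)).
  apply: (invft_ae x (cintgD ig (cintg_conj_reflect ig)) ir).
  by apply: ae_mono (ae_neq 0) => s s0; rewrite -(gE s0).
- have [M0 [M00 h0]] := invft_bounded iq; have [M1 [M10 h1]] := invft_bounded iq1.
  have [M2 [M20 h2]] := invft_bounded ig; have [M3 [M30 h3]] := invft_bounded iN.
  exists (M0 + M1 + M2 + M3) => x; split.
  + by apply: le_trans (h0 x) _; lra.
  + rewrite cabsM; have -> : cabs (0 +i* 1) = 1 by rewrite cabsE /= expr0n expr1n add0r sqrtr1.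
    by rewrite mul1r; apply: le_trans (h1 x) _; lra.
  + by apply: le_trans (h2 x) _; lra.
  + by apply: le_trans (h3 x) _; lra.
- exact: sQ0.
- exact: sN0.
- have [B [_ rB]] := r_bound.
  apply: hardy_cubic; [exact: sQ0.2|exact: ig| | |].
  + by move=> s s0; rewrite /g half_line_lt0// mul0r.
  + exists B => s; rewrite /g cabsM; apply: le_trans (rB s).
    by rewrite -[leRHS]mul1r ler_wpM2r ?cabs_ge0//; exact: half_le1.
  + apply: ae_mono (ae_neq 0) => s s0.
    have <- : r (- s) = ft (fun x => (normsq (Q0 x))%:C) (- s) := rE (- s).
    by rewrite gE ?oppr_eq0// addrC /conj_reflect opprK.
- have [C hC] := NN_pos; exists (cabs c * C) => h h0.
  have iNN := sqintg_mul sN0 sN0.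
  have e z := ft_mul_invft z hN0 iN sN iNN.
  have e1 : ft (fun x => N0 x * N0 x) (- h) = 0 by rewrite e NN_neg ?mulr0// ltW.
  have e2 : cabs (ft (fun x => N0 x * N0 x) h) <= cabs c * C * h ^+ 3.
    by rewrite e cabsM -mulrA ler_wpM2l ?cabs_ge0//; apply: hC; exact: ltW.
  have i1 := cintg_ft h iNN; have i2 := cintg_ft (- h) iNN.
  have C0 : 0 <= cabs c * C * h ^+ 3 := le_trans (cabs_ge0 _) e2.
  (* Write [sin (h x)] with exponentials. The coefficient at [- h] vanishes because the spectrum is
     positive, and the one at [h] is cubic in [h]. *)
  have -> : rint (fun x => complex.Im (N0 x * N0 x) * sin (h * x)) =
     complex.Im ((0 +i* - 2^-1) * (ft (fun x => N0 x * N0 x) (- h) - ft (fun x => N0 x * N0 x) h)).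
    rewrite /ft -(cintB i2 i1) -(cintZ _ (cintgB i2 i1)) cintE.
    congr rint; apply/funext => x; rewrite mulrN opprK [x * h]mulrC /expi cosN sinN.
    by case: (N0 x * N0 x) => a b /=; field.
  rewrite e1 sub0r; apply: le_trans (Im_le_cabs _) _.
  rewrite cabsM cabsN; have -> : cabs (0 +i* - 2^-1) = 2^-1.
    by rewrite cabsE /= expr0n add0r sqrrN sqrtr_sqr ger0_norm// invr_ge0.
  apply: le_trans (ler_wpM2l _ e2) _; first by rewrite invr_ge0.
  by move: (cabs c * C * h ^+ 3) C0 => X; lra.
Qed.

End Regularity.

(** * Integral identities and the first-order equation *)

Section Energy.
Context {R : realType}.
Local Notation mu := (@lebesgue_measure R).
Local Notation cabs := (@Normc.normc R).

Lemma cint_der0 (G G' : R -> R[i]) : cder G G' -> ccont G' -> cintg G -> cintg G' ->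
  cint G' = 0.
Proof.
move=> dG cG' iG iG'.
have sc := @smooth1_cutoff R; have sc1 := smooth1_derive sc.
have cc : compactly_supported 1 (@cutoff R) by move=> x x1; apply: cutoff_out; exact: ltW.
have cc1 := compactly_supported_derive cc.
have [M0 [_ bM0]] := smooth_bounded sc cc.
have [M1 [_ bM1]] := smooth_bounded sc1 cc1.
have L0 := cvg_dilation iG' (smooth1_continuous sc) bM0.
have L1 := cvg_dilation iG (smooth1_continuous sc1) bM1.
have Lk : ccvg (fun n => ((n.+1%:R)^-1)%:C) (0 : R[i]).
  by apply: (@ccvgR _ _ 0); exact: cvg_harmonic.
have L := ccvgD L0 (ccvgM Lk L1).
have e0 : (cutoff 0)%:C * cint G' + 0 * ((derive1 cutoff 0)%:C * cint G) = 0.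
  apply: (ccvg_uniq L); apply: eq_ccvg (ccvg_cst 0) => n.
  pose k : R := (n.+1%:R)^-1.
  have k0 : 0 < k := invn_gt0 n.
  have [sb cb] := cutoff_scaled k0 (invn_le1 n).
  pose b (x : R) := cutoff (k * x).
  have sb1 := smooth1_derive sb; have cb1 := compactly_supported_derive cb.
  have eb1 x : derive1 b x = k * derive1 cutoff (k * x) by rewrite (derive1_scale k sc).
  have db : cder (fun x => (b x)%:C) (fun x => (derive1 b x)%:C).
    by apply: cder_real => x; exact: smooth1_is_derive.
  have cb' : ccont (fun x => (b x)%:C) by apply: ccontR; exact: smooth1_continuous.
  have cb1' : ccont (fun x => (derive1 b x)%:C) by apply: ccontR; exact: smooth1_continuous.
  have iA : cintg (fun x => (b x)%:C * G' x).
    by under eq_fun do rewrite mulrC; exact: cintg_smooth iG' sb cb.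
  have iB : cintg (fun x => (derive1 b x)%:C * G x).
    by under eq_fun do rewrite mulrC; exact: cintg_smooth iG sb1 cb1.
  have iB' : cintg (fun x => (derive1 cutoff (k * x))%:C * G x).
    under eq_fun do rewrite mulrC.
    apply: (cintg_smooth (K := k^-1) iG (smooth1_scale k sc1)).
    move=> x kx; have k1 : derive1 b x = 0 by exact: cb1.
    by move: k1; rewrite eb1 => /eqP; rewrite mulf_eq0 gt_eqF//= => /eqP.
  have eB : cint (fun x => (derive1 b x)%:C * G x) =
      k%:C * cint (fun x => (derive1 cutoff (k * x))%:C * G x).
    rewrite -(cintZ _ iB'); apply: eq_cint => x.
    by rewrite eb1 (realCM k) mulrA.
  rewrite -/k -eB -(cintD iA iB).
  rewrite -[LHS](cint_der_compact (K := k^-1) _ (cderM db dG)).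
  - by apply: eq_cint => x; rewrite addrC.
  - by apply: ccontD; apply: ccontM => //; exact: cder_cont dG.
  - move=> x kx; have -> : b x = 0 by exact: cb.
    by rewrite (cb1 x kx) !mul0r addr0.
  - move=> x kx; have -> : b x = 0 by exact: cb.
    by rewrite mul0r.
move/eqP: e0; rewrite mul0r addr0 mulf_eq0 => /orP[/eqP/(congr1 (@complex.Re R))/= h|/eqP//].
by have := @cutoff0_gt0 R; rewrite h ltxx.
Qed.

Lemma rint_der0 (G G' : R -> R) : (forall x : R, is_derive x 1 G (G' x)) ->
  continuous G' -> rintg G -> rintg G' -> rint G' = 0.
Proof.
move=> dG cG' iG iG'.
have := cint_der0 (cder_real dG) (ccontR cG') (cintgR iG) (cintgR iG').
by rewrite cintR => /(congr1 (@complex.Re R)).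
Qed.

Lemma derive_ge0_le (G G' : R -> R) (a b : R) : a <= b ->
  (forall x : R, is_derive x 1 G (G' x)) -> continuous G' -> (forall x, 0 <= G' x) ->
  G a <= G b.
Proof.
move=> ab dG cG' G0; rewrite -subr_ge0 -(rint_FTC ab cG' dG).
by apply: rint_ge0 => x; rewrite mulr_ge0// indicE.
Qed.

(* Gronwall: [|U|^2 exp (2 B x)] is nondecreasing, [|U|^2 exp (- 2 B x)] is
   nonincreasing. *)
Lemma linear_ode_zero (F U : R -> R[i]) (B : R) (x0 : R) : ccont F ->
  (forall x, cabs (F x) <= B) -> cder U (fun x => F x * U x) -> U x0 = 0 ->
  forall x, U x = 0.
Proof.
move=> [cF1 cF2] FB dU U0.
have [cU1 cU2] := cder_cont dU.
have [d1 d2] := dU.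
pose w x := normsq (U x).
have dw (x : R) : is_derive x 1 w (2 * complex.Re (F x) * w x).
  rewrite /w /normsq; have d1x := d1 x; have d2x := d2 x.
  apply: is_derive_eq.
  by rewrite !ReImE /GRing.scale/=; ring.
have cw : continuous w by exact: is_derive_continuous dw.
have w0 x : 0 <= w x := normsq_ge0 _.
have wx0 : w x0 = 0 by rewrite /w U0 /normsq /= expr0n addr0.
have Fle x : `|complex.Re (F x)| <= B := le_trans (Re_le_cabs _) (FB x).
(* One statement for both monotonicities: [s = 1], [e = B] on the left of [x0], and [s = -1],
   [e = - B] on the right. *)
have mono (s e : R) a b : a <= b -> (forall x, 0 <= s * (e + complex.Re (F x))) ->
    s * (w a * expR (2 * e * a)) <= s * (w b * expR (2 * e * b)).
  move=> ab he.
  have dE (x : R) : is_derive x 1 (fun x : R => expR (2 * e * x)) (2 * e * expR (2 * e * x)).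
    have dk : is_derive x 1 (fun x : R => 2 * e * x) (2 * e).
      by apply: is_derive_eq; rewrite /GRing.scale/=; ring.
    have d := is_derive1_comp (is_derive_expR (2 * e * x)) dk.
    by apply: (is_derive_eq d); rewrite /GRing.scale/=; ring.
  have cE : continuous (fun x : R => expR (2 * e * x)) by exact: is_derive_continuous dE.
  apply: (derive_ge0_le (G := fun x => s * (w x * expR (2 * e * x)))
    (G' := fun x => 2 * (s * (e + complex.Re (F x))) * (w x * expR (2 * e * x)))) => //.
  - move=> x; have dwx := dw x; have dEx := dE x; apply: is_derive_eq.
    by rewrite /GRing.scale/=; ring.
  - move=> x; apply: cvgM; last by apply: cvgM; [exact: cw|exact: cE].
    apply: cvgM; first exact: cvg_cst.
    by apply: cvgM; [exact: cvg_cst|apply: cvgD; [exact: cvg_cst|exact: cF1]].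
  - move=> x; have := expR_gt0 (2 * e * x) => h.
    by apply: mulr_ge0; [apply: mulr_ge0; [|exact: he]|apply: mulr_ge0; [exact: w0|exact: ltW]].
move=> x; apply: cabs_eq0; apply/eqP; rewrite -sqrf_eq0 cabs_normsq -/(w x); apply/eqP.
have [xx|xx] := leP x x0.
- have := mono 1 B x x0 xx; rewrite wx0 mul0r mulr0 mul1r => h.
  have {}h : w x * expR (2 * B * x) <= 0.
    by apply: h => y; have := Fle y; rewrite ler_norml => /andP[h1 h2]; lra.
  by apply/eqP; rewrite eq_le w0 andbT; move: h; rewrite pmulr_lle0// expR_gt0.
- have := mono (-1) (- B) x0 x (ltW xx); rewrite wx0 mul0r mulr0 mulN1r oppr_ge0 => h.
  have {}h : w x * expR (2 * - B * x) <= 0.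
    by apply: h => y; have := Fle y; rewrite ler_norml => /andP[h1 h2]; lra.
  by apply/eqP; rewrite eq_le w0 andbT; move: h; rewrite pmulr_lle0// expR_gt0.
Qed.

Variables (c : R) (S P N F : R -> R[i]).
Hypothesis dS : cder S P.
Hypothesis dP : cder P (fun x => (c%:C - N x) * S x).
Hypothesis cN : ccont N.
Hypothesis dF : cder F (fun x => (0 +i* 2^-1) * N x).
Hypothesis ReF : forall x, F x + (F x)^*%C = (normsq (S x))%:C.
Hypothesis bounded : exists M : R, forall x,
    [/\ cabs (S x) <= M, cabs (P x) <= M, cabs (F x) <= M & cabs (N x) <= M].
Hypothesis sS : sqintg S.
Hypothesis sN : sqintg N.
Hypothesis cubic : 2 * rint (fun x => normsq (S x) * complex.Re (F x * F x)) =
    rint (fun x => normsq (S x) * normsq (F x)).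
Hypothesis ImNN : exists C : R, forall h : R, 0 < h ->
    `|rint (fun x => complex.Im (N x * N x) * sin (h * x))| <= C * h ^+ 3.

Let s1 x := complex.Re (S x).
Let s2 x := complex.Im (S x).
Let p1 x := complex.Re (P x).
Let p2 x := complex.Im (P x).
Let n1 x := complex.Re (N x).
Let n2 x := complex.Im (N x).
Let f x := complex.Im (F x).
Let rho x := s1 x ^+ 2 + s2 x ^+ 2.
Let sp x := s1 x * p1 x + s2 x * p2 x.
Let T x := p1 x ^+ 2 + p2 x ^+ 2 - rho x ^+ 3 / 3 - c * rho x.

Let ds1 (x : R) : is_derive x 1 s1 (p1 x). Proof. exact: dS.1. Qed.
Let ds2 (x : R) : is_derive x 1 s2 (p2 x). Proof. exact: dS.2. Qed.
Let dp1 (x : R) : is_derive x 1 p1 ((c - n1 x) * s1 x + n2 x * s2 x).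
Proof.
have := dP.1 x; rewrite (_ : complex.Re _ = (c - n1 x) * s1 x + n2 x * s2 x)//.
by rewrite !ReImE /= /n1 /n2 /s1 /s2; ring.
Qed.
Let dp2 (x : R) : is_derive x 1 p2 ((c - n1 x) * s2 x - n2 x * s1 x).
Proof.
have := dP.2 x; rewrite (_ : complex.Im _ = (c - n1 x) * s2 x - n2 x * s1 x)//.
by rewrite !ReImE /= /n1 /n2 /s1 /s2; ring.
Qed.
Let df (x : R) : is_derive x 1 f (n1 x / 2).
Proof.
have := dF.2 x; rewrite (_ : complex.Im _ = n1 x / 2)//.
by rewrite !ReImE /= /n1; ring.
Qed.
Let ReFE x : complex.Re (F x) = rho x / 2.
Proof.
have := congr1 (@complex.Re R) (ReF x).
by rewrite cReD cReJ /= /rho /s1 /s2 /normsq => <-; field.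
Qed.
Let drho' (x : R) : is_derive x 1 rho (2 * sp x).
Proof.
rewrite /rho; have a := ds1 x; have b := ds2 x.
by apply: is_derive_eq; rewrite /sp /GRing.scale/=; ring.
Qed.
(** [rho'] computed in two ways: from [S' = P], and from [rho = 2 Re F] with [F' = i N / 2]. *)
Let n2E x : n2 x = - (2 * sp x).
Proof.
have h : is_derive x 1 rho (- n2 x).
  have -> : rho = (fun x => 2 * complex.Re (F x)).
    by apply/funext => y; rewrite ReFE; field.
  have d := dF.1 x; apply: is_derive_eq.
  by rewrite !ReImE /= /n2 /GRing.scale/=; field.
have := @derive_val _ _ _ _ _ _ _ h; rewrite (@derive_val _ _ _ _ _ _ _ (drho' x)).
by move=> ->; rewrite opprK.
Qed.
Let cs1 : continuous s1 := (cder_cont dS).1.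
Let cs2 : continuous s2 := (cder_cont dS).2.
Let cp1 : continuous p1 := (cder_cont dP).1.
Let cp2 : continuous p2 := (cder_cont dP).2.
Let cn1 : continuous n1 := cN.1.
Let cn2 : continuous n2 := cN.2.
Let cf : continuous f := (cder_cont dF).2.

Let contM (g h : R -> R) : continuous g -> continuous h -> continuous (fun x => g x * h x).
Proof. by move=> cg ch x; apply: cvgM; [exact: cg|exact: ch]. Qed.
Let contD (g h : R -> R) : continuous g -> continuous h -> continuous (fun x => g x + h x).
Proof. by move=> cg ch x; apply: cvgD; [exact: cg|exact: ch]. Qed.
Let contC (k : R) : continuous (fun _ : R => k).
Proof. by move=> x; exact: cvg_cst. Qed.
Let contN (g : R -> R) : continuous g -> continuous (fun x => - g x).
Proof. by move=> cg x; apply: cvgN; exact: cg. Qed.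
Let contX (g : R -> R) n : continuous g -> continuous (fun x => g x ^+ n).
Proof.
move=> cg; elim: n => [|n ih].
  by rewrite (_ : (fun x => _) = (fun=> 1)); [exact: contC|apply/funext => x; rewrite expr0].
rewrite (_ : (fun x => _) = (fun x => g x * g x ^+ n)); first exact: contM.
by apply/funext => x; rewrite exprS.
Qed.
Let crho : continuous rho := is_derive_continuous drho'.
Let pp x := p1 x ^+ 2 + p2 x ^+ 2.
Let cpp : continuous pp.
Proof. by apply: contD; exact: contX. Qed.
Let csp : continuous sp.
Proof. by apply: contD; exact: contM. Qed.
Let dsp (x : R) : is_derive x 1 sp (pp x + (c - n1 x) * rho x).
Proof.
rewrite /sp; have a1 := ds1 x; have a2 := ds2 x; have b1 := dp1 x; have b2 := dp2 x.
by apply: is_derive_eq; rewrite /pp /rho /GRing.scale/=; ring.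
Qed.
Let rho0 x : 0 <= rho x. Proof. by rewrite addr_ge0 ?sqr_ge0. Qed.
Let pp0 x : 0 <= pp x. Proof. by rewrite addr_ge0 ?sqr_ge0. Qed.

Let bd : exists B : R, 0 <= B /\ forall x,
  [/\ rho x <= B, `|f x| <= B, `|n1 x| <= B & `|sp x| <= B].
Proof.
have [M hM] := bounded.
have M0 : 0 <= M by have [h _ _ _] := hM 0; exact: le_trans (cabs_ge0 _) h.
exists (M + 2 * M ^+ 2); split; first by rewrite addr_ge0// mulr_ge0// sqr_ge0.
move=> x; have [h1 h2 h3 h4] := hM x.
have a1 := le_trans (Re_le_cabs _) h1; have a2 := le_trans (Im_le_cabs _) h1.
have b1 := le_trans (Re_le_cabs _) h2; have b2 := le_trans (Im_le_cabs _) h2.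
have f1 := le_trans (Im_le_cabs _) h3; have m1 := le_trans (Re_le_cabs _) h4.
have sq a b : `|a| <= M -> `|b| <= M -> `|a * b| <= M ^+ 2.
  by move=> ha hb; rewrite normrM expr2; apply: ler_pM.
have MM : 0 <= M ^+ 2 by rewrite sqr_ge0.
split.
- have := sq _ _ a1 a1; have := sq _ _ a2 a2.
  rewrite -!expr2 !ger0_norm ?sqr_ge0// => e1 e2.
  by apply: le_trans (lerD e2 e1) _; lra.
- by apply: le_trans f1 _; lra.
- by apply: le_trans m1 _; lra.
- apply: le_trans (ler_normD _ _) _.
  by apply: le_trans (lerD (sq _ _ a1 b1) (sq _ _ a2 b2)) _; lra.
Qed.

Let irho : rintg rho := sS.2.

Let ibd (g h : R -> R) (K : R) : continuous g -> rintg h ->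
  (forall x, `|g x| <= K * h x) -> rintg g.
Proof.
move=> cg ih gh; apply: rintg_le (rintgZ K ih) gh.
exact: continuous_measurable_fun.
Qed.

Let ibdM (g h : R -> R) (K : R) : continuous g -> (forall x, `|g x| <= K) ->
  continuous h -> rintg h -> rintg (fun x => g x * h x).
Proof.
move=> cg gK ch ih; apply: (ibd (contM cg ch) (rintg_abs ih)) => x.
by rewrite normrM; apply: ler_wpM2r.
Qed.

Let iq : rintg (fun x => (c - n1 x) * rho x).
Proof.
have [B [_ hB]] := bd.
apply: (@ibdM _ _ (`|c| + B)) => //.
  by apply: contD; [exact: contC|exact: contN].
move=> x; apply: le_trans (ler_normB _ _) _; have [_ _ h _] := hB x.
by rewrite lerD2l.
Qed.

(** Square integrability of [S'] is not assumed. The derivative of [sp] is [pp + (c - n1) rho]; as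
    [sp] is bounded and the second term integrable, the windows of [pp] stay bounded. *)
Let ipp : rintg pp.
Proof.
have [B [B0 hB]] := bd.
apply: (@ge0_rintg_sym _ _ (B + B + rint (fun x => `|(c - n1 x) * rho x|))) => // n.
have cq : continuous (fun x => (c - n1 x) * rho x).
  by apply: contM => //; apply: contD; [exact: contC|exact: contN].
have cd : continuous (fun x => pp x + (c - n1 x) * rho x) by exact: contD.
have := rint_FTC (@ge0_le_sym R n) cd dsp.
have i1 := rintg_itv (- n%:R) n%:R cpp.
have i2 := rintg_itv (- n%:R) n%:R cq.
have -> : rint (fun x => \1_`[- n%:R, n%:R] x * (pp x + (c - n1 x) * rho x)) =
    rint (fun x => \1_`[- n%:R, n%:R] x * pp x) +
    rint (fun x => \1_`[- n%:R, n%:R] x * ((c - n1 x) * rho x)).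
  by rewrite -(rintD i1 i2); congr (rint _); apply/funext => x; rewrite mulrDr.
have h2 : - rint (fun x => \1_`[- n%:R, n%:R] x * ((c - n1 x) * rho x)) <=
    rint (fun x => `|(c - n1 x) * rho x|).
  rewrite -(rintN i2); apply: rint_le; [exact: rintgN|exact: rintg_abs|move=> x].
  rewrite indicE; case: (_ \in _); rewrite ?mul1r ?mul0r ?oppr0//.
  by rewrite -normrN; exact: ler_norm.
have [_ _ _ /ler_normlP[_ h3]] := hB n%:R.
have [_ _ _ /ler_normlP[h4 _]] := hB (- n%:R).
by move: h2 h3 h4; lra.
Qed.

Let isp : rintg sp.
Proof.
apply: (ibd (K := 1) csp (rintgD irho ipp)) => x; rewrite mul1r /sp /rho /pp.
have e (a b : R) : `|a * b| <= a ^+ 2 + b ^+ 2.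
  by rewrite ler_norml; apply/andP; split; nra.
have := lerD (e (s1 x) (p1 x)) (e (s2 x) (p2 x)).
by move=> h; apply: le_trans (ler_normD _ _) _; apply: le_trans h _; lra.
Qed.

(** The equation paired with the conjugate of [S]: the derivative of [sp] integrates to 0. *)
Let Xeq : rint pp = - rint (fun x => (c - n1 x) * rho x).
Proof.
have cd : continuous (fun x => pp x + (c - n1 x) * rho x).
  apply: contD => //; apply: contM => //; apply: contD; [exact: contC|exact: contN].
have := rint_der0 dsp cd isp (rintgD ipp iq).
by rewrite (rintD ipp iq) => /eqP; rewrite addr_eq0 => /eqP.
Qed.

Let ibrho (g : R -> R) (B : R) : continuous g -> (forall x, `|g x| <= B) ->
  rintg (fun x => g x * rho x).
Proof. by move=> cg gB; exact: (ibdM cg gB crho irho). Qed.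

Let in1rho : rintg (fun x => n1 x * rho x).
Proof. by have [B [_ hB]] := bd; apply: (ibrho (B := B)) => // x; have [] := hB x. Qed.

Let ifsp : rintg (fun x => f x * sp x).
Proof. by have [B [_ hB]] := bd; apply: (ibdM (K := B)) => // x; have [] := hB x. Qed.

Let irho2 : rintg (fun x => rho x ^+ 2).
Proof.
have [B [_ hB]] := bd.
under eq_fun do rewrite expr2.
by apply: (ibrho (B := B)) => // x; rewrite ger0_norm//; have [] := hB x.
Qed.

Let irho3 : rintg (fun x => rho x ^+ 3).
Proof.
have [B [B0 hB]] := bd.
under eq_fun do rewrite exprSr.
apply: (ibrho (B := B ^+ 2)) => [|x]; first exact: contX.
by rewrite ger0_norm ?sqr_ge0// lerXn2r ?nnegrE//; have [] := hB x.
Qed.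

Let iff : rintg (fun x => f x ^+ 2 * rho x).
Proof.
have [B [B0 hB]] := bd.
apply: (ibrho (B := B ^+ 2)) => [|x]; first exact: contX.
by rewrite normrX lerXn2r ?nnegrE//; have [] := hB x.
Qed.

(** The derivative of [f rho] integrates to 0, and [f' = n1 / 2]. *)
Let Yeq : rint (fun x => n1 x * rho x) = - 4 * rint (fun x => f x * sp x).
Proof.
have [B [B0 hB]] := bd.
have ifr : rintg (fun x => f x * rho x).
  by apply: (ibrho (B := B)) => // x; have [] := hB x.
have d (x : R) : is_derive x 1 (fun x => f x * rho x)
    (2^-1 * (n1 x * rho x) + 2 * (f x * sp x)).
  have a := df x; have b := drho' x.
  by apply: is_derive_eq; rewrite /GRing.scale/=; field.
have cd : continuous (fun x => 2^-1 * (n1 x * rho x) + 2 * (f x * sp x)).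
  by apply: contD; apply: contM; try exact: contC; exact: contM.
have := rint_der0 d cd ifr (rintgD (rintgZ _ in1rho) (rintgZ _ ifsp)).
rewrite (rintD (rintgZ _ in1rho) (rintgZ _ ifsp)) (rintZ _ in1rho) (rintZ _ ifsp); lra.
Qed.

Let Weq x : s1 x * p2 x - s2 x * p1 x = rho x ^+ 2 / 2.
Proof.
pose W x := s1 x * p2 x - s2 x * p1 x - rho x ^+ 2 / 2.
(* The current [Im (conj S S')] changes at the rate [- n2 rho = rho rho'], the derivative of
   [rho^2 / 2]. *)
have dW (z : R) : is_derive z 1 W 0.
  rewrite /W; have a1 := ds1 z; have a2 := ds2 z; have b1 := dp1 z; have b2 := dp2 z.
  have a := drho' z; apply: is_derive_eq.
  by rewrite /GRing.scale/= n2E /rho; field.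
have cst a b : a <= b -> W b - W a = 0.
  move=> ab; rewrite -(rint_FTC ab (@contC 0) dW) -[RHS](@rint0 R).
  by congr (rint _); apply/funext => y; rewrite mulr0.
have iW : rintg W.
  have cW : continuous W by exact: is_derive_continuous dW.
  apply: (ibd (K := 1) cW (rintgD (rintgD irho ipp) irho2)) => y.
  rewrite mul1r; apply: le_trans (ler_normB _ _) _; apply: lerD.
    have e (a b : R) : `|a * b| <= a ^+ 2 + b ^+ 2.
      by rewrite ler_norml; apply/andP; split; nra.
    apply: le_trans (ler_normB _ _) _; rewrite /rho /pp.
    by apply: le_trans (lerD (e (s1 y) (p2 y)) (e (s2 y) (p1 y))) _; lra.
  by rewrite ger0_norm ?divr_ge0 ?sqr_ge0// ler_pdivrMr//; have := sqr_ge0 (rho y); lra.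
suff : W x = 0 by rewrite /W => /eqP; rewrite subr_eq0 => /eqP.
have WE y : W y = W x.
  apply/eqP; rewrite -subr_eq0; apply/eqP.
  have [xy|/ltW yx] := leP x y; first exact: cst.
  by rewrite -opprB (cst y x yx) oppr0.
apply/eqP/negPn/negP; rewrite -normr_gt0 => k0.
pose L := rint (fun y => `|W y|).
(* A nonzero constant has unbounded integrals over [[-n, n]], contradicting integrability. *)
have h (n : nat) : `|W x| * n%:R <= L.
  have d (y : R) : is_derive y 1 (fun y : R => `|W x| * y) `|W x|.
    by apply: is_derive_eq; rewrite /GRing.scale/=; ring.
  have e := rint_FTC (@ge0_le_sym R n) (@contC `|W x|) d.
  apply: (@le_trans _ _ (`|W x| * n%:R - `|W x| * - n%:R)).
    by rewrite mulrN opprK lerDl mulr_ge0.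
  rewrite -e; apply: rint_le; [exact: rintg_itv (@contC `|W x|)|exact: rintg_abs|move=> y].
  by rewrite (WE y) indicE; case: (_ \in _); rewrite ?mul1r ?mul0r.
have L0 : 0 <= L / `|W x| by rewrite divr_ge0//; apply: rint_ge0.
have := archi_boundP L0; rewrite ltr_pdivrMr// mulrC => h1.
by have := lt_le_trans h1 (h _); rewrite ltxx.
Qed.

(** By [Weq] the derivative of [|P|^2] is [2 (c - n1) sp - n2 rho^2]. With [n2 = - 2 sp] the terms
    subtracted in [T] cancel the parts in [c] and [rho^2], and [n1 n2] remains: this dictates the
    form of [T]. *)
Let dT (x : R) : is_derive x 1 T (complex.Im (N x * N x) / 2).
Proof.
rewrite /T; have b1 := dp1 x; have b2 := dp2 x; have a := drho' x.
apply: is_derive_eq.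
rewrite cImM -/(n1 x) -/(n2 x).
have -> : (n1 x * n2 x + n2 x * n1 x) / 2 = n1 x * n2 x by field.
have e := n2E x; apply/eqP; rewrite -subr_eq0; apply/eqP.
transitivity (4 * sp x * (s1 x * p2 x - s2 x * p1 x - rho x ^+ 2 / 2)); last first.
  by rewrite Weq subrr mulr0.
by rewrite e /sp /GRing.scale/=; field.
Qed.

Let iT : rintg T.
Proof.
have := rintgB (rintgB ipp (rintgZ 3^-1 irho3)) (rintgZ c irho).
rewrite (_ : (fun x => _) = T)//; apply/funext => x.
by rewrite /T /pp; field.
Qed.

Let TE : rint T = rint pp - rint (fun x => rho x ^+ 3) / 3 - c * rint rho.
Proof.
rewrite -(rintZ c irho) mulrC -(rintZ 3^-1 irho3) -(rintB ipp (rintgZ 3^-1 irho3)).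
rewrite -(rintB (rintgB ipp (rintgZ 3^-1 irho3)) (rintgZ c irho)).
by congr (rint _); apply/funext => x; rewrite /T /pp; field.
Qed.

(** The derivative of [sin (h x) T] integrates to 0, so [h int cos (h x) T] is half an integral
    bounded by [C h^3], up to sign. After division by [h], take [h = 1 / (n + 1)]; the dilated
    cosines tend to 1. *)
Let T0 : rint T = 0.
Proof.
have [C hC] := ImNN.
have cT : continuous T by exact: is_derive_continuous dT.
have cNN : continuous (fun x => complex.Im (N x * N x)).
  rewrite (_ : (fun x => _) = (fun x => n1 x * n2 x + n2 x * n1 x)).
    by apply: contD; exact: contM.
  by apply/funext => x; rewrite cImM.
have iNN : rintg (fun x => complex.Im (N x * N x)) := cintg_Im (sqintg_mul sN sN).
have key (h : R) : 0 < h -> h <= 1 -> `|rint (fun x => cos (h * x) * T x)| <= `|C| * h.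
  move=> h0 h1.
  have dk (x : R) : is_derive x 1 (fun x : R => h * x) h.
    by apply: is_derive_eq; rewrite /GRing.scale/=; ring.
  have ds (x : R) : is_derive x 1 (fun x : R => sin (h * x)) (h * cos (h * x)).
    have d := is_derive1_comp (is_derive_sin (h * x)) (dk x).
    by apply: (is_derive_eq d); rewrite /GRing.scale/=; ring.
  have dc (x : R) : is_derive x 1 (fun x : R => cos (h * x)) (- h * sin (h * x)).
    have d := is_derive1_comp (is_derive_cos (h * x)) (dk x).
    by apply: (is_derive_eq d); rewrite /GRing.scale/=; ring.
  have csin : continuous (fun x : R => sin (h * x)) := is_derive_continuous ds.
  have ccos : continuous (fun x : R => cos (h * x)) := is_derive_continuous dc.
  have bs (x : R) : `|sin (h * x)| <= 1.
    by rewrite ler_norml sin_geN1 sin_le1.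
  have bc (x : R) : `|cos (h * x)| <= 1.
    by rewrite ler_norml cos_geN1 cos_le1.
  have i1 : rintg (fun x => sin (h * x) * T x) := ibdM csin bs cT iT.
  have i2 : rintg (fun x => cos (h * x) * T x) := ibdM ccos bc cT iT.
  have i3 : rintg (fun x => complex.Im (N x * N x) * sin (h * x)).
    by have := ibdM csin bs cNN iNN; under eq_fun do rewrite mulrC.
  have d (x : R) : is_derive x 1 (fun x => sin (h * x) * T x)
      (h * (cos (h * x) * T x) + 2^-1 * (complex.Im (N x * N x) * sin (h * x))).
    have a := ds x; have b := dT x.
    by apply: is_derive_eq; rewrite /GRing.scale/=; ring.
  have cd : continuous (fun x => h * (cos (h * x) * T x) + 2^-1 * (complex.Im (N x * N x) * sin (h * x))).
    by apply: contD; apply: contM; try exact: contC; exact: contM.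
  have := rint_der0 d cd i1 (rintgD (rintgZ _ i2) (rintgZ _ i3)).
  rewrite (rintD (rintgZ _ i2) (rintgZ _ i3)) (rintZ _ i2) (rintZ _ i3).
  have := hC h h0.
  move: (rint (fun x => complex.Im _ * _)) (rint (fun x => cos _ * _)) => a b ha e.
  have eb : h * `|b| = 2^-1 * `|a|.
    have -> : h * `|b| = `|h * b| by rewrite normrM gtr0_norm.
    have -> : h * b = - (2^-1 * a) by lra.
    by rewrite normrN normrM ger0_norm ?invr_ge0.
  rewrite -(ler_pM2l h0) eb.
  have hc := ler_norm C.
  have h3 : C * h ^+ 3 <= `|C| * h ^+ 2.
    apply: (@le_trans _ _ (`|C| * h ^+ 3)); first by rewrite ler_wpM2r// exprn_ge0// ltW.
    by rewrite ler_wpM2l// exprS ler_piMl ?sqr_ge0.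
  have h4 : h * (`|C| * h) = `|C| * h ^+ 2 by ring.
  rewrite h4; have := normr_ge0 a; lra.
have iT' := cintgR iT.
have cc : continuous (@cos R) by exact: continuous_cos.
have bc (x : R) : `|cos x| <= 1 by rewrite ler_norml cos_geN1 cos_le1.
have L := cvg_dilation iT' cc bc.
rewrite cos0 mul1r cintR in L.
have L' : ccvg (fun n : nat => cint (fun x => (cos ((n.+1%:R)^-1 * x))%:C * (T x)%:C)) 0.
  apply: (ccvg_le (v := fun n : nat => `|C| * (n.+1%:R)^-1)).
    move=> n; rewrite subr0.
    rewrite (_ : cint _ = (rint (fun x => cos ((n.+1%:R)^-1 * x) * T x))%:C).
      by rewrite cabsR; exact: key (invn_gt0 n) (invn_le1 n).
    by rewrite -cintR; apply: eq_cint => x; rewrite (realCM (cos _) (T x)).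
  by rewrite -[X in _ --> X](mulr0 `|C|); apply: cvgMr; exact: cvg_harmonic.
by have /(congr1 (@complex.Re R)) := ccvg_uniq L L'.
Qed.

Let nsE x : normsq (S x) = rho x. Proof. by []. Qed.

(** With [Re F = rho / 2] the hypothesis [cubic] compares [rho^2 / 4 - f^2] with [rho^2 / 4 + f^2],
    both integrated against [rho]. *)
Let Cub : rint (fun x => rho x ^+ 3) = 12 * rint (fun x => f x ^+ 2 * rho x).
Proof.
have := cubic.
rewrite (_ : (fun x => normsq (S x) * complex.Re (F x * F x)) =
   (fun x => 4^-1 * rho x ^+ 3 - f x ^+ 2 * rho x)); last first.
  by apply/funext => x; rewrite nsE cReM ReFE -/(f x); field.
rewrite (_ : (fun x => normsq (S x) * normsq (F x)) =
   (fun x => 4^-1 * rho x ^+ 3 + f x ^+ 2 * rho x)); last first.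
  by apply/funext => x; rewrite nsE /normsq ReFE -/(f x); field.
rewrite (rintB (rintgZ 4^-1 irho3) iff) (rintD (rintgZ 4^-1 irho3) iff) (rintZ _ irho3).
lra.
Qed.

Let A x : R[i] := - (0 +i* 1) * P x - F x * S x.

(** The cross term in [Re F] is the current times [- rho], that is [- rho^3 / 2] by [Weq]; the
    square [|F S|^2] returns [rho^3 / 4 + f^2 rho]. *)
Let AE x : normsq (A x) = pp x - 4^-1 * rho x ^+ 3 + f x ^+ 2 * rho x + 2 * (f x * sp x).
Proof.
have -> : normsq (A x) = (p2 x - (complex.Re (F x) * s1 x - f x * s2 x)) ^+ 2 +
    (- p1 x - (complex.Re (F x) * s2 x + f x * s1 x)) ^+ 2.
  by rewrite /A /normsq !ReImE /= /f /s1 /s2 /p1 /p2; ring.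
rewrite ReFE; apply/eqP; rewrite -subr_eq0; apply/eqP.
transitivity (- rho x * (s1 x * p2 x - s2 x * p1 x - rho x ^+ 2 / 2)); last first.
  by rewrite Weq subrr mulr0.
by rewrite /pp /sp /rho; field.
Qed.

Let iA : rintg (fun x => normsq (A x)).
Proof.
rewrite (funext AE).
exact: rintgD (rintgD (rintgB ipp (rintgZ _ irho3)) iff) (rintgZ _ ifsp).
Qed.

Let A0 x : A x = 0.
Proof.
have e : rint (fun x => normsq (A x)) = 0.
  rewrite (funext AE).
  rewrite (rintD (rintgD (rintgB ipp (rintgZ _ irho3)) iff) (rintgZ _ ifsp)).
  rewrite (rintD (rintgB ipp (rintgZ _ irho3)) iff) (rintB ipp (rintgZ _ irho3)).
  rewrite (rintZ _ irho3) (rintZ _ ifsp).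
  have x1 : rint pp = rint (fun x => n1 x * rho x) - c * rint rho.
    rewrite Xeq -(rintN iq) -(rintZ _ irho) -(rintB in1rho (rintgZ _ irho)).
    by congr (rint _); apply/funext => y; ring.
  (* Adding [x1] to [TE] eliminates [c]: [2 int pp = int n1 rho + int rho^3 / 3]. By [Yeq] the term
     in [f sp] is [- int n1 rho / 2], and by [Cub] the cubic terms [1/6 - 1/4 + 1/12] cancel. *)
  by have := T0; have := TE; have := Yeq; have := Cub; move: x1; lra.
have ae := rint_eq0_ae iA (fun x => normsq_ge0 _) e.
have cA : ccont A.
  apply: ccontD; first by apply: ccontM; [exact: ccont_cst|exact: cder_cont dP].
  have [c1 c2] : ccont (fun x => F x * S x).
    by apply: ccontM; [exact: cder_cont dF|exact: cder_cont dS].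
  by split => y; [rewrite (_ : (fun x => _) = (fun x => - complex.Re (F x * S x)));
      [exact: contN|apply/funext => z; rewrite cReN]|
      rewrite (_ : (fun x => _) = (fun x => - complex.Im (F x * S x)));
      [exact: contN|apply/funext => z; rewrite cImN]].
have cn : continuous (fun x => normsq (A x)).
  by apply: contD; apply: contX; [exact: cA.1|exact: cA.2].
apply: cabs_eq0; apply/eqP; rewrite -sqrf_eq0 cabs_normsq; apply/eqP.
exact: (ae0_continuous cn ae x).
Qed.

Let PE x : P x = (0 +i* 1) * F x * S x.
Proof.
have := A0 x; rewrite /A => h.
have -> : P x = (0 +i* 1) * (- (0 +i* 1) * P x).
  rewrite mulrA (_ : (0 +i* 1) * - (0 +i* 1) = 1) ?mul1r//.
  by apply: eq_complexP; rewrite /=; ring.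
by rewrite -mulrA; congr (_ * _); apply/eqP; rewrite -subr_eq0; apply/eqP.
Qed.

Hypothesis M0 : rint (fun x => normsq (S x)) != 0.

(** [P = i F S] gives [int pp = int (rho^3 / 4 + f^2 rho)], which is [int rho^3 / 3] by [Cub];
    [int T = 0] then leaves [c int rho = 0]. *)
Lemma wave_frequency : c = 0.
Proof.
have ppE x : pp x = 4^-1 * rho x ^+ 3 + f x ^+ 2 * rho x.
  have -> : pp x = normsq (P x) by [].
  by rewrite PE normsqM normsqM nsE /normsq ReFE -/(f x) /=; field.
have e : rint pp = 4^-1 * rint (fun x => rho x ^+ 3) + rint (fun x => f x ^+ 2 * rho x).
  by rewrite -(rintZ _ irho3) -(rintD (rintgZ _ irho3) iff) (funext ppE).
have : c * rint rho = 0 by have := T0; have := TE; have := Cub; lra.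
by move/eqP; rewrite mulf_eq0 => /orP[/eqP//|]; rewrite (negbTE M0).
Qed.

Let S_neq0 x : S x != 0.
Proof.
apply/negP => /eqP Sx0.
have [M hM] := bounded.
have cG : ccont (fun x => (0 +i* 1) * F x).
  by apply: ccontM; [exact: ccont_cst|exact: cder_cont dF].
have gb y : cabs ((0 +i* 1) * F y) <= M.
  rewrite cabsM (_ : cabs (0 +i* 1) = 1); first by rewrite mul1r; have [] := hM y.
  by rewrite cabsE /= expr0n expr1n add0r sqrtr1.
have Sz := linear_ode_zero cG gb (eq_cder PE dS) Sx0.
move/eqP: M0; apply; rewrite (_ : (fun x => _) = (fun=> 0)); first exact: rint0.
by apply/funext => y; rewrite (Sz y) /normsq /= expr0n addr0.
Qed.

(** Differentiate [P = i F S], compare with the equation for [P'] at [c = 0], and divide by [S],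
    which never vanishes. *)
Let NE x : N x = 2%:C * (F x * F x).
Proof.
have d := cderM (cderZ (0 +i* 1) dF) dS.
have {}d : cder P (fun x => (0 +i* 1) * ((0 +i* 2^-1) * N x) * S x + (0 +i* 1) * F x * P x).
  by apply: eq_cderl d => y; rewrite PE.
have e : (c%:C - N x) * S x = (0 +i* 1) * ((0 +i* 2^-1) * N x) * S x + (0 +i* 1) * F x * P x.
  apply: eq_complexP.
  - have h1 := dP.1 x; have h2 := d.1 x.
    by rewrite -(@derive_val _ _ _ _ _ _ _ h1) -(@derive_val _ _ _ _ _ _ _ h2).
  - have h1 := dP.2 x; have h2 := d.2 x.
    by rewrite -(@derive_val _ _ _ _ _ _ _ h1) -(@derive_val _ _ _ _ _ _ _ h2).
apply: (mulIf (S_neq0 x)); apply/eqP; rewrite -subr_eq0; apply/eqP.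
move: e; rewrite wave_frequency PE.
move: (N x) (F x) (S x) => a b z /eqP; rewrite -subr_eq0 => /eqP h.
transitivity (- 2%:C * ((0%:C - a) * z - ((0 +i* 1) * ((0 +i* 2^-1) * a) * z +
   (0 +i* 1) * b * ((0 +i* 1) * b * z)))); last by rewrite h mulr0.
by clear h; case: a b z => [a1 a2] [b1 b2] [z1 z2]; apply: eq_complexP; rewrite /=; field.
Qed.

(** Division by [F] away from 0 is avoided: with [L = 1 / F(0) - i x] and [C = S(0) / F(0)], both
    [F L - 1] and [S - C F] solve [U' = i F U] and vanish at 0. *)
Lemma wave_explicit : exists (k1 k2 : R) (C : R[i]),
  [/\ 0 < k1, normsq C = 2 * k1 & forall x, S x * ((x - k2) +i* k1) = C].
Proof.
have [M hM] := bounded.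
have cG : ccont (fun x => (0 +i* 1) * F x).
  by apply: ccontM; [exact: ccont_cst|exact: cder_cont dF].
have gb y : cabs ((0 +i* 1) * F y) <= M.
  rewrite cabsM (_ : cabs (0 +i* 1) = 1); first by rewrite mul1r; have [] := hM y.
  by rewrite cabsE /= expr0n expr1n add0r sqrtr1.
have dF' : cder F (fun x => (0 +i* 1) * F x * F x).
  apply: eq_cder dF => x; rewrite NE.
  by move: (F x) => [a b]; apply: eq_complexP; rewrite /=; field.
have rho_gt0 : 0 < rho 0.
  rewrite lt_neqAle rho0 andbT eq_sym; apply/eqP => h.
  have := S_neq0 0; apply/negP; rewrite negbK; apply/eqP; apply: cabs_eq0.
  by apply/eqP; rewrite -sqrf_eq0 cabs_normsq nsE h.
have F0 : F 0 != 0.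
  by apply/eqP => h; have := ReFE 0; rewrite h /=; lra.
pose k := (F 0)^-1; pose C := S 0 * k.
have Fk : F 0 * k = 1 by rewrite divff.
pose k1 := complex.Re k; pose k2 := complex.Im k.
pose L (x : R) : R[i] := k1 +i* (k2 - x).
have kE : k = L 0 by apply: eq_complexP; rewrite /L /= ?subr0.
have dL : cder L (fun=> 0 +i* (-1)).
  by split=> x /=; apply: is_derive_eq; rewrite /GRing.scale/=; ring.
have U x : F x * L x - 1 = 0.
  apply: (linear_ode_zero (U := fun x => F x * L x - 1) cG gb (x0 := 0)); last first.
    by rewrite -kE Fk subrr.
  apply: eq_cder (cderD (cderM dF' dL) (cder_cst (-1))) => y.
  by move: (F y) (L y) => [a b] [a' b']; apply: eq_complexP; rewrite /=; ring.
have V x : S x - C * F x = 0.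
  apply: (linear_ode_zero (U := fun x => S x - C * F x) cG gb (x0 := 0)); last first.
    by rewrite /C -mulrA [k * _]mulrC Fk mulr1 subrr.
  have d := cderD dS (cderZ (- C) dF').
  apply: (eq_cderl _ (eq_cder _ d)) => y; first by rewrite mulNr.
  by rewrite PE; move: (F y) (S y) (C) => [a b] [a' b'] [a'' b'']; apply: eq_complexP; rewrite /=; ring.
(* The real part of [1 / F 0], where [Re (F 0) = rho 0 / 2]. It gives both [k1 > 0] and the
   normalisation [2 k1] of the constant. *)
have k1E : k1 = rho 0 / 2 * normsq k.
  have h : F 0 * (normsq k)%:C = k^*%C by rewrite -mul_conj mulrA Fk mul1r.
  have := congr1 (@complex.Re R) h; rewrite cReM ReFE cReJ -/k1 => <-.
  by rewrite /= mulr0 subr0.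
have nk : 0 < normsq k.
  rewrite lt_neqAle normsq_ge0 andbT eq_sym; apply/eqP => h.
  have k0 : k = 0.
    by apply: cabs_eq0; apply/eqP; rewrite -sqrf_eq0 cabs_normsq h.
  by move/eqP: Fk; rewrite k0 mulr0 eq_sym oner_eq0.
exists k1, k2, ((0 +i* 1) * C); split.
- rewrite k1E; apply: mulr_gt0 nk; exact: divr_gt0.
- rewrite normsqM normsqM nsE.
  have -> : normsq (0 +i* 1 : R[i]) = 1 by rewrite /normsq /=; ring.
  by rewrite k1E; field.
- move=> x; have {}U : F x * L x = 1 by apply/eqP; rewrite -subr_eq0; apply/eqP; exact: U.
  have {}V : S x = C * F x by apply/eqP; rewrite -subr_eq0; apply/eqP; exact: V.
  have -> : (x - k2) +i* k1 = (0 +i* 1) * L x by apply: eq_complexP; rewrite /=; ring.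
  rewrite V mulrCA -mulrA; congr (_ * _).
  by rewrite -mulrA U mulr1.
Qed.

End Energy.

(** * Solitons, their mass and the sign of the velocity *)

Section Classification.
Context {R : realType}.
Local Notation mu := (@lebesgue_measure R).
Local Notation cabs := (@Normc.normc R).

Lemma rint_poisson_line (k b : R) : 0 < k ->
  rintg (fun x => poisson k (x - b)) /\ rint (fun x => poisson k (x - b)) = 2 * pi.
Proof.
move=> k0.
have d (x : R) : is_derive x 1 (fun x : R => 2 * atan (x / k)) (poisson k x).
  have dk : is_derive x 1 (fun x : R => x / k) k^-1.
    by apply: is_derive_eq; rewrite /GRing.scale/=; ring.
  have da := @is_derive1_comp _ atan (fun x : R => x / k) x _ _ (is_derive1_atan (x / k)) dk.
  apply: is_derive_eq; rewrite /GRing.scale/= /poisson.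
  have h : 0 < k ^+ 2 + x ^+ 2 by rewrite ltr_pwDl ?sqr_ge0 ?exprn_gt0.
  by field; rewrite !gt_eqF//.
have cp : continuous (fun x : R => poisson k x).
  have := continuous_poisson (x := 0) k0.
  rewrite (_ : (fun a => _) = (fun x => poisson k x))//.
  by apply/funext => x; rewrite /poisson sub0r sqrrN.
have ip : rintg (fun x => poisson k x).
  apply: (ge0_rintg_FTC (M := pi) cp _ d) => x; first exact: poisson_ge0.
  have h1 := atan_gtNpi2 (x / k); have h2 := atan_ltpi2 (x / k).
  by rewrite ler_norml; apply/andP; split; lra.
split; first exact: (rintg_shift (- b) ip).
rewrite (rint_shift (- b) ip).
have L := rint_FTC_R cp ip d.
have L' := @cvg_atan_sg R k^-1.
rewrite gtr0_sg ?invr_gt0// mulr1 in L'.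
(* [cvg_atan_sg] runs over [n.+1], hence the windows are shifted by one. *)
have L1 := L; rewrite -cvg_shiftS /= in L1.
have e : (fun n : nat => 2 * atan (n.+1%:R / k) - 2 * atan (- n.+1%:R / k)) =
   (fun n : nat => 2 * (2 * atan (k^-1 / (n.+1%:R)^-1))).
  by apply/funext => n; rewrite invrK mulNr atanN [k^-1 * _]mulrC; ring.
rewrite e in L1.
have L2 : 2 * (2 * atan (k^-1 / (n.+1%:R)^-1)) @[n --> \oo] --> 2 * (pi : R).
  by apply: cvgMr.
exact: (cvg_unique _ L1 L2).
Qed.

Lemma normsq_profile (x : R) : normsq (profile x) = poisson 1 x.
Proof.
have h : 0 < 1 + x ^+ 2 by rewrite ltr_pwDl ?sqr_ge0.
have e : profile x * (x +i* 1) = (Num.sqrt 2)%:C.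
  by rewrite /profile divfK//; apply/eqP => /(congr1 (@complex.Im R))/=; lra.
have h2 : normsq (profile x) * (x ^+ 2 + 1) = 2.
  have <- : normsq (x +i* 1) = x ^+ 2 + 1 by rewrite /normsq /= expr1n.
  by rewrite -normsqM e /normsq /= expr0n addr0 sqr_sqrtr.
have n0 : x ^+ 2 + 1 != 0 by rewrite addrC gt_eqF.
apply: (mulIf n0); rewrite h2 /poisson expr1n mulr1 [1 + _]addrC.
by rewrite -mulrA mulVf// mulr1.
Qed.

Lemma complex_polar (z : R[i]) : z != 0 ->
  exists theta : R, 0 <= theta < 2 * pi /\ z = (cabs z)%:C * expi theta.
Proof.
move=> z0; pose r := cabs z.
have r0 : 0 < r.
  rewrite lt_neqAle cabs_ge0 andbT eq_sym; apply: contra z0 => /eqP h.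
  by apply/eqP; exact: cabs_eq0.
pose a := complex.Re z / r; pose b := complex.Im z / r.
have ab : a ^+ 2 + b ^+ 2 = 1.
  have h : r ^+ 2 = complex.Re z ^+ 2 + complex.Im z ^+ 2 by rewrite cabs_normsq.
  by rewrite /a /b !expr_div_n -mulrDl -h divff// expf_neq0// gt_eqF.
have a1 : -1 <= a <= 1 by apply/andP; split; have := sqr_ge0 b; nra.
have zE th : cos th = a -> sin th = b -> z = r%:C * expi th.
  move=> ha hb; apply: eq_complexP; rewrite /expi ha hb /a /b /=; field; rewrite gt_eqF//.
have c0 := acos_ge0 a1; have cp := acos_lepi a1.
have p0 := pi_gt0 R.
have [b0|b0] := leP 0 b.
- exists (acos a); split; first by apply/andP; split; lra.
  apply: zE; first exact: acosK.
  by rewrite sin_acos// (_ : 1 - a ^+ 2 = b ^+ 2) ?sqrtr_sqr ?ger0_norm//; lra.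
(* The strict bound [theta < 2 pi] holds since [acos a = 0] would force [a = 1] and [b = 0]. *)
- exists (2 * pi - acos a); split.
    apply/andP; split; first by lra.
    suff : acos a != 0 by move=> h; have : 0 < acos a by [rewrite lt_neqAle eq_sym h|]; lra.
    apply/eqP => h; have := acosK a1; rewrite h cos0 => h1.
    by move: ab; rewrite -h1; nra.
  apply: zE.
  + by rewrite addrC mulr_natl cosD2pi cosN; exact: acosK.
  + rewrite addrC mulr_natl sinD2pi sinN sin_acos// (_ : 1 - a ^+ 2 = b ^+ 2); last by lra.
    by rewrite sqrtr_sqr ltr0_norm// opprK.
Qed.

(** The integral of [|f - g|^2] is zero and translation invariant, so the translated difference
    vanishes almost everywhere as well. *)
Lemma sqintg_ae_shift (f g : R -> R[i]) (a : R) : sqintg f -> sqintg g ->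
  {ae mu, forall x, f x = g x} -> {ae mu, forall x, f (x + a) = g (x + a)}.
Proof.
move=> sf sg e.
have [md sd] := sqintgD sf (sqintgN sg).
have z : rint (fun x => normsq (f x - g x)) = 0.
  rewrite -[RHS](@rint0 R); apply: rint_ae; [exact: rintg_meas|exact: measurable_cst|].
  by apply: ae_mono e => x ->; rewrite subrr /normsq /= expr0n addr0.
rewrite -(rint_shift a sd) in z.
apply: ae_mono (rint_eq0_ae (rintg_shift a sd) (fun x => normsq_ge0 _) z) => x h.
apply/eqP; rewrite -subr_eq0; apply/eqP/cabs_eq0/eqP.
by rewrite -sqrf_eq0 cabs_normsq h.
Qed.

Lemma normsq0 : normsq (0 : R[i]) = 0.
Proof. by rewrite /normsq /= expr0n addr0. Qed.

Lemma cabsV (z : R[i]) : z != 0 -> cabs z^-1 = (cabs z)^-1.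
Proof.
move=> z0; have h : cabs z^-1 * cabs z = 1.
  by rewrite -cabsM mulVf// cabsE /= expr1n expr0n addr0 sqrtr1.
have z1 : cabs z != 0 by apply: contra z0 => /eqP/cabs_eq0/eqP.
by rewrite -[LHS]mulr1 -(divff z1) mulrA h mul1r.
Qed.

(* Otherwise [C / eps], the Laplace transform of [C] at [eps], would be the
   integral of [qh] against a kernel which stays bounded as [eps -> 0]. *)
Lemma velocity_ge0 (v : R) (q : R -> R[i]) (z0 C : R[i]) : cintg q ->
  (forall xi : R, xi < 0 -> q xi = 0) -> C != 0 ->
  (forall x, invft q x * (x%:C + z0) = C * expi (v / 2 * x)) -> 0 <= v.
Proof.
move=> iq q0 C0 hC; rewrite leNgt; apply/negP => v0.
pose a := - (v / 2).
have a0 : 0 < a by rewrite /a; lra.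
pose c : R[i] := (2 * pi)^-1%:C.
pose K := a^-1 ^+ 2 + cabs z0 * a^-1.
have K0 : 0 <= K by rewrite addr_ge0 ?sqr_ge0// mulr_ge0 ?cabs_ge0// invr_ge0 ltW.
have key (e : R) : 0 < e -> cabs C / e <= cabs c * (K * rint (fun xi => cabs (q xi))).
  move=> e0.
  (* The factor [x + z0] cancels the denominator of [invft q] and the frequency [a] cancels its
     phase; what remains is [C] times the integral of [e^(-e x)] on the half line. *)
  pose k x : R[i] := (half_line x)%:C * ((x%:C + z0) * half_exp e a x).
  have i1 := cintg_half_exp a e0; have i2 := cintg_x_half_exp a e0.
  have kE x : k x = (half_line x)%:C * (x%:C * half_exp e a x) +
      z0 * ((half_line x)%:C * half_exp e a x) by rewrite /k; ring.
  have ik : cintg k by rewrite (funext kE); apply: cintgD i2 _; exact: cintgZ.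
  have e1 : cint (fun x => k x * invft q x) = C / e%:C.
    rewrite (_ : C / e%:C = C * (e +i* - 0)^-1); last by rewrite oppr0.
    rewrite -(cint_half_exp 0 e0) -(cintZ _ (cintg_half_exp 0 e0)).
    apply: eq_cint => x.
    have -> : k x * invft q x = (half_line x)%:C * half_exp e a x * (invft q x * (x%:C + z0)).
      by rewrite /k; ring.
    have ee : half_exp e a x * expi (v / 2 * x) = half_exp e 0 x.
      by rewrite /half_exp -mulrA -expiD; congr (_ * expi _); rewrite /a; ring.
    by rewrite hC -ee; ring.
  have mf : cmeas2 (fun x xi => k x * (q xi * expi (x * xi))).
    apply: cmeas2M; first exact: cmeas2_fst ik.1.
    apply: cmeas2M; first exact: cmeas2_snd iq.1.
    apply: (cmeas2_comp (f := @expi R) (h := fun p : R * R => p.1 * p.2)).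
      exact: cmeas_expi (@measurable_id _ _ setT).
    by apply: measurable_funM; [exact: measurable_fst|exact: measurable_snd].
  have bf x xi : cabs (k x * (q xi * expi (x * xi))) <= cabs (k x) * cabs (q xi).
    by rewrite cabsM cabs_mul_expi.
  have [j0 j1 F1] := cfubini_prod mf ik.2 iq.2 (fun x => cabs_ge0 _) (fun x => cabs_ge0 _) bf.
  have e2 : cint (fun x => k x * invft q x) = c * cint (fun x => cint (fun xi => k x * (q xi * expi (x * xi)))).
    have e3 x : cint (fun xi => k x * (q xi * expi (x * xi))) = k x * ift q x.
      by rewrite (cintZ _ (cintg_ift x iq)).
    rewrite -(cintZ c j0); apply: eq_cint => x.
    by rewrite e3 /invft mulrCA.
  have in_ xi : cint (fun x => k x * (q xi * expi (x * xi))) =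
      q xi * ((e +i* - (a + xi))^-2 + z0 * (e +i* - (a + xi))^-1).
    have l1 := cintg_half_exp (a + xi) e0; have l2 := cintg_x_half_exp (a + xi) e0.
    rewrite -(cint_half_exp (a + xi) e0) -(cint_x_half_exp (a + xi) e0).
    rewrite -(cintZ z0 l1) -(cintD l2 (cintgZ z0 l1)) -(cintZ (q xi) (cintgD l2 (cintgZ z0 l1))).
    apply: eq_cint => x; rewrite kE.
    have -> : half_exp e (a + xi) x = half_exp e a x * expi (x * xi).
      by rewrite /half_exp -mulrA -expiD; congr (_ * expi _); ring.
    ring.
  (* Since [v < 0] makes [a] positive, [a + xi] stays above [a] on the spectrum of [q]; the bound
     [K] is uniform in [e]. *)
  have b xi : 0 <= xi -> cabs ((e +i* - (a + xi))^-2 + z0 * (e +i* - (a + xi))^-1) <= K.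
    move=> xi0; pose w : R[i] := e +i* - (a + xi).
    have w0 : w != 0 := Complex_neq0 _ e0.
    have aw : a <= cabs w.
      apply: le_trans (Im_le_cabs w); rewrite /= normrN ger0_norm; lra.
    have cV := cabsV w0.
    have hv (t : R) : a <= t -> t^-1 <= a^-1.
      by move=> at'; have t0 := lt_le_trans a0 at'; rewrite lef_pV2.
    have wV : cabs w^-1 <= a^-1 by rewrite cV; exact: hv.
    apply: le_trans (cabsD _ _) _; rewrite /K; apply: lerD.
      have -> : w ^- 2 = w^-1 * w^-1 by rewrite expr2 invfM.
      by rewrite cabsM expr2; exact: (ler_pM (cabs_ge0 _) (cabs_ge0 _) wV wV).
    by rewrite cabsM; exact: (ler_wpM2l (cabs_ge0 _) wV).
  have h : cabs (cint (fun x => k x * invft q x)) <= cabs c * (K * rint (fun xi => cabs (q xi))).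
    rewrite e2 F1 (cabsM c); apply: (ler_wpM2l (cabs_ge0 c)).
    apply: le_trans (cint_le j1) _; rewrite -(rintZ _ iq.2).
    apply: rint_le; [exact: j1.2|exact: rintgZ iq.2|move=> xi].
    rewrite in_ cabsM [leRHS]mulrC; have [xi0|xi0] := leP 0 xi.
      exact: (ler_wpM2l (cabs_ge0 _) (b xi xi0)).
    by rewrite (q0 xi xi0) cabs0 !mul0r.
  move: h; rewrite e1 cabsM cabsV.
    by rewrite (cabsR e) gtr0_norm.
  by apply/eqP => /(congr1 (@complex.Re R))/= h; rewrite h ltxx in e0.
have C1 : 0 < cabs C.
  rewrite lt_neqAle cabs_ge0 andbT eq_sym; apply: contra C0 => /eqP h.
  by apply/eqP; exact: cabs_eq0.
set B := cabs c * _ in key.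
have B0 : 0 <= B.
  by rewrite mulr_ge0 ?cabs_ge0// mulr_ge0//; apply: rint_ge0 => x; exact: cabs_ge0.
have B1 : 0 < B + 1 by lra.
(* The choice [e = |C| / (B + 1)] turns the estimate into [B + 1 <= B]. *)
have := key _ (divr_gt0 C1 B1); rewrite invf_div mulrCA divff ?gt_eqF//; lra.
Qed.

Lemma regular_wave_explicit (omega v : R) (Q0 Q1 N0 F : R -> R[i]) :
  regular_wave omega v Q0 Q1 N0 F -> rint (fun x => normsq (Q0 x)) != 0 ->
  exists (k1 k2 : R) (C : R[i]), [/\ omega = v ^+ 2 / 4, 0 < k1, normsq C = 2 * k1 &
    forall x, Q0 x * ((x - k2) +i* k1) = C * expi (v / 2 * x)].
Proof.
case=> dQ dQ1 cN dF ReF bd sQ sN cubic ImNN M0.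
(* Galilean gauge: this phase removes the first-order term [i v Q'] and turns [omega] into
   [omega - v^2 / 4]. *)
pose s := - (v / 2); pose e (x : R) : R[i] := expi (x * s).
have de : cder e (fun x => (0 +i* s) * e x) := cder_expi_linear s.
pose S x := e x * Q0 x; pose P x := (0 +i* s) * S x + e x * Q1 x.
have dS : cder S P.
  by apply: eq_cder (cderM de dQ) => x; rewrite /P /S mulrA.
have nS : (fun x => normsq (S x)) = (fun x => normsq (Q0 x)).
  by apply/funext => x; exact: normsq_expi.
have dP : cder P (fun x => ((omega - v ^+ 2 / 4)%:C - N0 x) * S x).
  apply: eq_cder (cderD (cderZ (0 +i* s) dS) (cderM de dQ1)) => x.
  rewrite /P /S /s; move: (e x) (Q0 x) (Q1 x) (N0 x) => [e1 e2] [q1 q2] [p1 p2] [n1 n2].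
  by apply: eq_complexP; rewrite /=; field.
have ReF' x : F x + (F x)^*%C = (normsq (S x))%:C by rewrite ReF -(congr1 (@^~ x) nS).
have bd' : exists M : R, forall x,
    [/\ cabs (S x) <= M, cabs (P x) <= M, cabs (F x) <= M & cabs (N0 x) <= M].
  have [M hM] := bd; exists (M + `|s| * M) => x; have [h1 h2 h3 h4] := hM x.
  have M1 : 0 <= M := le_trans (cabs_ge0 _) h1.
  have s1 : 0 <= `|s| * M by rewrite mulr_ge0.
  have eS : cabs (S x) = cabs (Q0 x) by rewrite /S mulrC cabs_mul_expi.
  have up (t : R) : t <= M -> t <= M + `|s| * M by move=> h; apply: le_trans h _; rewrite lerDl.
  split; [by rewrite eS; exact: up| |exact: up|exact: up].
  apply: le_trans (cabsD _ _) _; rewrite [leRHS]addrC; apply: lerD.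
    rewrite cabsM eS; have -> : cabs (0 +i* s) = `|s| by rewrite cabsE /= expr0n add0r sqrtr_sqr.
    by apply: ler_wpM2l.
  by rewrite mulrC cabs_mul_expi.
have sS : sqintg S.
  split; last by rewrite nS; exact: sQ.2.
  by apply: cmeasM sQ.1; apply: ccont_meas; exact: cder_cont de.
have cubic' : 2 * rint (fun x => normsq (S x) * complex.Re (F x * F x)) =
    rint (fun x => normsq (S x) * normsq (F x)).
  rewrite (_ : (fun x => _) = (fun x => normsq (Q0 x) * complex.Re (F x * F x))); last first.
    by apply/funext => x; rewrite -(congr1 (@^~ x) nS).
  rewrite cubic; congr (rint _); apply/funext => x; by rewrite -(congr1 (@^~ x) nS).
have M0' : rint (fun x => normsq (S x)) != 0 by rewrite nS.
have c0 := wave_frequency dS dP cN dF ReF' bd' sS sN cubic' ImNN M0'.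
have [k1 [k2 [C [h1 h2 h3]]]] := wave_explicit dS dP cN dF ReF' bd' sS sN cubic' ImNN M0'.
exists k1, k2, C; split; [by apply/eqP; rewrite -subr_eq0 c0|exact: h1|exact: h2|move=> x].
rewrite -(h3 x) /S mulrC [RHS]mulrC mulrA mulrA -expiD mulrC.
have -> : v / 2 * x + x * s = 0 by rewrite /s; ring.
by rewrite expi0 mul1r mulrC.
Qed.

Lemma soliton_normsq (Q0 : R -> R[i]) (w k1 k2 : R) (C : R[i]) : 0 < k1 ->
  normsq C = 2 * k1 -> (forall x, Q0 x * ((x - k2) +i* k1) = C * expi (w * x)) ->
  forall x, normsq (Q0 x) = poisson k1 (x - k2).
Proof.
move=> k0 nC hQ x; have := congr1 (@normsq R) (hQ x).
rewrite normsqM [C * _]mulrC normsq_expi nC => e.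
have n0 : k1 ^+ 2 + (x - k2) ^+ 2 != 0 by rewrite gt_eqF// ltr_pwDl ?sqr_ge0 ?exprn_gt0.
apply: (mulIf n0); rewrite /poisson -[RHS]mulrA mulVf// mulr1 -e /normsq /=.
by rewrite [X in _ * X]addrC.
Qed.

Lemma soliton_profile (Q0 : R -> R[i]) (w k1 k2 theta : R) (C : R[i]) : 0 < k1 ->
  normsq C = 2 * k1 -> C = (cabs C)%:C * expi theta ->
  (forall x, Q0 x * ((x - k2) +i* k1) = C * expi (w * x)) ->
  forall x, Q0 x = expi (theta + w * x) * (Num.sqrt k1^-1)%:C *
    profile (k1^-1 * x - k2 / k1).
Proof.
move=> k0 nC polC hQ x.
have n0 : (x - k2) +i* k1 != 0 :> R[i].
  by apply/eqP => /(congr1 (@complex.Im R))/= h; rewrite h ltxx in k0.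
have n1 : (k1^-1 * x - k2 / k1) +i* 1 != 0 :> R[i].
  by apply/eqP => /(congr1 (@complex.Im R))/= h; lra.
apply: (mulIf n0); rewrite hQ.
have -> : (x - k2) +i* k1 = k1%:C * ((k1^-1 * x - k2 / k1) +i* 1).
  by apply: eq_complexP; rewrite /=; field; rewrite gt_eqF.
(* [|C| = sqrt (2 k1)], split so that the amplitude [sqrt 2] of [profile], the scaling factor
   [sqrt (1 / k1)] and the factor [k1] taken out of the denominator appear. *)
have cC : cabs C = Num.sqrt 2 * Num.sqrt k1^-1 * k1.
  apply/eqP; rewrite -(@eqrXn2 _ 2)//.
  - rewrite cabs_normsq nC !exprMn !sqr_sqrtr// ?invr_ge0 ?ltW//.
    by apply/eqP; field; rewrite gt_eqF.
  - exact: cabs_ge0.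
  - by rewrite !mulr_ge0 ?sqrtr_ge0// ltW.
rewrite {1}polC cC /profile (realCM (_ * _) k1) (realCM (Num.sqrt 2)) expiD.
move: (expi theta) (expi (w * x)) ((Num.sqrt 2)%:C) ((Num.sqrt k1^-1)%:C) (k1%:C) => a b d g i.
move: (_ +i* 1) n1 => j j0.
by field.
Qed.

End Classification.

Theorem theorem1p2 (R : realType) (u : R -> R -> R[i])
    (hu : traveling_solitary_wave u) :
  (exists theta y lambda eta : R,
     [/\ 0 <= theta < 2 * pi, 0 < lambda, 0 <= eta &
         forall t : R, {ae @lebesgue_measure R, forall x : R,
           u t x = expi (theta + eta * x - eta ^+ 2 * t)
                   * (Num.sqrt lambda)%:C
                   * profile (lambda * (x - 2 * eta * t) + y)}]) /\
  (forall t : R, mass (u t) = mass (@profile R)) /\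
  mass (@profile R) = (2 * pi)%:E.
Proof.
have [[h1 [N [hN weak]]] [omega [v [Q [hQ Qn0 uQ]]]]] := hu.
have su t := H1plus_sqintg (h1 t).
have sQ := H1plus_sqintg hQ.
have [Qh [fQ wQ Qneg]] := hQ.
have [_ /L2P sQh _] := fQ.
have w0 xi : 0 <= (1 + xi ^+ 2) * normsq (Qh xi).
  by rewrite mulr_ge0 ?normsq_ge0// addr_ge0 ?sqr_ge0.
have iw : rintg (fun xi => (1 + xi ^+ 2) * normsq (Qh xi)).
  apply/(rintg_ge0P _ w0); last exact: wQ.
  apply: measurable_funM; last exact: meas_normsq sQh.1.
  by apply: measurable_funD; [exact: measurable_cst|exact: measurable_funX].
have [Nh [fN eN]] := wave_N_fourier sQ su hN uQ 0.
have eN' : {ae @lebesgue_measure R, forall xi, Nh xi = (xi + `|xi|)%:C * ft (density Q) xi}.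
  by apply: ae_mono eN => xi ->; rewrite mulr0 mul0r oppr0 expi0 mul1r.
have iNQ := cintg_NQ sQ su hN uQ.
have prof := profile_fourier sQ iNQ (weak_profile_exp sQ su hN uQ weak) fQ.
have [Q0 [Q1 [N0 [F [QE Q0E iQh reg]]]]] := profile_regular fQ iw fN eN' prof.
have sQ0 := wave_Q_sqintg reg.
have M0 : rint (fun x => normsq (Q0 x)) != 0.
  apply/eqP => h; apply: Qn0.
  apply: ae_mono2 QE (rint_eq0_ae sQ0.2 (fun x => normsq_ge0 _) h) => x -> h0.
  by apply: cabs_eq0; apply/eqP; rewrite -sqrf_eq0 cabs_normsq h0.
have [k1 [k2 [C [ov k10 nC hC]]]] := regular_wave_explicit reg M0.
have C0 : C != 0.
  apply/eqP => h; have e := nC; rewrite h normsq0 in e; move: k10; lra.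
have v0 : 0 <= v.
  (* The spectral condition holds only almost everywhere, while [velocity_ge0] asks for it
     everywhere; truncation does not change the inverse transform. *)
  pose q xi := (half_line xi)%:C * Qh xi.
  have iq : cintg q.
    apply: (cintg_bdM (M := 1) _ _ iQh); first exact: cmeasR measurable_half_line.
    move=> xi; rewrite cabsR; have [h|h] := leP 0 xi; first by rewrite half_line_ge0// normr1.
    by rewrite half_line_lt0// normr0.
  have qE : {ae @lebesgue_measure R, forall xi, Qh xi = q xi}.
    apply: ae_mono Qneg => xi h; rewrite /q; have [xi0|xi0] := leP 0 xi.
      by rewrite half_line_ge0// mul1r.
    by rewrite (h xi0) mulr0.
  apply: (@velocity_ge0 _ v q (- k2 +i* k1) C iq _ C0).
    by move=> xi xi0; rewrite /q half_line_lt0// mul0r.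
  move=> x; rewrite -(invft_ae x iQh iq qE) -Q0E -hC; congr (_ * _).
  by apply: eq_complexP; rewrite /= ?add0r.
have [theta [th polC]] := complex_polar C0.
have QtE t : {ae @lebesgue_measure R, forall x, u t x = expi (omega * t) * Q0 (x - v * t)}.
  by apply: ae_mono2 (uQ t) (sqintg_ae_shift (- (v * t)) sQ sQ0 QE) => x -> ->.
have nQ := soliton_normsq k10 nC hC.
have mprof : mass (@profile R) = (2 * pi)%:E.
  have [ip ep] := rint_poisson_line 0 (@ltr01 R).
  rewrite /mass -ep -(rint_EFin ip); apply: eq_integral => x _.
  by rewrite normsq_profile subr0.
split; [|split => // t].
(* The width [k1] fixes the scale and [k2] the position; [eta] is half the velocity, so that
   [2 eta t = v t]. *)
- exists theta, (- k2 / k1), k1^-1, (v / 2); split => //; first by rewrite invr_gt0.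
    by rewrite divr_ge0.
  move=> t; apply: ae_mono (QtE t) => x ->.
  rewrite (soliton_profile k10 nC polC hC).
  have mul4 (a b d e : R[i]) : a * (b * d * e) = a * b * d * e by rewrite !mulrA.
  rewrite mul4 -expiD; congr (expi _ * _ * profile _).
  (* With [omega = v^2 / 4] the phase [omega t + (v / 2) (x - v t)] becomes [eta x - eta^2 t]. *)
  + by rewrite ov; field.
  + by field; rewrite gt_eqF.
(* The density is a Poisson kernel, whose total mass does not depend on its width or position. *)
- have [ip ep] := rint_poisson_line k2 k10.
  rewrite mprof -ep -(rint_shift (- (v * t)) ip) /mass (rint_EFin (su t).2); congr (_%:E).
  apply: rint_ae; [exact: rintg_meas (su t).2|exact: rintg_meas (rintg_shift _ ip)|].
  by apply: ae_mono (QtE t) => x ->; rewrite normsq_expi nQ.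
Qed.
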